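(* Let $q>1$ be a constant. Let $\Omega\subset\mathbb{R}^2$ be a $C^2$ domain which is star-shaped with respect to the origin with an admissible radius function $\rho$ (with respect to $q$). Assume that there is a relatively open subset $\mathcal{N}$ of $[0,2\pi)$ (viewed in $\mathbb{R}/(2\pi\mathbb{Z})$) with $|\mathcal{N}|=\pi$ and $\overline{\mathcal{N}\cup(\mathcal{N}+\pi)}=[0,2\pi)$ (in the sense of $\mathbb{R}/(2\pi\mathbb{Z})$) such that $\rho'=0$ in $\mathcal{N}$ and $\rho'\neq0$ almost everywhere in $\mathcal{N}+\pi$. Let $\phi$ be a $C^1$ function on $\mathbb{S}^1$ which is not identically zero. Then there are at most finitely many wave numbers $k>0$ such that $\Omega$ is non-scattering in the presence of the incident wave $v=\mathbf{H}[k,\phi]$.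
   Context: We identify $\mathbb{S}^1$ with $[0,2\pi)$ (and with $\mathbb{R}/(2\pi\mathbb{Z})$) via $\theta\mapsto\vec\theta=(\cos\theta,\sin\theta)^T$; for $\xi\in\mathbb{S}^1$, $\theta_\xi$ denotes its angular coordinate. A bounded, simply connected $C^2$ domain $\Omega\subset\mathbb{R}^2$ containing the origin is star-shaped with respect to the origin if $\partial\Omega=\{\rho(\theta)\vec\theta:\theta\in[0,2\pi)\}$ for a positive $2\pi$-periodic $C^2$ function $\rho$, called its radius function. Given $q>1$, $\rho$ is admissible (with respect to $q$) if $(\ln\rho)''(t)<\sqrt{q}/(1+\sqrt{q})$ for all $t$. For $k>0$ and $\phi\in L^2(\mathbb{S}^1)$ the Herglotz wave is $\mathbf{H}[k,\phi](x)=\int_{-\pi}^{\pi}\phi(\xi)e^{\mathrm{i}k\xi\cdot x}\,d\theta_\xi$. $\Omega$ is non-scattering in the presence of $\mathbf{H}[k,\phi]$ (index of refraction the constant $q$) if there exists $u\in H^1(\Omega)$ with $\Delta u+k^2qu=0$ in $\Omega$ and $u=\mathbf{H}[k,\phi]$, $\partial_\nu u=\partial_\nu\mathbf{H}[k,\phi]$ on $\partial\Omega$. *)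

(* Defs.v *)
From HB Require Import structures.
From mathcomp Require Import all_boot all_order all_algebra.
From mathcomp Require Import all_classical all_reals all_analysis.
Set Implicit Arguments. Unset Strict Implicit. Unset Printing Implicit Defensive.
Import Order.TTheory GRing.Theory Num.Theory.
Import numFieldNormedType.Exports.
Local Open Scope classical_set_scope.
Local Open Scope ring_scope.

Section Defs.
Variable R : realType.

Definition leb2 := ((@lebesgue_measure R) \x (@lebesgue_measure R))%E.

Definition partial1 (f : R * R -> R) : R * R -> R :=
  fun x => derive1 (fun s => f (s, x.2)) x.1.
Definition partial2 (f : R * R -> R) : R * R -> R :=
  fun x => derive1 (fun s => f (x.1, s)) x.2.

Fixpoint iter_partial (s : seq bool) (f : R * R -> R) : R * R -> R :=
  match s with
  | [::] => f
  | b :: s' => (if b then partial2 else partial1) (iter_partial s' f)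
  end.

Definition smooth2 (f : R * R -> R) : Prop :=
  forall s : seq bool,
    continuous (iter_partial s f) /\
    forall x : R * R,
      derivable (fun t => iter_partial s f (t, x.2)) x.1 1 /\
      derivable (fun t => iter_partial s f (x.1, t)) x.2 1.

Definition support2 (f : R * R -> R) : set (R * R) := [set x | f x != 0].

Definition test_fun (Om : set (R * R)) (f : R * R -> R) : Prop :=
  smooth2 f /\ compact (closure (support2 f)) /\ closure (support2 f) `<=` Om.

Definition L2 (Om : set (R * R)) (f : R * R -> R) : Prop :=
  measurable_fun Om f /\ leb2.-integrable Om (fun x => (f x ^+ 2)%:E).

Definition weak_grad (Om : set (R * R)) (f g1 g2 : R * R -> R) : Prop :=
  forall phi, test_fun Om phi ->
    (\int[leb2]_(x in Om) (f x * partial1 phi x)%:E = - \int[leb2]_(x in Om) (g1 x * phi x)%:E)%E /\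
    (\int[leb2]_(x in Om) (f x * partial2 phi x)%:E = - \int[leb2]_(x in Om) (g2 x * phi x)%:E)%E.

Definition H1 (Om : set (R * R)) (f g1 g2 : R * R -> R) : Prop :=
  L2 Om f /\ L2 Om g1 /\ L2 Om g2 /\ weak_grad Om f g1 g2.

Definition star_domain (rho : R -> R) : set (R * R) :=
  [set x | exists r t, 0 <= r < rho t /\ x = (r * cos t, r * sin t)].

Definition radius_function (rho : R -> R) : Prop :=
  (forall t, 0 < rho t) /\ (forall t, rho (t + 2 * pi) = rho t) /\
  (forall t, derivable rho t 1) /\ (forall t, derivable (derive1 rho) t 1) /\
  continuous (derive1 (derive1 rho)).

Definition admissible (q : R) (rho : R -> R) : Prop :=
  forall t, derive1 (derive1 ((@ln R) \o rho)) t < Num.sqrt q / (1 + Num.sqrt q).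

(* The Herglotz wave H[k,phi], phi = phir + i phii on S^1 (angular lift);
   real and imaginary parts. *)
Definition herglotz_re (k : R) (phir phii : R -> R) (x : R * R) : R :=
  Rintegral (@lebesgue_measure R) `[- pi, pi]%classic
    (fun t => phir t * cos (k * (cos t * x.1 + sin t * x.2))
            - phii t * sin (k * (cos t * x.1 + sin t * x.2))).
Definition herglotz_im (k : R) (phir phii : R -> R) (x : R * R) : R :=
  Rintegral (@lebesgue_measure R) `[- pi, pi]%classic
    (fun t => phir t * sin (k * (cos t * x.1 + sin t * x.2))
            + phii t * cos (k * (cos t * x.1 + sin t * x.2))).

(* Omega is non-scattering for the incident wave v = vr + i vi (smooth on R^2)
   with constant index of refraction q at wave number k:
   there is u = ur + i ui in H^1(Omega) with
   Delta u + k^2 q u = 0 in Omega (weakly),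
   u = v on the boundary (trace sense, via Green's formula),
   d_nu u = d_nu v on the boundary (weak normal derivative, via Green's formula,
   using Delta u = - k^2 q u and Delta v = - k^2 v). *)
Definition helmholtz_weak (Om : set (R * R)) (k q : R) (u g1 g2 : R * R -> R) :=
  forall phi, test_fun Om phi ->
    (\int[leb2]_(x in Om)
       (g1 x * partial1 phi x + g2 x * partial2 phi x - k ^+ 2 * q * u x * phi x)%:E
     = 0)%E.

Definition dirichlet_match (Om : set (R * R)) (u g1 g2 v : R * R -> R) :=
  forall psi, smooth2 psi ->
    (\int[leb2]_(x in Om)
       ((u x - v x) * partial1 psi x + (g1 x - partial1 v x) * psi x)%:E = 0)%E /\
    (\int[leb2]_(x in Om)
       ((u x - v x) * partial2 psi x + (g2 x - partial2 v x) * psi x)%:E = 0)%E.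

Definition neumann_match (Om : set (R * R)) (k q : R) (u g1 g2 v : R * R -> R) :=
  forall psi, smooth2 psi ->
    (\int[leb2]_(x in Om)
       (g1 x * partial1 psi x + g2 x * partial2 psi x - k ^+ 2 * q * u x * psi x)%:E
     = \int[leb2]_(x in Om)
       (partial1 v x * partial1 psi x + partial2 v x * partial2 psi x
        - k ^+ 2 * v x * psi x)%:E)%E.

Definition non_scattering (Om : set (R * R)) (k q : R) (vr vi : R * R -> R) : Prop :=
  exists ur ui ur1 ur2 ui1 ui2 : R * R -> R,
    H1 Om ur ur1 ur2 /\ H1 Om ui ui1 ui2 /\
    helmholtz_weak Om k q ur ur1 ur2 /\ helmholtz_weak Om k q ui ui1 ui2 /\
    dirichlet_match Om ur ur1 ur2 vr /\ dirichlet_match Om ui ui1 ui2 vi /\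
    neumann_match Om k q ur ur1 ur2 vr /\ neumann_match Om k q ui ui1 ui2 vi.

End Defs.

(* Main.v *)
(* If Omega is non-scattering at k, testing the two boundary conditions with Herglotz waves w of
   wave number sqrt(q) k shows that v is orthogonal to every such w in L^2(Omega).  For fixed
   densities the pairing of v and w is an entire function of k, so infinitely many bad k give
   arbitrarily large ones.  By Green's formula the pairing is a boundary integral, and stationary
   phase at the two critical points theta and theta + pi turns it, as k -> infinity, into an
   integral over theta of a bilinear form in the densities with factors p(k rho), m(k rho),
   p(sqrt(q) k rho), m(sqrt(q) k rho), where p = sqrt(l) J_0(l), m = sqrt(l) J_1(l) up to constants.
   Choose the density of w supported in a small arc around a point t0 of N.  Near t0 the radius is
   constant, so these factors are constants there; near t0 + pi one has rho' <> 0 almost everywhere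
   and the contribution vanishes by a Riemann-Lebesgue argument.  As p^2 + m^2 stays away from 0,
   the two test waves with cosine and sine density force the even part of the cosine density and
   the odd part of the sine density of v to vanish at t0, hence on N and on N + pi, hence
   everywhere.  Applied to the real and to the imaginary part of v this gives phi = 0. *)
Require Import Defs.
From HB Require Import structures.
From mathcomp Require Import all_boot all_order all_algebra.
From mathcomp Require Import ring lra.
From mathcomp Require Import all_classical all_reals all_analysis.
From mathcomp Require Import measurable_realfun.
Import Order.TTheory GRing.Theory Num.Theory.
Import numFieldNormedType.Exports.
Local Open Scope classical_set_scope.
Local Open Scope ring_scope.
Set Implicit Arguments. Unset Strict Implicit. Unset Printing Implicit Defensive.

(** * Calculus on compact intervals *)

(** The densities are only C^1, so stationary phase allows a single integration by parts; its error,
    multiplied by sqrt(l), is only shown to tend to 0, without a rate, and the later limits are of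
    the same qualitative kind. Near t0 + pi the products of amplitudes at l and sqrt(q) l oscillate
    with frequencies sqrt(q) - 1 and sqrt(q) + 1. As q > 1 neither is zero, so each product is, up
    to O(1/l), the derivative of a bounded function, which is what the Riemann-Lebesgue argument
    needs. Near t0 nothing oscillates in t and no average over k is taken: at one large k the two
    test waves give two linear equations built from rotations up to scale, and p^2 + m^2 bounds the
    scale from below. That bound comes from an almost conserved energy of the Bessel equation
    instead of Bessel asymptotics. Waves stay real: each has a cosine and a sine density, and the
    components of phi exchange these roles between the real and the imaginary part of v, which
    supplies both parities of both components. *)

Notation leb := (@lebesgue_measure _).

(** The integral is not oriented: for [b < a] the segment is empty and the value is 0. *)
Definition itg {R : realType} (a b : R) (f : R -> R) : R :=
  \int[leb]_(t in `[a, b]) f t.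

Section Itg.
Context {R : realType}.
Implicit Types (a b c : R) (f g F G : R -> R).

Lemma continuous_integrable_itv a b f :
  continuous f -> leb.-integrable `[a, b] (EFin \o f).
Proof.
move=> cf; apply: continuous_compact_integrable; first exact: segment_compact.
exact: continuous_subspaceT.
Qed.

Lemma eq_itg a b f g : {in `[a, b], f =1 g} -> itg a b f = itg a b g.
Proof. by move=> fg; apply: eq_Rintegral => x; rewrite inE => /fg. Qed.

Lemma itgD a b f g : continuous f -> continuous g ->
  itg a b (fun t => f t + g t) = itg a b f + itg a b g.
Proof. by move=> cf cg; rewrite /itg RintegralD//; exact: continuous_integrable_itv. Qed.

Lemma itgB a b f g : continuous f -> continuous g ->
  itg a b (fun t => f t - g t) = itg a b f - itg a b g.
Proof. by move=> cf cg; rewrite /itg RintegralB//; exact: continuous_integrable_itv. Qed.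

Lemma itgZ a b c f : continuous f -> itg a b (fun t => c * f t) = c * itg a b f.
Proof. by move=> cf; rewrite /itg RintegralZl//; exact: continuous_integrable_itv. Qed.

Lemma itgN a b f : continuous f -> itg a b (fun t => - f t) = - itg a b f.
Proof.
move=> cf; rewrite -[RHS]mulN1r -itgZ//.
by apply: eq_itg => t _; rewrite mulN1r.
Qed.

Lemma itg_cst a b c : a <= b -> itg a b (fun=> c) = c * (b - a).
Proof.
move=> ab; rewrite /itg Rintegral_cst//= lebesgue_measure_itv/= lte_fin.
by move: ab; rewrite le_eqVlt => /predU1P[->|->]; rewrite ?ltxx ?subrr.
Qed.

Lemma le_itg a b f g : continuous f -> continuous g ->
  {in `[a, b], forall t, f t <= g t} -> itg a b f <= itg a b g.
Proof.
move=> cf cg fg; apply: le_Rintegral => //; exact: continuous_integrable_itv.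
Qed.

Lemma itg_ge0 a b f : {in `[a, b], forall t, 0 <= f t} -> 0 <= itg a b f.
Proof. by move=> f0; apply: Rintegral_ge0. Qed.

Lemma norm_itg_le a b f g : continuous f -> continuous g ->
  {in `[a, b], forall t, `|f t| <= g t} -> `|itg a b f| <= itg a b g.
Proof.
move=> cf cg fg; apply: le_trans (le_normr_Rintegral _ _) _ => //.
  exact: continuous_integrable_itv.
apply: le_itg => //.
by move=> x; apply: continuous_comp; [exact: cf|exact: norm_continuous].
Qed.

Lemma norm_itg_le_cst a b f c : a <= b -> continuous f ->
  {in `[a, b], forall t, `|f t| <= c} -> `|itg a b f| <= c * (b - a).
Proof.
move=> ab cf fc; rewrite -itg_cst//; apply: norm_itg_le => //.
by move=> x; exact: cst_continuous.
Qed.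

Lemma itg_derive a b F f : a <= b -> (forall x : R, is_derive x 1 F (f x)) ->
  continuous f -> itg a b f = F b - F a.
Proof.
rewrite le_eqVlt => /predU1P[<-|ab] dF cf.
  by rewrite /itg set_itv1 Rintegral_set1 subrr.
have cF : continuous F.
  move=> x; apply/differentiable_continuous/derivable1_diffP.
  exact: ex_derive.
rewrite /itg /Rintegral (@continuous_FTC2 _ _ F)//.
- exact: continuous_subspaceT.
- split => [x _||].
  + exact: ex_derive.
  + by apply: cvg_at_right_filter; exact: cF.
  + by apply: cvg_at_left_filter; exact: cF.
- by move=> x _; rewrite derive1E; exact: derive_val.
Qed.

Lemma is_derive_continuous F f : (forall x : R, is_derive x 1 F (f x)) -> continuous F.
Proof.
move=> dF x; apply/differentiable_continuous/derivable1_diffP; exact: ex_derive.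
Qed.

Lemma itg_byparts a b F f G g : a <= b ->
  (forall x : R, is_derive x 1 F (f x)) -> (forall x : R, is_derive x 1 G (g x)) ->
  continuous f -> continuous g ->
  itg a b (fun t => F t * g t) =
    F b * G b - F a * G a - itg a b (fun t => f t * G t).
Proof.
move=> ab dF dG cf cg.
have cF := is_derive_continuous dF. have cG := is_derive_continuous dG.
apply/eqP; rewrite -subr_eq opprK -itgD; first last.
- by move=> x; apply: cvgM; [exact: cf|exact: cG].
- by move=> x; apply: cvgM; [exact: cF|exact: cg].
apply/eqP; apply: (@itg_derive _ _ (F \* G)) => //.
  move=> x; have := dF x; have := dG x => ? ?; apply: is_derive_eq.
  by rewrite /GRing.scale/= [G x * _]mulrC.
by move=> x; apply: cvgD; apply: cvgM; [exact: cF|exact: cg|exact: cf|exact: cG].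
Qed.

(** A tube argument: by compactness of the segment, [f y] is uniformly close to [f x] on it for [y]
    near [x]. No metric on [T] is involved, so the lemma also serves for products of planes and
    lines. *)
Lemma continuous_itg (T : topologicalType) a b (f : T -> R -> R) :
  continuous (fun z : T * R => f z.1 z.2) -> continuous (fun x => itg a b (f x)).
Proof.
move=> cf x.
have [ab|ba] := leP a b; last first.
  have -> : (fun x => itg a b (f x)) = fun=> 0.
    by apply/funext => y; rewrite /itg set_itv_ge ?Rintegral_set0// -leNgt bnd_simp.
  exact: cst_continuous.
have cfx y : continuous (f y).
  move=> t; apply: (@continuous_comp _ _ _ (fun t => (y, t)) (fun z => f z.1 z.2)); last exact: cf.
  apply: (@cvg_pair _ _ _ _ (nbhs y) (nbhs t)) => /=; [exact: cvg_cst|exact: cvg_id].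
apply/(@cvgrPdist_le _ R^o) => /= e e0.
(* The [+ 1] keeps the denominator positive when [a = b]. *)
have c0 : 0 < e / (b - a + 1) by rewrite divr_gt0// ltr_wpDl// subr_ge0.
set d := e / _ in c0.
have : \forall y \near x, `[a, b] `<=` [set t | `|f x t - f y t| <= d].
  apply: (near_covering_withinP _).2.
    by apply/compact_near_coveringP; exact: segment_compact.
  move=> t tab.
  have d20 : 0 < d / 2 by rewrite divr_gt0.
  have /cvgrPdist_le/(_ _ d20) h1 := cfx x t.
  have /cvgrPdist_le/(_ _ d20) [/= [U V] /= [nU nV] UV] := cf (x, t).
  exists (V `&` [set t0 | `|f x t - f x t0| <= d / 2], U) => /=.
    by split => //; apply: filterI.
  move=> [t' y] /= [[Vt' ht'] Uy] _.
  have := UV (y, t') (conj Uy Vt'); rewrite /= => h.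
  rewrite [d]splitr (_ : _ - _ = (f x t - f y t') - (f x t - f x t')); last by ring.
  by apply: le_trans (ler_normB _ _) _; exact: lerD.
apply: filterS => y hy.
rewrite -itgB//; apply: le_trans (@norm_itg_le_cst _ _ _ d ab _ _) _.
- by move=> t; apply: cvgB; exact: cfx.
- by move=> t tab; exact: hy.
- by rewrite /d -mulrA ger_pMr// mulrC ler_pdivrMr ?mul1r ?lerDl// ltr_wpDl// subr_ge0.
Qed.

End Itg.

Section Continuity.
Context {R : realType} {T : topologicalType}.
Implicit Types (f g : T -> R) (h : R -> R).

Lemma contD f g : continuous f -> continuous g -> continuous (fun x => f x + g x).
Proof. by move=> cf cg x; apply: cvgD; [exact: cf|exact: cg]. Qed.

Lemma contM f g : continuous f -> continuous g -> continuous (fun x => f x * g x).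
Proof. by move=> cf cg x; apply: cvgM; [exact: cf|exact: cg]. Qed.

Lemma contN f : continuous f -> continuous (fun x => - f x).
Proof. by move=> cf x; apply: cvgN; exact: cf. Qed.

Lemma contX f n : continuous f -> continuous (fun x => f x ^+ n).
Proof.
move=> cf; elim: n => [|n ih]; first exact: cst_continuous.
rewrite (_ : (fun _ => _) = fun x => f x * f x ^+ n); first exact: contM.
by apply/funext => x; rewrite exprS.
Qed.

Lemma contV f : (forall x, f x != 0) -> continuous f -> continuous (fun x => (f x)^-1).
Proof. by move=> f0 cf x; apply: cvgV => //; exact: cf. Qed.

Lemma cont_norm f : continuous f -> continuous (fun x => `|f x|).
Proof. by move=> cf x; apply: cvg_norm; exact: cf. Qed.

Lemma cont_comp h f : continuous h -> continuous f -> continuous (fun x => h (f x)).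
Proof. by move=> ch cf x; apply: continuous_comp; [exact: cf|exact: ch]. Qed.

Lemma cont_comp2 (U : topologicalType) (h : U -> R) (f : T -> U) :
  continuous h -> continuous f -> continuous (fun x => h (f x)).
Proof. by move=> ch cf x; apply: continuous_comp; [exact: cf|exact: ch]. Qed.

Lemma cont_fst (U V : topologicalType) (f : T -> U * V) :
  continuous f -> continuous (fun x => (f x).1).
Proof. by move=> cf x; apply: cvg_comp; [exact: cf|exact: cvg_fst]. Qed.

Lemma cont_snd (U V : topologicalType) (f : T -> U * V) :
  continuous f -> continuous (fun x => (f x).2).
Proof. by move=> cf x; apply: cvg_comp; [exact: cf|exact: cvg_snd]. Qed.

Lemma cont_pair (U V : topologicalType) (f : T -> U) (g : T -> V) :
  continuous f -> continuous g -> continuous (fun x => (f x, g x)).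
Proof. by move=> cf cg x; apply: cvg_pair; [exact: cf|exact: cg]. Qed.

End Continuity.

Lemma cont_cst (T U : topologicalType) (c : U) : continuous (fun _ : T => c).
Proof. by move=> x; exact: cvg_cst. Qed.

Lemma cont_id (T : topologicalType) : continuous (fun x : T => x).
Proof. by move=> x; exact: cvg_id. Qed.

(** Structural recursion on the body of the function. The case of an inverse leaves the goal that
    the denominator never vanishes, which [cont] closes only by [assumption]; hence the facts of
    that form put in context before many calls. *)
Ltac cont_step :=
  lazymatch goal with
  | |- continuous (fun x => x) => refine (@cont_id _)
  | |- continuous (fun _ => ?c) => refine (@cont_cst _ _ c)
  | |- continuous (fun x => @?ff x + @?gg x) => refine (@contD _ _ ff gg _ _)
  | |- continuous (fun x => @?ff x * @?gg x) => refine (@contM _ _ ff gg _ _)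
  | |- continuous (fun x => - (@?ff x)) => refine (@contN _ _ ff _)
  | |- continuous (fun x => @?ff x ^+ ?n) => refine (@contX _ _ ff n _)
  | |- continuous (fun x => Num.norm (@?ff x)) => refine (@cont_norm _ _ ff _)
  | |- continuous (fun x => (@?ff x, @?gg x)) => refine (@cont_pair _ _ _ ff gg _ _)
  | |- continuous (fun x => (@?ff x).1) => refine (@cont_fst _ _ _ ff _)
  | |- continuous (fun x => (@?ff x).2) => refine (@cont_snd _ _ _ ff _)
  | |- continuous (fun x => cos (@?ff x)) =>
      refine (@cont_comp _ _ (@cos _) ff (@continuous_cos _) _)
  | |- continuous (fun x => sin (@?ff x)) =>
      refine (@cont_comp _ _ (@sin _) ff (@continuous_sin _) _)
  | |- continuous (fun x => @GRing.inv _ (@?ff x)) => refine (@contV _ _ ff _ _)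
  | H : continuous ?hh |- continuous (fun x => ?hh (@?ff x)) =>
      refine (@cont_comp2 _ _ _ hh ff H _)
  end.
Ltac cont := solve [repeat (cbv beta; first [cont_step | assumption])].

(** * Measurability and boundedness of continuous functions *)

Section Measurable2.
Context {R : realType}.

(** The measurable sets of the plane are generated by rectangles, so an open set is written as the
    countable union of the boxes with rational corners that it contains. *)
Lemma open_measurable2 (U : set (R * R)) : open U -> measurable U.
Proof.
move=> oU.
pose box (q : (rat * rat) * (rat * rat)) : set (R * R) :=
  `]ratr q.1.1, ratr q.1.2[%classic `*` `]ratr q.2.1, ratr q.2.2[%classic.
pose F n := if unpickle n is Some q then
  (if asbool (box q `<=` U) then box q else set0) else set0.
have -> : U = \bigcup_n F n.
  apply/seteqP; split => [x Ux|x [n _]]; last first.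
    by rewrite /F; case: unpickle => // q; case: asboolP => // + xq; exact.
  have /(_ x Ux) := open_nbhs_nbhs (conj oU _).
  case=> -[/= A B] [/= nA nB] AB.
  have [e /= e0 eA] := nA; have [d /= d0 dB] := nB.
  have [q1] := @rat_in_itvoo R (x.1 - e) x.1 ltac:(lra).
  have [q2] := @rat_in_itvoo R x.1 (x.1 + e) ltac:(lra).
  have [q3] := @rat_in_itvoo R (x.2 - d) x.2 ltac:(lra).
  have [q4] := @rat_in_itvoo R x.2 (x.2 + d) ltac:(lra).
  rewrite !in_itv/= => /andP[? ?] /andP[? ?] /andP[? ?] /andP[? ?].
  have [n nE] : exists n, unpickle n = Some ((q1, q2), (q3, q4)).
    by exists (pickle ((q1, q2), (q3, q4))); exact: pickleK.
  exists n; first exact: I.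
  rewrite /F nE.
  case: asboolP => [_|[]].
    by split => /=; rewrite in_itv/=; apply/andP; split.
  move=> [y1 y2] [/=]; rewrite !in_itv/= => /andP[? ?] /andP[? ?].
  apply: AB; split => /=.
    by apply: eA => /=; rewrite ltr_distlC; lra.
  by apply: dB => /=; rewrite ltr_distlC; lra.
apply: bigcupT_measurable => n; rewrite /F; case: unpickle => // q.
by case: asboolP => // _; apply: measurableX.
Qed.

Lemma continuous_measurable2 (f : R * R -> R) : continuous f -> measurable_fun setT f.
Proof.
move=> /continuousP cf; apply: (measurability _ (measurable_realfun.RGenOpens.measurableE R)).
move=> _ [_ [a [b ->] <-]]; rewrite setTI; apply: open_measurable2.
exact/cf/interval_open.
Qed.

Lemma continuous_bounded_on (T : topologicalType) (f : T -> R) (A : set T) :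
  compact A -> continuous f -> exists2 C : R, 0 < C & forall x, A x -> `|f x| <= C.
Proof.
move=> cA cf.
have [->|A0] := eqVneq A set0; first by exists 1.
have {}A0 : A !=set0 by apply/set0P.
have [|c _ H] := @compact_EVT_max _ R (fun x => `|f x|) A A0 cA.
  by apply: continuous_subspaceT; cont.
exists (`|f c| + 1); first by rewrite ltr_wpDl.
by move=> x Ax; rewrite (le_trans (H x _)) ?inE// lerDl.
Qed.

Lemma continuous_bounded_itv (f : R -> R) (a b : R) : continuous f ->
  exists2 C : R, 0 < C & {in `[a, b], forall x, `|f x| <= C}.
Proof.
move=> cf; have [C C0 H] := continuous_bounded_on (@segment_compact _ a b) cf.
by exists C.
Qed.

End Measurable2.

(** * Iterated integrals and differentiation under the integral *)

Section Parametric.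
Context {R : realType}.

(** Extension by zero outside the rectangle reduces this to Fubini on the whole plane; the extension
    is integrable because [f] is bounded on a set of finite measure. *)
Lemma itg_fubini (f : R * R -> R) (a b c d : R) : continuous f ->
  itg a b (fun x => itg c d (fun y => f (x, y))) =
  itg c d (fun y => itg a b (fun x => f (x, y))).
Proof.
move=> cf.
pose B : set (R * R) := `[a, b]%classic `*` `[c, d]%classic.
pose g := f \_ B.
have [C C0 fC] := continuous_bounded_on
  (compact_setX (@segment_compact _ a b) (@segment_compact _ c d)) cf.
have mB : measurable B by exact: measurableX.
have mf : measurable_fun setT f := continuous_measurable2 cf.
have ig : (leb \x leb)%E.-integrable setT (EFin \o g).
  rewrite /g -restrict_EFin; apply: (integrable_restrict (leb \x leb)%E mB measurableT (EFin \o f)).1; rewrite setTI.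
  apply: (@le_integrable _ _ _ (leb \x leb)%E _ mB (EFin \o f) (fun=> C%:E)).
  - by apply/measurable_EFinP; exact: measurable_funTS.
  - by move=> z Bz; rewrite /= lee_fin [leRHS]gtr0_norm//; exact: fC.
  - apply/integrableP; split; first exact: measurable_cst.
    rewrite integral_cst//= product_measure1E//= !lebesgue_measure_itv/=.
    by do 2 case: ifPn => _; rewrite -?EFinD -?EFinM ?mul0e ?mule0 ?ltry.
have gE x y : g (x, y) = (fun x => (fun y => f (x, y)) \_ `[c, d] y) \_ `[a, b] x.
  rewrite /g !patchE /B.
  have -> : ((x, y) \in `[a, b]%classic `*` `[c, d]%classic) =
      (x \in `[a, b]%classic) && (y \in `[c, d]%classic).
    by apply/idP/andP => [|[]]; rewrite !inE.
  by case: (x \in _); case: (y \in _).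
have gE' x y : g (x, y) = (fun y => (fun x => f (x, y)) \_ `[a, b] x) \_ `[c, d] y.
  by rewrite gE !patchE; case: (x \in _); case: (y \in _).
have e1 x : (\int[leb]_y (g (x, y))%:E =
    ((fun x => itg c d (fun y => f (x, y))) \_ `[a, b] x)%:E)%E.
  rewrite patchE; case: ifPn => xab.
    rewrite /itg /Rintegral fineK; last first.
      by apply: integrable_fin_num => //; apply: continuous_integrable_itv; cont.
    rewrite integral_mkcond; apply: eq_integral => y _.
    by rewrite gE patchE xab restrict_EFin.
  by apply: integral0_eq => y _; rewrite gE patchE (negbTE xab).
have e2 y : (\int[leb]_x (g (x, y))%:E =
    ((fun y => itg a b (fun x => f (x, y))) \_ `[c, d] y)%:E)%E.
  rewrite patchE; case: ifPn => xab.
    rewrite /itg /Rintegral fineK; last first.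
      by apply: integrable_fin_num => //; apply: continuous_integrable_itv; cont.
    rewrite integral_mkcond; apply: eq_integral => x _.
    by rewrite gE' patchE xab restrict_EFin.
  by apply: integral0_eq => x _; rewrite gE' patchE (negbTE xab).
have FE := Fubini ig.
rewrite /itg Rintegral_mkcond [RHS]Rintegral_mkcond /Rintegral; congr fine.
transitivity (\int[leb]_x \int[leb]_y (g (x, y))%:E)%E.
  by apply: eq_integral => x _; rewrite e1.
by rewrite FE; apply: eq_integral => y _; rewrite e2.
Qed.

Lemma is_derive_itg (a b u v x : R) (f f' : R -> R -> R) (C : R) :
  x \in `]u, v[ ->
  (forall y, continuous (f y)) -> (forall y t, is_derive y (1 : R) (f ^~ t) (f' y t)) ->
  {in `]u, v[, forall y, {in `[a, b], forall t, `|f' y t| <= C}} ->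
  is_derive x (1 : R) (fun y => itg a b (f y)) (itg a b (f' x)).
Proof.
move=> xuv cf df bf.
have H1 : forall y, `]u, v[%classic y -> leb.-integrable `[a, b] (EFin \o f y).
  by move=> y _; exact: continuous_integrable_itv.
have H2 : forall y t, `]u, v[%classic y -> `[a, b]%classic t -> derivable (f ^~ t) y 1.
  by move=> y t _ _; exact: ex_derive.
have H3 : leb.-integrable `[a, b] (EFin \o (fun=> `|C|)).
  by apply: continuous_integrable_itv; exact: cst_continuous.
have H4 : forall y t, `]u, v[%classic y -> `[a, b]%classic t ->
    `|partial1of2 f y t| <= `|C|.
  move=> y t yuv tab; rewrite partial1of2E derive_val.
  by rewrite (le_trans (bf _ yuv _ tab))// ler_norm.
have := @differentiation_under_integral R _ _ leb f `[a, b]%classic _ x u v xuv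
  H1 H2 (fun=> `|C|) (fun=> normr_ge0 _) H3 H4.
have := @derivable_under_integral R _ _ leb f `[a, b]%classic _ x u v xuv
  H1 H2 (fun=> `|C|) (fun=> normr_ge0 _) H3 H4.
move=> h1 h2; apply: DeriveDef; first exact: h1.
rewrite -derive1E h2//; apply: eq_itg => t _; rewrite partial1of2E; exact: derive_val.
Qed.

End Parametric.

Section Antiderivative.
Context {R : realType}.
Implicit Types (a b c : R) (f g F G : R -> R).

(** The inequality is strict because [itg a y f] is constantly 0 for [y < a]. For this reason later
    antiderivatives start strictly to the left of the interval on which they are used. *)
Lemma is_derive_itg_upper a f (x : R) : continuous f -> a < x ->
  is_derive x (1 : R) (fun y => itg a y f) (f x).
Proof.
move=> cf ax.
have [dF FE] := @continuous_FTC1_closed _ f a x (x + 1) ltac:(lra)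
  (continuous_integrable_itv _ _ cf) ax (cf x).
by apply: DeriveDef; [exact: dF|rewrite -derive1E FE].
Qed.

Lemma itg_derive_in a b F f : a <= b ->
  (forall x : R, a <= x <= b -> is_derive x (1 : R) F (f x)) ->
  continuous f -> itg a b f = F b - F a.
Proof.
rewrite le_eqVlt => /predU1P[<-|ab] dF cf.
  by rewrite /itg set_itv1 Rintegral_set1 subrr.
have cF x : a <= x <= b -> {for x, continuous F}.
  move=> xab; apply/differentiable_continuous/derivable1_diffP.
  by have := dF _ xab => ?; exact: ex_derive.
rewrite /itg /Rintegral (@continuous_FTC2 _ _ F)//.
- exact: continuous_subspaceT.
- split => [x||].
  + by rewrite in_itv/= => xab; have := dF x ltac:(lra) => ?; exact: ex_derive.
  + by apply: cvg_at_right_filter; apply: cF; lra.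
  + by apply: cvg_at_left_filter; apply: cF; lra.
- move=> x; rewrite in_itv/= => xab; have := dF x ltac:(lra) => ?.
  by rewrite derive1E; exact: derive_val.
Qed.

Lemma itg_eq_at_deriv0 a b F : a <= b ->
  (forall x : R, a <= x <= b -> is_derive x (1 : R) F 0) -> F b = F a.
Proof.
move=> ab dF; apply/eqP; rewrite -subr_eq0 -(@itg_derive_in a b F (fun=> 0) ab)//.
  by rewrite itg_cst// mul0r.
by cont.
Qed.

Lemma is_derive_addr (f : R -> R) (x c df : R) :
  is_derive (x + c) (1 : R) f df -> is_derive x (1 : R) (fun y => f (y + c)) df.
Proof.
move=> h; have h2 : is_derive x (1 : R) (fun y => y + c) (1 + 0).
  by apply: is_deriveD.
by have := @is_derive1_comp _ f _ x _ _ h h2; rewrite addr0 mulr1.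
Qed.

Lemma itg_shift a b c f : a <= b -> continuous f ->
  itg a b (fun t => f (t + c)) = itg (a + c) (b + c) f.
Proof.
move=> ab cf.
pose L := Num.min a (a + c) - 1.
have La : L < a by rewrite /L ltrBlDr; have := ge_min a a (a + c); rewrite lexx/=; lra.
have Lac : L < a + c.
  by rewrite /L ltrBlDr; have := ge_min (a + c) a (a + c); rewrite lexx orbT/=; lra.
pose G y := itg L y f.
have dG x : L < x -> is_derive x (1 : R) G (f x).
  by move=> Lx; exact: is_derive_itg_upper.
have H1 x : a <= x <= b -> is_derive x (1 : R) (fun y => G (y + c)) (f (x + c)).
  by move=> xab; apply: is_derive_addr; apply: dG; lra.
have H2 x : a + c <= x <= b + c -> is_derive x (1 : R) G (f x).
  by move=> xab; apply: dG; lra.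
rewrite (itg_derive_in ab H1); last by cont.
by rewrite (itg_derive_in _ H2)// lerD2r.
Qed.

(** The integral over [[y, y + p]] has derivative f(y + p) - f(y) = 0 in y. *)
Lemma itg_periodic p a c f : 0 <= p -> continuous f -> (forall t, f (t + p) = f t) ->
  itg c (c + p) f = itg a (a + p) f.
Proof.
move=> p0 cf fp.
wlog ac : a c / a <= c.
  by move=> H; have [/H//|/ltW/H] := leP a c.
pose L := a - 1.
pose H y := itg L (y + p) f - itg L y f.
have dI x : L < x -> is_derive x (1 : R) (fun y => itg L y f) (f x).
  by move=> Lx; exact: is_derive_itg_upper.
have HE y : L < y -> itg y (y + p) f = H y.
  move=> Ly; have H1 x : y <= x <= y + p -> is_derive x (1 : R) (fun y => itg L y f) (f x).
    by move=> xy; apply: dI; lra.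
  by rewrite (itg_derive_in _ H1)//; lra.
rewrite !HE; [|rewrite /L; lra..].
apply: (@itg_eq_at_deriv0 a c H) => // x xac.
rewrite -(subrr (f x)) -{1}(fp x); apply: is_deriveB.
  by apply: (@is_derive_addr (fun y => itg L y f)); apply: dI; rewrite /L; lra.
by apply: dI; rewrite /L; lra.
Qed.

Lemma itg_shift_periodic c f : continuous f -> (forall t, f (t + 2 * pi) = f t) ->
  itg (- pi) pi (fun t => f (t + c)) = itg (- pi) pi f.
Proof.
move=> cf fp; have pi0 := @pi_ge0 R.
rewrite itg_shift//; last lra.
have -> : pi + c = - pi + c + 2 * pi by ring.
have -> : itg (- pi) pi f = itg (- pi) (- pi + 2 * pi) f by congr (itg _ _ _); ring.
by apply: itg_periodic => //; lra.
Qed.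

End Antiderivative.

Section IsDerive.
Context {R : realType}.
Implicit Types (f g : R -> R) (x df dg : R).

Lemma isd_eq f x df dg : is_derive x (1 : R) f df -> df = dg -> is_derive x (1 : R) f dg.
Proof. by move=> ? <-. Qed.

Lemma isd_id x : is_derive x (1 : R) (fun y => y) 1.
Proof. exact: is_derive_id. Qed.

Lemma isd_cst (c x : R) : is_derive x (1 : R) (fun=> c) 0.
Proof. exact: is_derive_cst. Qed.

Lemma isdD f g x df dg : is_derive x (1 : R) f df -> is_derive x (1 : R) g dg ->
  is_derive x (1 : R) (fun y => f y + g y) (df + dg).
Proof. by move=> ? ?; exact: is_deriveD. Qed.

Lemma isdN f x df : is_derive x (1 : R) f df -> is_derive x (1 : R) (fun y => - f y) (- df).
Proof. by move=> ?; exact: is_deriveN. Qed.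

Lemma isdM f g x df dg : is_derive x (1 : R) f df -> is_derive x (1 : R) g dg ->
  is_derive x (1 : R) (fun y => f y * g y) (df * g x + f x * dg).
Proof.
move=> ? ?; rewrite -[fun y => _]/(f \* g); apply: is_derive_eq.
by rewrite /GRing.scale/=; ring.
Qed.

Lemma isd_comp f g x df dg : is_derive (g x) (1 : R) f df -> is_derive x (1 : R) g dg ->
  is_derive x (1 : R) (fun y => f (g y)) (df * dg).
Proof. by move=> h1 h2; exact: (@is_derive1_comp _ f g x _ _ h1 h2). Qed.

Lemma isd_cos g x dg : is_derive x (1 : R) g dg ->
  is_derive x (1 : R) (fun y => cos (g y)) (- sin (g x) * dg).
Proof. by move=> h; apply: (@isd_comp (@cos R) g). Qed.

Lemma isd_sin g x dg : is_derive x (1 : R) g dg ->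
  is_derive x (1 : R) (fun y => sin (g y)) (cos (g x) * dg).
Proof. by move=> h; apply: (@isd_comp (@sin R) g). Qed.

Lemma isdV g x dg : g x != 0 -> is_derive x (1 : R) g dg ->
  is_derive x (1 : R) (fun y => (g y)^-1) (- (g x)^-2 * dg).
Proof.
by move=> g0 h; have := @is_deriveV _ g x dg 1 g0 h.
Qed.

Lemma isdX g n x dg : is_derive x (1 : R) g dg ->
  is_derive x (1 : R) (fun y => g y ^+ n.+1) (n.+1%:R * g x ^+ n * dg).
Proof.
move=> h; elim: n => [|n ih].
  rewrite (_ : (fun _ => _) = g); last by apply/funext => y; rewrite expr1.
  by apply: isd_eq h _; rewrite expr0 !mul1r.
rewrite (_ : (fun _ => _) = fun y => g y * g y ^+ n.+1); first last.
  by apply/funext => y; rewrite exprS.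
by apply: isd_eq (isdM h ih) _; rewrite exprS -[n.+2]addn1 natrD; ring.
Qed.

End IsDerive.

(** [is_derive] is a class, so [notypeclasses refine] is used to keep instance search from solving
    the premises: the derivative, still unknown, is built by these rules alone. [isd] then leaves
    the equation between it and the announced derivative. *)
Ltac isd_step :=
  lazymatch goal with
  | |- is_derive _ _ (fun x => x) _ => notypeclasses refine (@isd_id _ _)
  | |- is_derive _ _ (fun _ => ?c) _ => notypeclasses refine (@isd_cst _ c _)
  | |- is_derive _ _ (fun x => @?ff x + @?gg x) _ => notypeclasses refine (@isdD _ ff gg _ _ _ _ _)
  | |- is_derive _ _ (fun x => @?ff x * @?gg x) _ => notypeclasses refine (@isdM _ ff gg _ _ _ _ _)
  | |- is_derive _ _ (fun x => - (@?ff x)) _ => notypeclasses refine (@isdN _ ff _ _ _)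
  | |- is_derive _ _ (fun x => @?ff x ^+ S ?n) _ => notypeclasses refine (@isdX _ ff n _ _ _)
  | |- is_derive _ _ (fun x => cos (@?ff x)) _ => notypeclasses refine (@isd_cos _ ff _ _ _)
  | |- is_derive _ _ (fun x => sin (@?ff x)) _ => notypeclasses refine (@isd_sin _ ff _ _ _)
  | H : forall x, is_derive x _ ?hh _ |- is_derive _ _ (fun x => ?hh (@?ff x)) _ =>
      notypeclasses refine (@isd_comp _ hh ff _ _ _ (H _) _)
  | H : forall x, is_derive x _ ?hh _ |- is_derive _ _ ?hh _ => notypeclasses refine (H _)
  end.
Ltac isd := eapply isd_eq; [solve [repeat (cbv beta; first [eassumption | isd_step])]|cbv beta].

(** * Herglotz waves *)

Section HerglotzWave.
Context {R : realType}.
Implicit Types (k : R) (a b : R -> R) (x : R * R).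

(** A real Herglotz wave with a cosine density and a sine density. The family is closed under
    partial derivatives: each one exchanges the two densities, up to sign, and multiplies them by k
    cos t or k sin t, as in [hw1] and [hw2]. *)
Definition hw k a b x : R := itg (- pi) pi (fun t =>
  a t * cos (k * (cos t * x.1 + sin t * x.2)) +
  b t * sin (k * (cos t * x.1 + sin t * x.2))).

Definition hw1 k a b : R * R -> R :=
  hw k (fun t => k * cos t * b t) (fun t => - (k * cos t * a t)).
Definition hw2 k a b : R * R -> R :=
  hw k (fun t => k * sin t * b t) (fun t => - (k * sin t * a t)).

Lemma continuous_hw k a b : continuous a -> continuous b -> continuous (hw k a b).
Proof. by move=> ca cb; apply: continuous_itg; cont. Qed.

(** Differentiation along an arbitrary C^1 curve covers at once the two partial derivatives, the
    derivative along rays and the angular derivative. *)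
Lemma is_derive_hw k a b (c1 c2 d1 d2 : R -> R) (s : R) :
  continuous a -> continuous b ->
  (forall s : R, is_derive s (1 : R) c1 (d1 s)) ->
  (forall s : R, is_derive s (1 : R) c2 (d2 s)) ->
  continuous d1 -> continuous d2 ->
  is_derive s (1 : R) (fun s => hw k a b (c1 s, c2 s))
    (d1 s * hw1 k a b (c1 s, c2 s) + d2 s * hw2 k a b (c1 s, c2 s)).
Proof.
move=> ca cb dc1 dc2 cd1 cd2.
have cc1 := is_derive_continuous dc1. have cc2 := is_derive_continuous dc2.
pose u (z : R * R) := k * (cos z.2 * c1 z.1 + sin z.2 * c2 z.1).
pose f' (z : R * R) := k * (cos z.2 * d1 z.1 + sin z.2 * d2 z.1) *
   (b z.2 * cos (u z) - a z.2 * sin (u z)).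
have cf' : continuous f' by rewrite /f' /u; cont.
have [C C0 fC] := continuous_bounded_on (compact_setX (@segment_compact _ (s - 1) (s + 1))
  (@segment_compact _ (- pi) pi)) cf'.
have H := @is_derive_itg R (- pi) pi (s - 1) (s + 1) s
  (fun y t => a t * cos (u (y, t)) + b t * sin (u (y, t))) (fun y t => f' (y, t)) C.
apply: isd_eq; first apply: H.
- by rewrite in_itv/=; lra.
- by move=> y; rewrite /u; cont.
- by move=> y t; rewrite /u/=; isd; rewrite /f' /u/=; ring.
- move=> y ys t tpi; apply: (fC (y, t)); split => //=.
  by move: ys; rewrite !in_itv/=; lra.
rewrite /hw1 /hw2 /hw -!itgZ; [|cont..].
rewrite -itgD; [|cont..].
by apply: eq_itg => t _; rewrite /f' /u/=; ring.
Qed.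

Lemma partial1_hw k a b : continuous a -> continuous b -> partial1 (hw k a b) = hw1 k a b.
Proof.
move=> ca cb; apply/funext => -[x1 x2]; rewrite /partial1 /= derive1E.
have := @is_derive_hw k a b (fun s => s) (fun=> x2) (fun=> 1) (fun=> 0) x1 ca cb
  (fun s => isd_id s) (fun s => isd_cst x2 s) ltac:(cont) ltac:(cont).
by move=> h; rewrite derive_val; ring.
Qed.

Lemma partial2_hw k a b : continuous a -> continuous b -> partial2 (hw k a b) = hw2 k a b.
Proof.
move=> ca cb; apply/funext => -[x1 x2]; rewrite /partial2 /= derive1E.
have := @is_derive_hw k a b (fun=> x1) (fun s => s) (fun=> 0) (fun=> 1) x2 ca cb
  (fun s => isd_cst x1 s) (fun s => isd_id s) ltac:(cont) ltac:(cont).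
by move=> h; rewrite derive_val; ring.
Qed.

Lemma smooth2_hw k a b : continuous a -> continuous b -> smooth2 (hw k a b).
Proof.
move=> ca cb s.
have [a' [b' [ca' [cb' ->]]]] : exists a' b', continuous a' /\ continuous b' /\
    iter_partial s (hw k a b) = hw k a' b'.
  elim: s => [|[] s [a' [b' [ca' [cb' /= ->]]]]]; first by exists a, b.
    rewrite partial2_hw//; exists (fun t => k * sin t * b' t), (fun t => - (k * sin t * a' t)).
    by split; [cont|split; [cont|]].
  rewrite partial1_hw//; exists (fun t => k * cos t * b' t), (fun t => - (k * cos t * a' t)).
  by split; [cont|split; [cont|]].
split; first exact: continuous_hw.
move=> x; split.
  have h := @is_derive_hw k a' b' (fun s => s) (fun=> x.2) (fun=> 1) (fun=> 0) x.1 ca' cb'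
    (fun s => isd_id s) (fun s => isd_cst x.2 s) ltac:(cont) ltac:(cont).
  exact: ex_derive.
have h := @is_derive_hw k a' b' (fun=> x.1) (fun s => s) (fun=> 0) (fun=> 1) x.2 ca' cb'
  (fun s => isd_cst x.1 s) (fun s => isd_id s) ltac:(cont) ltac:(cont).
exact: ex_derive.
Qed.

Lemma hw_laplace k a b x : continuous a -> continuous b ->
  hw1 k (fun t => k * cos t * b t) (fun t => - (k * cos t * a t)) x +
  hw2 k (fun t => k * sin t * b t) (fun t => - (k * sin t * a t)) x =
  - k ^+ 2 * hw k a b x.
Proof.
move=> ca cb; rewrite /hw1 /hw2 /hw -itgZ; last by cont.
rewrite -itgD; [|cont..].
apply: eq_itg => t _; have := cos2Dsin2 t.
set c := cos t; set s := sin t => cs.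
transitivity (- k ^+ 2 * (c ^+ 2 + s ^+ 2) * (a t * cos (k * (c * x.1 + s * x.2)) +
   b t * sin (k * (c * x.1 + s * x.2)))); first by ring.
by rewrite cs mulr1.
Qed.

End HerglotzWave.

(** * Polar coordinates on a star-shaped domain *)

Section Periodic.
Context {R : realType} {T : Type}.
Implicit Types (f : R -> T).

Lemma periodicN f (p : R) : (forall t, f (t + p) = f t) -> forall t, f (t - p) = f t.
Proof. by move=> fp t; rewrite -[in RHS](subrK p t) fp. Qed.

Lemma periodicz f (p : R) (z : int) : (forall t, f (t + p) = f t) ->
  forall t, f (t + p *~ z) = f t.
Proof.
move=> fp t; case: z => n.
  elim: n t => [|n ih] t; first by rewrite mulr0z addr0.
  by rewrite -addn1 PoszD mulrzDr mulr1z addrA fp ih.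
elim: n t => [|n ih] t; first by rewrite NegzE mulrNz mulr1z (periodicN fp).
rewrite (_ : t + p *~ Negz n.+1 = t + p *~ Negz n - p); first by rewrite (periodicN fp) ih.
rewrite !NegzE -addrA; congr (_ + _); rewrite !mulrNz -opprD; congr (- _).
by rewrite -[n.+2]addn1 PoszD mulrzDr mulr1z.
Qed.

End Periodic.

Section Angles.
Context {R : realType}.

Lemma periodic_cosD2pi (t : R) : cos (t + 2 * pi) = cos t.
Proof. by rewrite mulr_natl cosD2pi. Qed.

Lemma periodic_sinD2pi (t : R) : sin (t + 2 * pi) = sin t.
Proof. by rewrite mulr_natl sinD2pi. Qed.

Lemma cos_eq1_2pi (d : R) : cos d = 1 -> exists z : int, d = 2 * pi *~ z.
Proof.
move=> cd; pose z := Num.floor (d / (2 * pi)).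
have pi0 := @pi_gt0 R.
exists z; apply/eqP; rewrite -subr_eq0; apply/eqP.
have /andP[h1 h2] := floor_itv (d / (2 * pi)); rewrite -/z in h1 h2.
rewrite ler_pdivlMr in h1; last lra. rewrite ltr_pdivrMr in h2; last lra.
set e := d - _.
have ce : cos e = 1.
  by rewrite /e -mulrNz (periodicz _ periodic_cosD2pi).
have e0 : 0 <= e by rewrite /e subr_ge0 -mulrzr; lra.
have e2 : e < 2 * pi.
  by rewrite /e ltrBlDr -mulrzr; move: h2; rewrite intrD; lra.
have key (u : R) : 0 < u <= pi -> cos u = 1 -> False.
  move=> /andP[u0 upi] cu.
  have := @ltr_cos R 0 u; rewrite !in_itv/= lexx ltW//= (ltW u0) upi cos0 cu.
  by move=> /(_ isT isT); rewrite ltxx u0.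
have [epi|pie] := leP e pi.
  by have [//|e0'] := eqVneq e 0; case: (key e) => //; rewrite epi andbT lt_neqAle eq_sym e0'.
case: (key (2 * pi - e)); first lra.
by rewrite addrC periodic_cosD2pi cosN.
Qed.

Lemma eq_angle (t s : R) : cos t = cos s -> sin t = sin s -> exists z : int, t = s + 2 * pi *~ z.
Proof.
move=> ct st; have [|z tz] := @cos_eq1_2pi (t - s).
  by rewrite cosB ct st -!expr2 cos2Dsin2.
by exists z; rewrite -tz; ring.
Qed.

End Angles.

Section StarDomain.
Context {R : realType}.
Variable rho : R -> R.
Hypothesis rho0 : forall t, 0 < rho t.
Hypothesis rhop : forall t, rho (t + 2 * pi) = rho t.
Hypothesis crho : continuous rho.

(** The pair given by [star_domain] may differ from [(r, t)]. Its radius is the same, and its angle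
    differs by a multiple of 2 pi unless the point is the origin, where positivity of [rho]
    decides. *)
Lemma star_domain_polar r t : 0 <= r ->
  star_domain rho (r * cos t, r * sin t) <-> r < rho t.
Proof.
move=> r0; split => [|rt]; last by exists r, t; rewrite r0.
move=> [r' [t' [/andP[r'0 r't'] [ec es]]]].
have er : r = r'.
  apply/eqP; rewrite -(@eqrXn2 _ 2)//; apply/eqP.
  rewrite -[LHS]mulr1 -[RHS]mulr1 -{1}(cos2Dsin2 t) -(cos2Dsin2 t').
  by rewrite !mulrDr -!exprMn ec es.
subst r'; have [->|rn0] := eqVneq r 0; first exact: rho0.
have [z ->] := @eq_angle _ t t' (mulfI rn0 ec) (mulfI rn0 es).
by rewrite periodicz.
Qed.

(* [0 < u] is the component of the point along the direction s, m u its component across *)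
Lemma star_domain_slope s u m : 0 < u ->
  star_domain rho (u * (cos s - m * sin s), u * (sin s + m * cos s)) <->
  u < rho (s + atan m) * cos (atan m).
Proof.
move=> u0.
have cm : 0 < cos (atan m).
  by apply: cos_gt0_pihalf; rewrite atan_gtNpi2 atan_ltpi2.
have sm : sin (atan m) = m * cos (atan m).
  by rewrite -[X in X * _](atanK m) /tan divfK// gt_eqF.
rewrite -ltr_pdivrMr// -star_domain_polar; last by rewrite divr_ge0// ltW.
rewrite cosD sinD sm.
have -> : u / cos (atan m) * (cos s * cos (atan m) - sin s * (m * cos (atan m))) =
    u * (cos s - m * sin s) by field; rewrite gt_eqF.
by have -> : u / cos (atan m) * (sin s * cos (atan m) + cos s * (m * cos (atan m))) =
    u * (sin s + m * cos s) by field; rewrite gt_eqF.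
Qed.

Let slope s m := rho (s + atan m) * cos (atan m).

Lemma continuous_atan' : continuous (@atan R).
Proof. by move=> x; exact: continuous_atan. Qed.

Lemma continuous_slope s : continuous (slope s).
Proof. by have ca := continuous_atan'; rewrite /slope; cont. Qed.

(** In this half-plane the angle is [s + atan (p / e)], a continuous function of the point, so
    membership becomes a strict inequality between continuous functions. Four such half-planes cover
    the plane without the origin. *)
Lemma open_star_sector s :
  open (star_domain rho `&` [set x | 0 < x.1 * cos s + x.2 * sin s]).
Proof.
pose e (x : R * R) := x.1 * cos s + x.2 * sin s.
pose p (x : R * R) := x.2 * cos s - x.1 * sin s.
have ce : continuous e by rewrite /e; cont.
have cp : continuous p by rewrite /p; cont.
have E x : 0 < e x -> star_domain rho x <-> e x < slope s (p x / e x).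
  move=> ex0; rewrite /slope -star_domain_slope//.
  have cs := cos2Dsin2 s.
  have -> : e x * (cos s - p x / e x * sin s) = x.1.
    transitivity (x.1 * (cos s ^+ 2 + sin s ^+ 2)); last by rewrite cs mulr1.
    by rewrite /e /p; field; rewrite gt_eqF.
  have -> : e x * (sin s + p x / e x * cos s) = x.2.
    transitivity (x.2 * (cos s ^+ 2 + sin s ^+ 2)); last by rewrite cs mulr1.
    by rewrite /e /p; field; rewrite gt_eqF.
  by case: x {ex0}.
rewrite openE => x [Sx /= ex0]; rewrite -/(e x) in ex0.
move: (E x ex0).1 => /(_ Sx); rewrite -subr_gt0 => lt0.
have cv : (slope s (p y / e y) - e y) @[y --> x] --> slope s (p x / e x) - e x.
  apply: cvgB; last exact: ce.
  apply: (@continuous_cvg _ _ _ _ _ (fun y => p y / e y) (slope s)).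
    exact: continuous_slope.
  by apply: cvgM; [exact: cp|apply: cvgV; [rewrite gt_eqF|exact: ce]].
have n1 := cvgr_gt _ cv _ lt0. have n2 := cvgr_gt _ (ce x) _ ex0.
near=> y.
have ey0 : 0 < e y by near: y; exact: n2.
split => //; apply/E => //; rewrite -subr_gt0; near: y; exact: n1.
Unshelve. all: by end_near. Qed.

Lemma measurable_star_domain : measurable (star_domain rho).
Proof.
have -> : star_domain rho = [set (0, 0)] `|`
    (star_domain rho `&` [set x | 0 < x.1 * cos 0 + x.2 * sin 0]) `|`
    (star_domain rho `&` [set x | 0 < x.1 * cos pi + x.2 * sin pi]) `|`
    (star_domain rho `&` [set x | 0 < x.1 * cos (pi / 2) + x.2 * sin (pi / 2)]) `|`
    (star_domain rho `&` [set x | 0 < x.1 * cos (- (pi / 2)) + x.2 * sin (- (pi / 2))]).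
  apply/seteqP; split => [[x1 x2] Sx|x]; last first.
    case=> [[[[->|[]//]|[]//]|[]//]|[]//].
    by exists 0, 0; rewrite !mul0r lexx rho0.
  rewrite cosN sinN cos0 sin0 cospi sinpi cos_pihalf sin_pihalf /=.
  have [x10|x10|x10] := ltgtP x1 0; last 1 first.
  - have [x20|x20|x20] := ltgtP x2 0; last by left; left; left; left; rewrite x10 x20.
    + by right; split => //=; lra.
    + by left; right; split => //=; lra.
  - by left; left; right; split => //=; lra.
  - by left; left; left; right; split => //=; lra.
have m0 : measurable ([set (0, 0)] : set (R * R)).
  rewrite (_ : [set _] = [set 0] `*` [set 0]); first exact: measurableX.
  by apply/seteqP; split => [_ ->//|[a b] [/= -> ->]].
by do ! apply: measurableU => //; apply: open_measurable2; exact: open_star_sector.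
Qed.

End StarDomain.

(** * Linear and arctangent substitutions *)

Section Scaling.
Context {R : realType}.

Lemma measurable_mull (c : R) :
  measurable_fun (setT : set (measurableTypeR R)) (fun x : measurableTypeR R => c * x : measurableTypeR R).
Proof. exact: mulrl_measurable. Qed.

Let scaled (c : R) : {measure set (measurableTypeR R) -> \bar R} :=
  measure_function_pushforward__canonical__measure_function_Measure
    (@lebesgue_measure R) (measurable_mull c).

(** By uniqueness of Lebesgue measure it suffices to compare on half-open intervals. A negative [c]
    moves the closed end to the other side, which does not change the length. *)
Lemma lebesgue_measure_scale (c : R) (c0 : c != 0) (A : set R) : measurable A ->
  leb A = mscale (NngNum (normr_ge0 c)) (scaled c) A.
Proof.
apply: (lebesgue_measure_unique (mu := mscale (NngNum (normr_ge0 c)) (scaled c))).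
move=> _ [[a b] _ <-]/=; rewrite /mscale /pushforward /=.
have [c_gt0|c_lt0] := ltP 0 c.
  rewrite [X in (_ * lebesgue_measure X)%E](_ : _ = `]a / c, b / c]%classic); last first.
    apply/seteqP; split => x /=; rewrite !in_itv/= ltr_pdivrMr// ler_pdivlMr// ![c * _]mulrC//.
  rewrite !lebesgue_measure_itv/= !lte_fin ltr_pM2r ?invr_gt0//.
  case: ifPn => _; last by rewrite mule0.
  by rewrite -!EFinD -EFinM gtr0_norm//; congr EFin; field.
have {}c_lt0 : c < 0 by rewrite lt_neqAle c0.
rewrite [X in (_ * lebesgue_measure X)%E](_ : _ = `[b / c, a / c[%classic); last first.
  by apply/seteqP; split => x /=; rewrite !in_itv/= ltr_ndivlMr// ler_ndivrMr// ![c * _]mulrC andbC.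
rewrite !lebesgue_measure_itv/= !lte_fin ltr_nM2r ?invr_lt0//.
case: ifPn => _; last by rewrite mule0.
by rewrite -!EFinD -EFinM ltr0_norm//; congr EFin; field.
Qed.

Lemma ge0_integral_scale (c : R) (g : R -> \bar R) : c != 0 ->
  measurable_fun setT g -> (forall x, (0 <= g x)%E) ->
  (\int[leb]_x g x = `|c|%:E * \int[leb]_x g (c * x)%R)%E.
Proof.
move=> c0 mg g0.
rewrite (eq_measure_integral (mscale (NngNum (normr_ge0 c)) (scaled c))); last first.
  by move=> A mA _; exact: lebesgue_measure_scale.
rewrite ge0_integral_mscale//=; congr (_ * _)%E.
by rewrite (ge0_integral_pushforward (measurable_mull c)).
Qed.

End Scaling.

Section Splitting.
Context {R : realType}.
Implicit Types (a b c : R) (f : R -> R).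

Lemma itg_cat a b c f : a <= b -> b <= c -> continuous f ->
  itg a c f = itg a b f + itg b c f.
Proof.
move=> ab bc cf.
have H x y : a <= x -> x <= y -> itg x y f = itg (a - 1) y f - itg (a - 1) x f.
  move=> ax xy; apply: (itg_derive_in (F := fun y => itg (a - 1) y f)) => // z xz.
  by apply: is_derive_itg_upper => //; lra.
by rewrite (H a c) ?(H a b) ?(H b c)//; [ring|lra..].
Qed.

Lemma itg_scale c f : 0 <= c -> continuous f ->
  itg 0 c f = itg 0 1 (fun y => c * f (y * c)).
Proof.
move=> c0 cf; pose F x := itg (- 1) x f.
have dF (x : R) : -1 < x -> is_derive x (1 : R) F (f x).
  by move=> x0; exact: is_derive_itg_upper.
have H1 (x : R) : 0 <= x <= c -> is_derive x (1 : R) F (f x) by move=> x0; apply: dF; lra.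
have H2 (y : R) : 0 <= y <= 1 -> is_derive y (1 : R) (fun y => F (y * c)) (c * f (y * c)).
  move=> /andP[y0 _]; have yc := mulr_ge0 y0 c0.
  have h : is_derive y (1 : R) (fun y => y * c) c by isd; ring.
  have h2 : is_derive (y * c) (1 : R) F (f (y * c)) by apply: dF; lra.
  by apply: isd_eq (@isd_comp _ F (fun y => y * c) y _ _ h2 h) _; rewrite mulrC.
rewrite (itg_derive_in c0 H1)// (itg_derive_in ler01 H2) ?mul0r ?mul1r//.
by cont.
Qed.

Lemma itg_reflect a b f : a <= b -> continuous f ->
  itg a b f = itg (- b) (- a) (fun x => f (- x)).
Proof.
move=> ab cf; pose F x := itg (a - 1) x f.
have dF (x : R) : a - 1 < x -> is_derive x (1 : R) F (f x).
  by move=> x0; exact: is_derive_itg_upper.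
have H1 (x : R) : a <= x <= b -> is_derive x (1 : R) F (f x) by move=> x0; apply: dF; lra.
have H2 (y : R) : - b <= y <= - a -> is_derive y (1 : R) (fun y => - F (- y)) (f (- y)).
  move=> y0; have h : is_derive y (1 : R) (fun y => - y) (- 1) by isd.
  have h2 : is_derive (- y) (1 : R) F (f (- y)) by apply: dF; lra.
  by apply: isd_eq (isdN (@isd_comp _ F (fun y => - y) y _ _ h2 h)) _; ring.
rewrite (itg_derive_in ab H1)// (itg_derive_in _ H2) ?lerN2//; last by cont.
by rewrite !opprK; ring.
Qed.

(** The substitution t = atan m. Nonnegativity permits the improper fundamental theorem on the
    half-line, and a reflection brings the negative half-line to the positive one. *)
Lemma integral_oneDsqr_atan f : continuous f -> (forall t, 0 <= f t) ->
  (\int[leb]_m (f (atan m) / (1 + m ^+ 2))%:E = (itg (- (pi / 2)) (pi / 2) f)%:E)%E.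
Proof.
move=> cf f0; have pi0 := @pi_gt0 R.
have ca := @continuous_atan' R.
have d0 (m : R) : 1 + m ^+ 2 != 0 by rewrite gt_eqF// ltr_pwDl// sqr_ge0.
have half (g : R -> R) : continuous g -> (forall t, 0 <= g t) ->
    (\int[leb]_(m in `[0%R, +oo[) (g (atan m) / (1 + m ^+ 2))%:E = (itg 0 (pi / 2) g)%:E)%E.
  move=> cg g0.
  pose F m := itg (- pi) (atan m) g.
  have dF m : is_derive m (1 : R) F (g (atan m) / (1 + m ^+ 2)).
    have h1 : is_derive (atan m) (1 : R) (fun x => itg (- pi) x g) (g (atan m)).
      by apply: is_derive_itg_upper => //; have := atan_gtNpi2 m; lra.
    have h2 : is_derive m (1 : R) (@atan R) (1 + m ^+ 2)^-1.
      exact: is_derive1_atan.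
    exact: (@isd_comp _ (fun x => itg (- pi) x g) (@atan R) m _ _ h1 h2).
  have cF := is_derive_continuous dF.
  rewrite (@ge0_continuous_FTC2y _ _ F 0 (itg (- pi) (pi / 2) g)).
  - rewrite /F atan0 -EFinB; congr EFin.
    by rewrite (@itg_cat (- pi) 0 (pi / 2))//; [ring|lra..].
  - by move=> x _; rewrite divr_ge0// addr_ge0// sqr_ge0.
  - by apply: continuous_subspaceT; cont.
  - apply: (@continuous_cvg _ _ _ _ _ atan (fun x => itg (- pi) x g)); last exact: cvgy_atan.
    have h1 : is_derive (pi / 2) (1 : R) (fun x => itg (- pi) x g) (g (pi / 2)).
      by apply: is_derive_itg_upper => //; lra.
    by apply/differentiable_continuous/derivable1_diffP; exact: ex_derive.
  - by move=> x _; exact: ex_derive.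
  - by apply: cvg_at_right_filter; exact: cF.
  - by move=> x _; rewrite derive1E; exact: derive_val.
pose h m := f (atan m) / (1 + m ^+ 2).
have ch : continuous h by rewrite /h; cont.
have h0 m : 0 <= h m by rewrite divr_ge0// addr_ge0// sqr_ge0.
have mh : measurable_fun (setT : set R) (EFin \o h).
  by apply/measurable_EFinP; exact: continuous_measurable_fun.
have U : `[0%R, +oo[%classic `|` `]-oo, 0%R[%classic = setT :> set R.
  apply/seteqP; split => // x _; have [x0|x0] := leP 0 x; [left|right].
    by rewrite /= in_itv/= x0.
  by rewrite /= in_itv/= x0.
transitivity (\int[leb]_(m in `[0%R, +oo[) (h m)%:E + \int[leb]_(m in `]-oo, 0%R[) (h m)%:E)%E.
  rewrite -ge0_integral_setU//=.
  - by rewrite [X in _ = (\int[_]_(x in X) _)%E]U.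
  - by rewrite [X in measurable_fun X _]U.
  - by move=> x _; rewrite lee_fin.
  - by apply/disj_setPS => x [/=]; rewrite !in_itv/= andbT; lra.
have -> : (\int[leb]_(m in `]-oo, 0%R[) (h m)%:E = \int[leb]_(m in `]0%R, +oo[) (h (- m)%R)%:E)%E.
  rewrite integral_mkcond (@ge0_integral_scale _ (-1)%R) ?oppr_eq0 ?oner_eq0//; last first.
  - by move=> x; rewrite patchE; case: ifPn => // _; rewrite lee_fin.
  - by apply: (measurable_restrict _ _ _).1 => //; exact: measurable_funTS.
  rewrite normrN normr1 mul1e [RHS]integral_mkcond; apply: eq_integral => x _.
  rewrite !patchE mulN1r; congr (if _ then _ else _).
  by apply/idP/idP; rewrite !inE/= !in_itv/= oppr_lt0 ?andbT.
rewrite integral_itv_obnd_cbnd; last first.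
  by apply/measurable_EFinP; apply: measurable_funTS; apply: continuous_measurable_fun; cont.
rewrite (half f)//.
have := half (fun x => f (- x)); rewrite /h.
under eq_integral do rewrite -atanN -[X in 1 + X]sqrrN.
move=> -> //; last by cont.
rewrite -EFinD; congr EFin; rewrite addrC [RHS](@itg_cat _ 0)//; [|lra..].
congr (_ + _); rewrite [RHS]itg_reflect//; last lra.
by rewrite oppr0 opprK.
Qed.

End Splitting.

Section Polar.
Context {R : realType}.
Variable rho : R -> R.
Hypothesis rho0 : forall t, 0 < rho t.
Hypothesis rhop : forall t, rho (t + 2 * pi) = rho t.
Hypothesis crho : continuous rho.
Implicit Types f : R * R -> R.
Let Om := star_domain rho.

(** The radial part of polar integration after r = y rho(t), so that r dr becomes rho(t)^2 y dy and
    the interval no longer depends on t. *)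
Definition ray_integral f (t : R) := itg 0 1 (fun y =>
  f (y * (rho t * cos t), y * (rho t * sin t)) * (rho t ^+ 2 * y)).

Lemma continuous_ray_integral f : continuous f -> continuous (ray_integral f).
Proof. by move=> cf; apply: continuous_itg; cont. Qed.

Lemma ray_integralD2pi f t : ray_integral f (t + 2 * pi) = ray_integral f t.
Proof. by rewrite /ray_integral rhop periodic_cosD2pi periodic_sinD2pi. Qed.

(** The line of slope [m] through the origin meets the domain exactly above the abscissae between
    [- G' m] and [G m]. *)
Let G m := rho (atan m) * cos (atan m).
Let G' m := rho (atan m + pi) * cos (atan m).

Let cos_atan_gt0 (m : R) : 0 < cos (atan m).
Proof. by apply: cos_gt0_pihalf; rewrite atan_gtNpi2 atan_ltpi2. Qed.

Let G0 m : 0 < G m. Proof. by rewrite mulr_gt0. Qed.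
Let G'0 m : 0 < G' m. Proof. by rewrite mulr_gt0. Qed.

Let star_line m x : star_domain rho (x, x * m) <-> - G' m < x < G m.
Proof.
have [x0|x0|->] := ltgtP x 0.
- have h := star_domain_slope rho0 rhop pi m (u := - x) ltac:(lra).
  rewrite cospi sinpi in h.
  have e1 : - x * (- 1 - m * 0) = x by ring.
  have e2 : - x * (0 + m * - 1) = x * m by ring.
  rewrite e1 e2 in h.
  by rewrite h addrC -/(G' m); have := G0 m; lra.
- have h := star_domain_slope rho0 rhop 0 m (u := x) x0.
  rewrite cos0 sin0 in h.
  have e1 : x * (1 - m * 0) = x by ring.
  have e2 : x * (0 + m * 1) = x * m by ring.
  rewrite e1 e2 add0r in h.
  by rewrite h -/(G m); have := G'0 m; lra.
- rewrite mul0r; have h := star_domain_polar rho0 rhop 0 (lexx 0).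
  rewrite !mul0r in h; rewrite h; have := G'0 m; have := G0 m; have := rho0 0; lra.
Qed.

Let line_integral f m : continuous f ->
  itg (- G' m) (G m) (fun x => `|x| * f (x, x * m)) =
  (ray_integral f (atan m) + ray_integral f (atan m + pi)) / (1 + m ^+ 2).
Proof.
move=> cf; set h := fun x => _.
have ch : continuous h by rewrite /h; cont.
have g0 := G0 m; have g'0 := G'0 m; have c0 := cos_atan_gt0 m.
have c2 : (1 + m ^+ 2)^-1 = cos (atan m) ^+ 2.
  have := cos2_tan2 (lt0r_neq0 c0); rewrite atanK => <-.
  by rewrite invrK.
have sm : m * cos (atan m) = sin (atan m).
  by rewrite -[X in X * _](atanK m) /tan divfK// gt_eqF.
rewrite (@itg_cat _ _ 0)//; [|lra..].
rewrite addrC mulrDl; congr (_ + _).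
  rewrite itg_scale//; last lra.
  rewrite c2 mulrC /ray_integral -itgZ; last by cont.
  apply: eq_itg => y; rewrite in_itv/= => /andP[y0 _].
  rewrite /h ger0_norm; last exact: mulr_ge0 y0 (ltW g0).
  rewrite /G -sm; set c := cos _; set r := rho _.
  rewrite (_ : y * (r * c) * m = y * (r * (m * c))); ring.
rewrite itg_reflect//; last lra.
rewrite oppr0 opprK itg_scale//; [|lra|by cont].
rewrite c2 mulrC /ray_integral -itgZ; last by cont.
apply: eq_itg => y; rewrite in_itv/= => /andP[y0 _].
rewrite /h normrN ger0_norm; last exact: mulr_ge0 y0 (ltW g'0).
rewrite cosDpi sinDpi /G' -sm; set c := cos _; set r := rho _.
rewrite (_ : - (y * (r * c)) * m = y * (r * - (m * c))); last by ring.
rewrite (_ : - (y * (r * c)) = y * (r * - c)); ring.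
Qed.

(** Polar coordinates from one-dimensional substitutions only. In the inner integral y = x m
    replaces the ordinate by the slope, with Jacobian |x|; Tonelli exchanges the order; each line of
    slope m splits into two opposite rays; finally m = tan t turns dm / (1 + m^2) into dt. *)
Lemma ge0_integral_star_domain f : continuous f -> (forall x, 0 <= f x) ->
  (\int[leb2 (R := R)]_(x in Om) (f x)%:E = (itg (- pi) pi (ray_integral f))%:E)%E.
Proof.
move=> cf f0; have pi0 := @pi_gt0 R.
have mOm : measurable Om by exact: measurable_star_domain.
have mf := continuous_measurable2 cf.
pose F (z : R * R) : \bar R := (f z * \1_Om z)%:E.
have mF : measurable_fun setT F.
  by apply/measurable_EFinP; apply: measurable_funM => //; exact: measurable_indic.
have F0 z : (0 <= F z)%E by rewrite lee_fin mulr_ge0// indicE.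
have e1 : (\int[leb2 (R := R)]_(x in Om) (f x)%:E = \int[leb \x leb]_x F x)%E.
  rewrite integral_mkcond; apply: eq_integral => x _.
  by rewrite patchE /F indicE; case: ifPn => _; rewrite ?mulr1 ?mulr0.
pose K (z : R * R) : \bar R := (`|z.1| * (f (z.1, z.1 * z.2) * \1_Om (z.1, z.1 * z.2)))%:E.
have mK : measurable_fun setT K.
  have mh : measurable_fun setT (fun z : R * R => (z.1, z.1 * z.2)).
    by apply: measurable_fun_pair => //; exact: measurable_funM.
  apply/measurable_EFinP; apply: measurable_funM; first exact: measurableT_comp.
  apply: measurable_funM; first exact: (measurableT_comp mf).
  by apply: (measurableT_comp _ mh); exact: measurable_indic.
have K0 z : (0 <= K z)%E by rewrite lee_fin mulr_ge0// mulr_ge0// indicE.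
rewrite e1 fubini_tonelli1//.
transitivity (\int[leb \x leb]_x K x)%E.
  rewrite fubini_tonelli1//.
  apply: ae_eq_integral => //.
  - exact: measurable_fun_fubini_tonelli_F.
  - exact: measurable_fun_fubini_tonelli_F.
  (* The substitution degenerates on the axis x = 0, a null set. *)
  exists [set 0]; split => //; first exact: lebesgue_measure_set1.
  move=> x /= H; apply: contrapT => /= x0; apply: H => _; rewrite /fubini_F.
  have {}x0 : x != 0 by apply/eqP.
  rewrite (@ge0_integral_scale _ x)//; last exact: measurable_fun_pair2.
  rewrite -ge0_integralZl//.
  by apply: (measurableT_comp (measurable_fun_pair2 x mF)); exact: measurable_mull.
rewrite fubini_tonelli2//.
pose W t := ray_integral f t + ray_integral f (t + pi).
have cr := continuous_ray_integral cf.
have cW : continuous W by rewrite /W; cont.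
have W0 t : 0 <= W t.
  by rewrite addr_ge0//; apply: itg_ge0 => y; rewrite in_itv/= => /andP[y0 _];
    rewrite mulr_ge0// mulr_ge0// sqr_ge0.
transitivity (\int[leb]_m (W (atan m) / (1 + m ^+ 2))%:E)%E.
  apply: eq_integral => m _; rewrite /fubini_G -line_integral// /itg /Rintegral fineK; last first.
    by apply: integrable_fin_num => //; apply: continuous_integrable_itv; cont.
  rewrite -integral_itv_obnd_cbnd; last first.
    by apply/measurable_EFinP; apply: measurable_funTS; apply: continuous_measurable_fun; cont.
  rewrite -integral_itv_bndo_bndc; last first.
    by apply/measurable_EFinP; apply: measurable_funTS; apply: continuous_measurable_fun; cont.
  rewrite [RHS]integral_mkcond; apply: eq_integral => x _.
  rewrite patchE /K indicE; have sl := star_line m x.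
  case: ifPn => [|/negP] xin.
    rewrite mem_set ?mulr1//; apply/sl; move: xin; rewrite inE/= in_itv/=; done.
  rewrite memNset ?mulr0// => /sl H; apply: xin; rewrite inE/= in_itv/=; done.
rewrite integral_oneDsqr_atan//; congr EFin; rewrite /W itgD//; last by cont.
rewrite itg_shift//; last lra.
have -> : - (pi / 2) + pi = pi / 2 :> R by lra.
rewrite -itg_cat//; [|lra..].
have -> : pi / 2 + pi = - (pi / 2) + 2 * pi :> R by lra.
rewrite (@itg_periodic _ _ (- pi))//; [|lra|exact: ray_integralD2pi].
by congr itg; lra.
Qed.

Let ge0_integrable_star_domain f : continuous f -> (forall x, 0 <= f x) ->
  (leb2 (R := R)).-integrable Om (EFin \o f).
Proof.
move=> cf f0; apply/integrableP; split.
  by apply/measurable_EFinP; apply: measurable_funTS; exact: continuous_measurable2.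
under eq_integral do rewrite /= ger0_norm//.
by rewrite ge0_integral_star_domain// ltry.
Qed.

Lemma integral_star_domain f : continuous f ->
  (leb2 (R := R)).-integrable Om (EFin \o f) /\
  \int[leb2 (R := R)]_(x in Om) f x = itg (- pi) pi (ray_integral f).
Proof.
move=> cf.
pose fp z := 2^-1 * (`|f z| + f z); pose fm z := 2^-1 * (`|f z| - f z).
have cfp : continuous fp by rewrite /fp; cont.
have cfm : continuous fm by rewrite /fm; cont.
have fp0 z : 0 <= fp z by rewrite /fp; have := ler_norm (- f z); rewrite normrN; lra.
have fm0 z : 0 <= fm z by rewrite /fm; have := ler_norm (f z); lra.
have fE : f = fun z => fp z - fm z by apply/funext => z; rewrite /fp /fm; field.
have ip := ge0_integrable_star_domain cfp fp0.
have im := ge0_integrable_star_domain cfm fm0.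
have mOm : measurable Om by exact: measurable_star_domain.
split.
  rewrite fE (_ : EFin \o _ = (EFin \o fp) \- (EFin \o fm))%E; first exact: integrableB.
  by apply/funext => z.
rewrite [in LHS]fE RintegralB// /Rintegral !ge0_integral_star_domain//=.
have crp := continuous_ray_integral cfp. have crm := continuous_ray_integral cfm.
rewrite -itgB//; apply: eq_itg => t _; rewrite /ray_integral -itgB; [|cont..].
by apply: eq_itg => y _; rewrite fE; ring.
Qed.

End Polar.

(** * Green's formula and orthogonality *)

Section Green.
Context {R : realType}.

(** A gradient is encoded by its chain rule along C^1 curves, the form needed on the rays and on the
    dilated boundary curves. *)
Definition gradient (V V1 V2 : R * R -> R) := forall (c1 c2 d1 d2 : R -> R) (s : R),
  (forall s : R, is_derive s (1 : R) c1 (d1 s)) ->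
  (forall s : R, is_derive s (1 : R) c2 (d2 s)) ->
  continuous d1 -> continuous d2 ->
  is_derive s (1 : R) (fun s => V (c1 s, c2 s))
    (d1 s * V1 (c1 s, c2 s) + d2 s * V2 (c1 s, c2 s)).

Variables (rho drho : R -> R).
Hypothesis rho0 : forall t, 0 < rho t.
Hypothesis rhop : forall t, rho (t + 2 * pi) = rho t.
Hypothesis drho_rho : forall t : R, is_derive t (1 : R) rho (drho t).
Hypothesis cdrho : continuous drho.

Let g1 t := rho t * cos t.
Let g2 t := rho t * sin t.

(* outer normal times the speed of the boundary parametrization (g1, g2) *)
Definition normal1 t := drho t * sin t + rho t * cos t.
Definition normal2 t := rho t * sin t - drho t * cos t.

Variables (V V1 V2 V11 V12 V22 U U1 U2 U11 U12 U22 : R * R -> R) (k2 l2 : R).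
Hypotheses (cV : continuous V) (cV1 : continuous V1) (cV2 : continuous V2).
Hypotheses (cV11 : continuous V11) (cV12 : continuous V12) (cV22 : continuous V22).
Hypotheses (cU : continuous U) (cU1 : continuous U1) (cU2 : continuous U2).
Hypotheses (cU11 : continuous U11) (cU12 : continuous U12) (cU22 : continuous U22).
Hypotheses (dV : gradient V V1 V2) (dV1 : gradient V1 V11 V12) (dV2 : gradient V2 V12 V22).
Hypotheses (dU : gradient U U1 U2) (dU1 : gradient U1 U11 U12) (dU2 : gradient U2 U12 U22).
Hypotheses (lV : forall x, V11 x + V22 x = - k2 * V x).
Hypotheses (lU : forall x, U11 x + U22 x = - l2 * U x).

(** The field H = V grad U - U grad V has divergence (k2 - l2) V U. In the coordinates (y, t) of the
    point y (g1 t, g2 t), the Jacobian y rho^2 times this divergence equals dA/dy + dB/dt. The first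
    term integrates to the boundary flux, since [A] vanishes at y = 0; the second integrates to 0 by
    periodicity. *)
Lemma green_star_domain :
  (k2 - l2) * \int[leb2 (R := R)]_(x in star_domain rho) (V x * U x) =
  itg (- pi) pi (fun t =>
    V (g1 t, g2 t) * (normal1 t * U1 (g1 t, g2 t) + normal2 t * U2 (g1 t, g2 t)) -
    U (g1 t, g2 t) * (normal1 t * V1 (g1 t, g2 t) + normal2 t * V2 (g1 t, g2 t))).
Proof.
have crho := is_derive_continuous drho_rho.
have cf : continuous (fun x => V x * U x) by cont.
have [_ ->] := integral_star_domain rho0 rhop crho cf.
have cr := continuous_ray_integral crho cf.
pose p y t : R * R := (y * g1 t, y * g2 t).
pose dg1 t := drho t * cos t - rho t * sin t.
pose dg2 t := drho t * sin t + rho t * cos t.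
pose h1 x := V x * U1 x - U x * V1 x.
pose h2 x := V x * U2 x - U x * V2 x.
pose h11 x := V x * U11 x - U x * V11 x.
pose h22 x := V x * U22 x - U x * V22 x.
pose h12 x := V2 x * U1 x + V x * U12 x - U2 x * V1 x - U x * V12 x.
pose h21 x := V1 x * U2 x + V x * U12 x - U1 x * V2 x - U x * V12 x.
pose A t y := y * (normal1 t * h1 (p y t) + normal2 t * h2 (p y t)).
pose dA t y := normal1 t * h1 (p y t) + normal2 t * h2 (p y t) +
  y * (normal1 t * (g1 t * h11 (p y t) + g2 t * h12 (p y t)) +
       normal2 t * (g1 t * h21 (p y t) + g2 t * h22 (p y t))).
pose B y t := g1 t * h2 (p y t) - g2 t * h1 (p y t).
pose dB (z : R * R) := let: y := z.2 in let: t := z.1 in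
  dg1 t * h2 (p y t) - dg2 t * h1 (p y t) +
  y * (g1 t * (dg1 t * h21 (p y t) + dg2 t * h22 (p y t)) -
       g2 t * (dg1 t * h11 (p y t) + dg2 t * h12 (p y t))).
have dg1E t : is_derive t (1 : R) g1 (dg1 t).
  by rewrite /g1; isd; rewrite /dg1; ring.
have dg2E t : is_derive t (1 : R) g2 (dg2 t).
  by rewrite /g2; isd; rewrite /dg2; ring.
have cg1 := is_derive_continuous dg1E. have cg2 := is_derive_continuous dg2E.
have cdg1 : continuous dg1 by rewrite /dg1; cont.
have cdg2 : continuous dg2 by rewrite /dg2; cont.
have cn1 : continuous normal1 by rewrite /normal1; cont.
have cn2 : continuous normal2 by rewrite /normal2; cont.
have dAE t y : is_derive y (1 : R) (A t) (dA t y).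
  have e1 (s : R) : is_derive s (1 : R) (fun y => y * g1 t) (g1 t) by isd; ring.
  have e2 (s : R) : is_derive s (1 : R) (fun y => y * g2 t) (g2 t) by isd; ring.
  have cst1 : continuous (fun _ : R => g1 t) by cont.
  have cst2 : continuous (fun _ : R => g2 t) by cont.
  have r F F1 F2 (H : gradient F F1 F2) := H _ _ _ _ y e1 e2 cst1 cst2.
  have rV := r _ _ _ dV. have rV1 := r _ _ _ dV1. have rV2 := r _ _ _ dV2.
  have rU := r _ _ _ dU. have rU1 := r _ _ _ dU1. have rU2 := r _ _ _ dU2.
  rewrite /A /h1 /h2 /p; isd.
  by rewrite /dA /h1 /h2 /h11 /h12 /h21 /h22 /p; ring.
have dBE y t : is_derive t (1 : R) (B y) (dB (t, y)).
  have e1 (s : R) : is_derive s (1 : R) (fun t => y * g1 t) (y * dg1 s) by isd; ring.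
  have e2 (s : R) : is_derive s (1 : R) (fun t => y * g2 t) (y * dg2 s) by isd; ring.
  have cst1 : continuous (fun t => y * dg1 t) by cont.
  have cst2 : continuous (fun t => y * dg2 t) by cont.
  have r F F1 F2 (H : gradient F F1 F2) := H _ _ _ _ t e1 e2 cst1 cst2.
  have rV := r _ _ _ dV. have rV1 := r _ _ _ dV1. have rV2 := r _ _ _ dV2.
  have rU := r _ _ _ dU. have rU1 := r _ _ _ dU1. have rU2 := r _ _ _ dU2.
  rewrite /B /h1 /h2 /p; isd.
  by rewrite /dB /h1 /h2 /h11 /h12 /h21 /h22 /p /=; ring.
have [ch1 ch2] : continuous h1 /\ continuous h2 by split; rewrite /h1 /h2; cont.
have [ch11 ch22] : continuous h11 /\ continuous h22 by split; rewrite /h11 /h22; cont.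
have [ch12 ch21] : continuous h12 /\ continuous h21 by split; rewrite /h12 /h21; cont.
have cdA' : continuous (fun z : R * R => dA z.1 z.2).
  by clear dAE dBE; clearbody h1 h2 h11 h22 h12 h21 dg1 dg2; rewrite /dA /p; cont.
have cdA t : continuous (dA t).
  move=> y; apply: (@cont_comp2 _ _ _ (fun z => dA z.1 z.2) (fun y => (t, y))) => //.
  by cont.
have cdB : continuous dB.
  by clear dAE dBE; clearbody h1 h2 h11 h22 h12 h21 dg1 dg2; rewrite /dB /p; cont.
rewrite -itgZ//.
transitivity (itg (- pi) pi (fun t => itg 0 1 (dA t) + itg 0 1 (fun y => dB (t, y)))).
  apply: eq_itg => t _; rewrite /ray_integral -itgZ; last by cont.
  rewrite -itgD//; last by cont.
  apply: eq_itg => y _; rewrite -/(g1 t) -/(g2 t) -/(p y t).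
  have cs := cos2Dsin2 t.
  have -> : rho t ^+ 2 = g1 t * dg2 t - g2 t * dg1 t.
    transitivity (rho t ^+ 2 * (cos t ^+ 2 + sin t ^+ 2)); first by rewrite cs mulr1.
    by rewrite /g1 /g2 /dg1 /dg2; ring.
  rewrite /dA /dB -/(normal1 t).
  have -> : normal1 t = dg2 t by [].
  have -> : normal2 t = - dg1 t by rewrite /normal2 /dg1; ring.
  rewrite /h11 /h22 /h12 /h21 /h1 /h2.
  have -> : V11 (p y t) = - k2 * V (p y t) - V22 (p y t) by rewrite -(lV (p y t)); ring.
  have -> : U11 (p y t) = - l2 * U (p y t) - U22 (p y t) by rewrite -(lU (p y t)); ring.
  by rewrite /=; ring.
have cI1 : continuous (fun t => itg 0 1 (dA t)).
  exact: continuous_itg cdA'.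
have cI2 : continuous (fun t => itg 0 1 (fun y => dB (t, y))).
  by apply: continuous_itg; cont.
have shift (f : R -> R) : (forall t, f (t + 2 * pi) = f t) -> f pi = f (- pi).
  by move=> fp; rewrite -[RHS]fp; congr f; ring.
have pi_shift : g1 pi = g1 (- pi).
  by apply: shift => t; rewrite /g1 rhop periodic_cosD2pi.
have pi_shift2 : g2 pi = g2 (- pi).
  by apply: shift => t; rewrite /g2 rhop periodic_sinD2pi.
rewrite itgD// (itg_fubini _ _ _ _ cdB).
have -> : itg 0 1 (fun y => itg (- pi) pi (fun t => dB (t, y))) = itg 0 1 (fun=> 0).
  apply: eq_itg => y _; rewrite (itg_derive _ (dBE y)); last by cont.
    by rewrite /B /p pi_shift pi_shift2 subrr.
  by have := pi_ge0 R; lra.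
rewrite itg_cst// mul0r addr0; apply: eq_itg => t _.
rewrite (itg_derive _ (dAE t))// /A /p !mul1r mul0r subr0 /h1 /h2; ring.
Qed.

End Green.

(** * Orthogonality of the incident wave to the test waves *)

Section Orthogonality.
Context {R : realType}.
Variables (rho : R -> R).
Hypothesis rho0 : forall t, 0 < rho t.
Hypothesis rhop : forall t, rho (t + 2 * pi) = rho t.
Hypothesis crho : continuous rho.
Let Om := star_domain rho.
Local Notation mu := (leb2 (R := R)).

Lemma continuous_integrable_star_domain (f : R * R -> R) : continuous f ->
  mu.-integrable Om (EFin \o f).
Proof. by move=> /(integral_star_domain rho0 rhop crho)[]. Qed.

(** From |u w| <= u^2 + w^2. *)
Lemma L2_mul_integrable (u w : R * R -> R) : L2 Om u -> continuous w ->
  mu.-integrable Om (EFin \o (fun x => u x * w x)).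
Proof.
move=> [mu' iu] cw.
have mOm : measurable Om by exact: measurable_star_domain.
have iw : mu.-integrable Om (EFin \o (fun x => w x ^+ 2)).
  by apply: continuous_integrable_star_domain; cont.
have h : mu.-integrable Om ((fun x => (u x ^+ 2)%R%:E) \+ (EFin \o (fun x => w x ^+ 2)%R))%E.
  exact: integrableD.
apply: (@le_integrable _ _ _ (leb \x leb)%E _ mOm _ _ _ _ h).
  apply/measurable_EFinP; apply: measurable_funM => //.
  by apply: measurable_funTS; exact: continuous_measurable2.
move=> x _; rewrite /= lee_fin.
rewrite [leRHS]ger0_norm ?addr_ge0 ?sqr_ge0//.
set s : R := u x; set t : R := w x.
have h1 := sqr_ge0 (s - t). have h2 := sqr_ge0 (s + t).
by rewrite ler_norml; apply/andP; split; nra.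
Qed.

Lemma EFin_Rintegral (f : R * R -> R) : mu.-integrable Om (EFin \o f) ->
  (\int[mu]_(x in Om) (f x)%:E = (\int[mu]_(x in Om) f x)%:E)%E.
Proof.
move=> fi; rewrite /Rintegral fineK//; apply: integrable_fin_num => //.
exact: measurable_star_domain.
Qed.

(** The Dirichlet identity is tested with the partial derivatives of the wave U, so that its two
    halves add up to (u - v) Delta U plus the gradient terms; the Neumann identity is tested with U
    itself. As Delta U = - q k^2 U, all terms in u and its weak gradient cancel in the difference,
    and k^2 (1 - q) v U remains. *)
Lemma matching_orthogonal k q a b (u g1 g2 : R * R -> R) :
  0 < k -> 1 < q -> continuous a -> continuous b ->
  H1 Om u g1 g2 -> dirichlet_match Om u g1 g2 (hw k a b) ->
  neumann_match Om k q u g1 g2 (hw k a b) ->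
  forall A B, continuous A -> continuous B ->
  \int[mu]_(x in Om) (hw k a b x * hw (Num.sqrt q * k) A B x) = 0.
Proof.
move=> k0 q1 ca cb [Lu [Lg1 [Lg2 _]]] Dm Nm A B cA cB.
set l := Num.sqrt q * k.
pose V := hw k a b; pose V1 := hw1 k a b; pose V2 := hw2 k a b.
pose U := hw l A B; pose U1 := hw1 l A B; pose U2 := hw2 l A B.
pose U11 := hw1 l (fun t => l * cos t * B t) (fun t => - (l * cos t * A t)).
pose U22 := hw2 l (fun t => l * sin t * B t) (fun t => - (l * sin t * A t)).
have mOm : measurable Om by exact: measurable_star_domain.
have cV : continuous V by exact: continuous_hw.
have [cV1 cV2] : continuous V1 /\ continuous V2 by split; apply: continuous_hw; cont.
have cU : continuous U by exact: continuous_hw.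
have [cU1 cU2] : continuous U1 /\ continuous U2 by split; apply: continuous_hw; cont.
have [cU11 cU22] : continuous U11 /\ continuous U22 by split; apply: continuous_hw; cont.
have lU x : U11 x + U22 x = - (q * k ^+ 2) * U x.
  by rewrite /U11 /U22 hw_laplace// /l exprMn sqr_sqrtr//; lra.
have sU : smooth2 U by exact: smooth2_hw.
have sU1 : smooth2 U1 by apply: smooth2_hw; cont.
have sU2 : smooth2 U2 by apply: smooth2_hw; cont.
have [D1 _] := Dm _ sU1. have [_ D2] := Dm _ sU2. have N := Nm _ sU.
rewrite !partial1_hw// in D1; [|cont..].
rewrite !partial2_hw// in D2; [|cont..].
rewrite !partial1_hw// !partial2_hw// -/U1 -/U2 -/V1 -/V2 -/V -/U in N.
rewrite -/U11 -/V1 -/U1 -/V in D1. rewrite -/U22 -/V2 -/U2 -/V in D2.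
have I := L2_mul_integrable. have C := continuous_integrable_star_domain.
have iD (f g : R * R -> R) : mu.-integrable Om (EFin \o f) -> mu.-integrable Om (EFin \o g) ->
    mu.-integrable Om (EFin \o (fun x => f x + g x)).
  move=> fi gi; rewrite (_ : EFin \o _ = (EFin \o f) \+ (EFin \o g))%E; last exact/funext.
  exact: integrableD.
have iB (f g : R * R -> R) : mu.-integrable Om (EFin \o f) -> mu.-integrable Om (EFin \o g) ->
    mu.-integrable Om (EFin \o (fun x => f x - g x)).
  move=> fi gi; rewrite (_ : EFin \o _ = (EFin \o f) \- (EFin \o g))%E; last exact/funext.
  exact: integrableB.
have lin (p1 p2 p3 p4 : R * R -> R) : mu.-integrable Om (EFin \o p1) ->
    mu.-integrable Om (EFin \o p2) -> mu.-integrable Om (EFin \o p3) ->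
    mu.-integrable Om (EFin \o p4) ->
    \int[mu]_(x in Om) ((p1 x - p2 x) - (p3 x + p4 x)) =
    (\int[mu]_(x in Om) p1 x - \int[mu]_(x in Om) p2 x) -
    (\int[mu]_(x in Om) p3 x + \int[mu]_(x in Om) p4 x).
  move=> i1 i2 i3 i4; have j1 := iB _ _ i1 i2. have j2 := iD _ _ i3 i4.
  by rewrite RintegralB// RintegralB// RintegralD.
pose d1 x := (u x - V x) * U11 x + (g1 x - V1 x) * U1 x.
pose d2 x := (u x - V x) * U22 x + (g2 x - V2 x) * U2 x.
pose n1 x := g1 x * U1 x + g2 x * U2 x - k ^+ 2 * q * u x * U x.
pose n2 x := V1 x * U1 x + V2 x * U2 x - k ^+ 2 * V x * U x.
have id1 : mu.-integrable Om (EFin \o d1).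
  rewrite (_ : d1 = fun x => u x * U11 x + g1 x * U1 x - (V x * U11 x + V1 x * U1 x)).
    by apply: iB; [apply: iD; exact: I|apply: C; cont].
  by apply/funext => x; rewrite /d1; ring.
have id2 : mu.-integrable Om (EFin \o d2).
  rewrite (_ : d2 = fun x => u x * U22 x + g2 x * U2 x - (V x * U22 x + V2 x * U2 x)).
    by apply: iB; [apply: iD; exact: I|apply: C; cont].
  by apply/funext => x; rewrite /d2; ring.
have in1 : mu.-integrable Om (EFin \o n1).
  rewrite (_ : n1 = fun x => g1 x * U1 x + g2 x * U2 x - u x * (k ^+ 2 * q * U x)).
    by apply: iB; [apply: iD; exact: I|apply: I => //; cont].
  by apply/funext => x; rewrite /n1; ring.
have in2 : mu.-integrable Om (EFin \o n2) by apply: C; rewrite /n2; cont.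
have {}D1 : \int[mu]_(x in Om) d1 x = 0.
  by apply: EFin_inj; rewrite -EFin_Rintegral.
have {}D2 : \int[mu]_(x in Om) d2 x = 0.
  by apply: EFin_inj; rewrite -EFin_Rintegral.
have {}N : \int[mu]_(x in Om) n1 x = \int[mu]_(x in Om) n2 x.
  by apply: EFin_inj; rewrite -!EFin_Rintegral.
have key : \int[mu]_(x in Om) (k ^+ 2 * (1 - q) * (V x * U x)) = 0.
  transitivity (\int[mu]_(x in Om) ((n1 x - n2 x) - (d1 x + d2 x))).
    apply: eq_Rintegral => x _; rewrite /n1 /n2 /d1 /d2.
    have -> : U11 x = - (q * k ^+ 2) * U x - U22 x by rewrite -lU; ring.
    by ring.
  by rewrite lin// N D1 D2 subrr addr0 subrr.
move: key; rewrite RintegralZl//; last by apply: C; cont.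
move/eqP; rewrite mulf_eq0 => /orP[|/eqP//].
by rewrite mulf_eq0 sqrf_eq0 gt_eqF//= => /eqP; lra.
Qed.

End Orthogonality.

(** * Stationary phase *)

Section StationaryPhase.
Context {R : realType}.
Implicit Types (l M t : R) (h dh g dg : R -> R).

Lemma deriv_lipschitz h dh M : (forall t : R, is_derive t (1 : R) h (dh t)) -> continuous dh ->
  (forall t, `|dh t| <= M) -> forall s t, `|h t - h s| <= M * `|t - s|.
Proof.
move=> dhE cdh hM s t.
wlog st : s t / s <= t.
  move=> H; have [/H//|/ltW/H] := leP s t.
  by rewrite distrC [X in _ * X]distrC.
rewrite -(itg_derive st dhE)// [`|t - s|]ger0_norm ?subr_ge0//.
by apply: norm_itg_le_cst.
Qed.

(** Since x cos x <= sin x at x = t/2, doubling the angle gives 2 sin t >= 2 t cos^2(t/2) = t (1 +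
    cos t) >= t. *)
Lemma le_sin2 t : 0 <= t <= pi / 2 -> t <= 2 * sin t.
Proof.
move=> /andP[t0 tpi]; have pi0 := @pi_gt0 R.
pose f (x : R) := sin x - x * cos x.
pose df (x : R) := x * sin x.
have dfE (x : R) : is_derive x (1 : R) f (df x) by rewrite /f; isd; rewrite /df; ring.
have f0 : 0 <= f (t / 2).
  have <- : itg 0 (t / 2) df = f (t / 2).
    rewrite (itg_derive _ dfE); [by rewrite /f sin0 mul0r !subr0|lra|by rewrite /df; cont].
  apply: itg_ge0 => x; rewrite in_itv/= => /andP[x0 xt].
  by rewrite mulr_ge0// sin_ge0_pi//; lra.
have c0 : 0 <= cos (t / 2) by apply: cos_ge0_pihalf; lra.
have ct0 : 0 <= cos t by apply: cos_ge0_pihalf; lra.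
have tE : t = t / 2 + t / 2 by lra.
have ct : cos t = 2 * cos (t / 2) ^+ 2 - 1.
  by rewrite {1}tE cosD -!expr2 sin2cos2; ring.
have st : sin t = 2 * (sin (t / 2) * cos (t / 2)) by rewrite {1}tE sinD; ring.
rewrite st; have : 0 <= f (t / 2) * cos (t / 2) by rewrite mulr_ge0.
rewrite /f; move: ct ct0; set s := sin _; set c := cos (t / 2) => -> ct0.
nra.
Qed.

(** The three assumed zeros are the zeros of sin on the interval. The Lipschitz bound controls [h]
    by the distance to the nearest of them, and [le_sin2] compares that distance with |sin t|. *)
Lemma vanishing_le_sin h dh M : (forall t : R, is_derive t (1 : R) h (dh t)) -> continuous dh ->
  (forall t, `|dh t| <= M) -> h (- pi) = 0 -> h 0 = 0 -> h pi = 0 ->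
  {in `[- pi, pi], forall t, `|h t| <= 2 * M * `|sin t|}.
Proof.
move=> dhE cdh hM hNpi h0 hpi t; rewrite in_itv/= => /andP[tl tr].
have pi0 := @pi_gt0 R.
have lip := deriv_lipschitz dhE cdh hM.
have M0 : 0 <= M by apply: le_trans (hM 0).
have key (d : R) : 0 <= d <= pi / 2 -> `|h t| <= M * d -> `|sin t| = sin d -> `|h t| <= 2 * M * `|sin t|.
  by move=> d0 hd ->; have := le_sin2 d0; nra.
have sge (d : R) : 0 <= d <= pi -> 0 <= sin d by move=> ?; apply: sin_ge0_pi.
have [t1|t1] := leP t (- (pi / 2)).
  apply: (key (t + pi)); first lra.
    by have := lip (- pi) t; rewrite hNpi subr0 opprK [`|t + pi|]ger0_norm//; lra.
  by rewrite sinDpi -normrN ger0_norm// -sinDpi; apply: sge; lra.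
have [t2|t2] := leP t 0.
  apply: (key (- t)); first lra.
    by have := lip 0 t; rewrite h0 !subr0 [`|t|]ler0_norm//; lra.
  by rewrite sinN -normrN ger0_norm// -sinN; apply: sge; lra.
have [t3|t3] := leP t (pi / 2).
  apply: (key t); first lra.
    by have := lip 0 t; rewrite h0 !subr0 [`|t|]ger0_norm//; lra.
  by rewrite ger0_norm//; apply: sge; lra.
apply: (key (pi - t)); first lra.
  by have := lip pi t; rewrite hpi subr0 distrC [`|pi - t|]ger0_norm//; lra.
rewrite addrC sinDpi sinN opprK ger0_norm//; apply: sge; lra.
Qed.

(** The weight which the cutoff sin^2 / (sin^2 + 1/l) leaves in the error. Its integral may grow
    with l; what is needed is that it is o(sqrt l). *)
Definition phase_weight l t := `|sin t| / (sin t ^+ 2 + l^-1).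
Definition phase_defect l : R := itg (- pi) pi (phase_weight l).

Lemma phase_denom_gt0 l t : 0 < l -> 0 < sin t ^+ 2 + l^-1.
Proof. by move=> l0; rewrite ltr_wpDl ?sqr_ge0// invr_gt0. Qed.

Lemma continuous_phase_weight l : 0 < l -> continuous (phase_weight l).
Proof.
move=> l0; have d0 t : sin t ^+ 2 + l^-1 != 0 by rewrite gt_eqF// phase_denom_gt0.
by rewrite /phase_weight; cont.
Qed.

Lemma phase_defect_ge0 l : 0 < l -> 0 <= phase_defect l.
Proof.
by move=> l0; apply: itg_ge0 => t _; rewrite divr_ge0// ltW// phase_denom_gt0.
Qed.

(* The cutoff sin^2 / (sin^2 + 1/l) allows one integration by parts against K sin. *)
Lemma vanishing_phase_integral h dh M l (K L : R -> R) : 0 < l ->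
  (forall t : R, is_derive t (1 : R) h (dh t)) -> continuous dh ->
  (forall t, `|dh t| <= M) -> h (- pi) = 0 -> h 0 = 0 -> h pi = 0 ->
  continuous K -> (forall t : R, is_derive t (1 : R) L (sin t * K t)) ->
  (forall t, `|K t| <= 1) -> (forall t, `|L t| <= l^-1) ->
  `|itg (- pi) pi (fun t => h t * K t)| <= 5 * M * (l^-1 * phase_defect l).
Proof.
move=> l0 dhE cdh hM hNpi h0 hpi cK dL K1 L1.
have pi0 := @pi_gt0 R.
have npi : - pi <= pi :> R by lra.
have hs := vanishing_le_sin dhE cdh hM hNpi h0 hpi.
have ch := is_derive_continuous dhE. have cL := is_derive_continuous dL.
pose D t := sin t ^+ 2 + l^-1.
have D0 t : 0 < D t by exact: phase_denom_gt0.
have Dn0 t : D t != 0 by rewrite gt_eqF.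
have cD : continuous D by rewrite /D; cont.
have dD (t : R) : is_derive t (1 : R) D (2 * sin t * cos t) by rewrite /D; isd; ring.
pose u t := h t * sin t / D t.
pose du t := (dh t * sin t) / D t + h t * cos t * (l^-1 - sin t ^+ 2) / D t ^+ 2.
have dcos (t : R) := is_derive_cos t. have dsin (t : R) := is_derive_sin t.
have duE (t : R) : is_derive t (1 : R) u (du t).
  have e := @isdM _ _ (fun t => (D t)^-1) _ _ _ (isdM (dhE t) (dsin t)) (isdV (Dn0 t) (dD t)).
  by apply: isd_eq e _; rewrite /du (_ : l^-1 - _ = D t - 2 * sin t ^+ 2);
    [field; exact: Dn0|rewrite /D; ring].
have cdu : continuous du.
  have D2 t : D t ^+ 2 != 0 by rewrite expf_neq0.
  by rewrite /du; cont.
have cu := is_derive_continuous duE.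
(* Here h = h (1/l) / D + u sin, and sin K is the derivative of [L]; the boundary terms vanish
   because [u] contains the factor sin. *)
have e1 : itg (- pi) pi (fun t => h t * K t) =
    itg (- pi) pi (fun t => h t * (l^-1 / D t) * K t) - itg (- pi) pi (fun t => du t * L t).
  have cDV : continuous (fun t => (D t)^-1) by cont.
  transitivity (itg (- pi) pi (fun t => h t * (l^-1 / D t) * K t) +
    itg (- pi) pi (fun t => u t * (sin t * K t))).
    rewrite -itgD; [|cont..]; apply: eq_itg => t _.
    by rewrite /u (_ : l^-1 = D t - sin t ^+ 2); [field; exact: Dn0|rewrite /D; ring].
  congr (_ + _); rewrite (itg_byparts npi duE dL)//; last by cont.
  by rewrite /u sinN sinpi oppr0 !mulr0 !mul0r subrr sub0r.
have cw := continuous_phase_weight l0.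
have M0 : 0 <= M by apply: le_trans (hM 0).
have wE t : phase_weight l t = `|sin t| / D t by [].
(* The constant 5 M is 2 M from this term, by |h| <= 2 M |sin|, plus M and 2 M from the two summands
   of [du] below. *)
have b1 : `|itg (- pi) pi (fun t => h t * (l^-1 / D t) * K t)| <= 2 * M * l^-1 * phase_defect l.
  rewrite /phase_defect -itgZ//.
  apply: norm_itg_le; [by cont|by cont|] => t tpi.
  rewrite !normrM !normfV [`|l|]gtr0_norm// [`|D t|]gtr0_norm// wE.
  apply: le_trans (ler_piMr _ (K1 t)) _; first by rewrite !mulr_ge0// ?invr_ge0 ltW.
  have := hs t tpi; set x := `|h t|; set s := `|sin t| => hx.
  have -> : 2 * M * l^-1 * (s / D t) = (2 * M * s) * (l^-1 / D t) by ring.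
  by rewrite ler_wpM2r// divr_ge0// ?invr_ge0 ltW.
have b2 : `|itg (- pi) pi (fun t => du t * L t)| <= 3 * M * l^-1 * phase_defect l.
  rewrite /phase_defect -itgZ//.
  apply: norm_itg_le; [by cont|by cont|] => t tpi.
  rewrite normrM wE.
  have -> : 3 * M * l^-1 * (`|sin t| / D t) = (M * `|sin t| / D t + 2 * M * `|sin t| / D t) * l^-1 by ring.
  apply: ler_pM => //.
  rewrite /du; apply: le_trans (ler_normD _ _) _; apply: lerD.
    rewrite !normrM normfV [`|D t|]gtr0_norm//.
    by apply: ler_wpM2r; [rewrite invr_ge0 ltW|apply: ler_wpM2r].
  rewrite !normrM normfV [`|D t ^+ 2|]gtr0_norm ?exprn_gt0//.
  have hx := hs t tpi.
  have cx : `|h t| * `|cos t| <= 2 * M * `|sin t|.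
    by apply: le_trans hx; rewrite ler_piMr// cos_max.
  have dx : `|l^-1 - sin t ^+ 2| <= D t.
    rewrite /D ler_norml; have := sqr_ge0 (sin t); have : 0 < l^-1 by rewrite invr_gt0.
    by move=> ? ?; apply/andP; split; lra.
  have -> : (2 * M * `|sin t|) / D t = (2 * M * `|sin t|) * D t / D t ^+ 2.
    by field.
  by apply: ler_wpM2r; [rewrite invr_ge0 exprn_ge0 ?ltW|apply: ler_pM; rewrite ?mulr_ge0].
rewrite e1; apply: le_trans (ler_normB _ _) _.
by apply: le_trans (lerD b1 b2) _; rewrite le_eqVlt; apply/orP; left; apply/eqP; ring.
Qed.

(* [2 pi J_0(l)] and [2 pi J_1(l)] *)
Definition phase_cos l : R := itg (- pi) pi (fun t => cos (l * cos t)).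
Definition phase_sin l : R := itg (- pi) pi (fun t => cos t * sin (l * cos t)).

Lemma itg_odd_cos (F : R -> R) : continuous F -> (forall x, F (- x) = - F x) ->
  itg (- pi) pi (fun t => F (cos t)) = 0.
Proof.
move=> cF oF.
have e : itg (- pi) pi (fun t => F (cos (t + pi))) = itg (- pi) pi (fun t => F (cos t)).
  apply: (@itg_shift_periodic _ pi (fun t => F (cos t))); first by cont.
  by move=> t; rewrite periodic_cosD2pi.
have : itg (- pi) pi (fun t => F (cos t)) = - itg (- pi) pi (fun t => F (cos t)).
  rewrite -{1}e -itgN; last by cont.
  by apply: eq_itg => t _; rewrite cosDpi oF.
lra.
Qed.

(** Subtracting A + B cos t leaves an amplitude that vanishes at 0 and at both ends. Against the
    cosine kernel the B part integrates to 0 by oddness in cos t, and against the sine kernel the A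
    part does; the surviving parts are multiples of [phase_cos] and [phase_sin]. The factor 10 is 5
    times the 2 in the bound on [dh]. *)
Lemma stationary_phase g dg M l : 0 < l ->
  (forall t : R, is_derive t (1 : R) g (dg t)) -> continuous dg ->
  (forall t, g (t + 2 * pi) = g t) -> (forall t, `|g t| <= M) -> (forall t, `|dg t| <= M) ->
  `|itg (- pi) pi (fun t => g t * cos (l * cos t)) - (g 0 + g pi) / 2 * phase_cos l| <=
    10 * M * (l^-1 * phase_defect l) /\
  `|itg (- pi) pi (fun t => g t * sin (l * cos t)) - (g 0 - g pi) / 2 * phase_sin l| <=
    10 * M * (l^-1 * phase_defect l).
Proof.
move=> l0 dgE cdg gp gM dgM.
have cg := is_derive_continuous dgE.
pose A := (g 0 + g pi) / 2; pose B := (g 0 - g pi) / 2.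
pose h t := g t - A - B * cos t.
pose dh t := dg t + B * sin t.
have dhE (t : R) : is_derive t (1 : R) h (dh t).
  by rewrite /h; isd; rewrite /dh; ring.
have cdh : continuous dh by rewrite /dh; cont.
have gNpi : g (- pi) = g pi by rewrite -[LHS]gp; congr g; ring.
have hM t : `|dh t| <= 2 * M.
  have BM : `|B| <= M.
    rewrite /B normrM normfV [`|2|]gtr0_norm//; have := ler_normB (g 0) (g pi).
    by have := gM 0; have := gM pi; lra.
  apply: le_trans (ler_normD _ _) _; rewrite normrM.
  have : `|B| * `|sin t| <= `|B| by rewrite ler_piMr// sin_max.
  by have := dgM t; lra.
have hNpi : h (- pi) = 0 by rewrite /h gNpi cosN cospi /A /B; field.
have h0 : h 0 = 0 by rewrite /h cos0 /A /B; field.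
have hpi : h pi = 0 by rewrite /h cospi /A /B; field.
have l1 : 0 < l^-1 by rewrite invr_gt0.
have ln0 : l != 0 by rewrite gt_eqF.
have mE : 10 * M * (l^-1 * phase_defect l) = 5 * (2 * M) * (l^-1 * phase_defect l) by ring.
rewrite mE; split.
- have -> : itg (- pi) pi (fun t => g t * cos (l * cos t)) - A * phase_cos l =
      itg (- pi) pi (fun t => h t * cos (l * cos t)).
    have z := @itg_odd_cos (fun x => x * cos (l * x)) ltac:(cont)
      (fun x => ltac:(by rewrite /= mulrN cosN mulNr)).
    rewrite /phase_cos -itgZ; last by cont.
    rewrite -itgB; [|cont..].
    rewrite -[LHS]subr0 -(mulr0 B) -z -itgZ; last by cont.
    rewrite -itgB; [|cont..].
    by apply: eq_itg => t _; rewrite /h; ring.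
  apply: (@vanishing_phase_integral h dh (2 * M) l _ (fun t => - l^-1 * sin (l * cos t))) => //.
  + by cont.
  + by move=> t; isd; field.
  + by move=> t; exact: cos_max.
  + by move=> t; rewrite normrM normrN [`|l^-1|]gtr0_norm// ler_piMr ?sin_max// ltW.
- have -> : itg (- pi) pi (fun t => g t * sin (l * cos t)) - B * phase_sin l =
      itg (- pi) pi (fun t => h t * sin (l * cos t)).
    have z := @itg_odd_cos (fun x => sin (l * x)) ltac:(cont)
      (fun x => ltac:(by rewrite /= mulrN sinN)).
    rewrite /phase_sin -itgZ; last by cont.
    rewrite -itgB; [|cont..].
    rewrite -[LHS]subr0 -(mulr0 A) -z -itgZ; last by cont.
    rewrite -itgB; [|cont..].
    by apply: eq_itg => t _; rewrite /h; ring.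
  apply: (@vanishing_phase_integral h dh (2 * M) l _ (fun t => l^-1 * cos (l * cos t))) => //.
  + by cont.
  + by move=> t; isd; field.
  + by move=> t; exact: sin_max.
  + by move=> t; rewrite normrM [`|l^-1|]gtr0_norm// ler_piMr ?cos_max// ltW.
Qed.

End StationaryPhase.

(** * Limits by dominated convergence *)

Section Dominated.
Context {R : realType}.

Lemma itg_dominated_cvg0 (a b C : R) (f : nat -> R -> R) :
  (forall n, continuous (f n)) -> (forall n, {in `[a, b], forall t, `|f n t| <= C}) ->
  {ae (@lebesgue_measure R), forall t, t \in `[a, b] -> f ^~ t @ \oo --> (0 : R)} ->
  itg a b (f n) @[n --> \oo] --> (0 : R).
Proof.
move=> cf fC f0.
have [||||||_ _ H] := @dominated_convergence _ _ R leb `[a, b]%classic _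
  (fun n t => (f n t)%:E) (fun=> 0%E) (fun=> C%:E).
- by [].
- move=> n; apply/measurable_EFinP; apply: measurable_funTS.
  exact: continuous_measurable_fun.
- exact: measurable_cst.
- case: f0 => Z [mZ Z0 sZ]; exists Z; split => // t /= H; apply: sZ => /= H2; apply: H => tab.
  by apply/fine_cvgP; split; [exact: nearW|apply: H2].
- have := @continuous_integrable_itv R a b (fun=> C) (@cont_cst _ _ C).
  exact.
- by apply: aeW => t n tab /=; rewrite lee_fin; apply: fC.
move: H; rewrite integral0 => /fine_cvg; exact.
Qed.

Lemma cvg0_le (u : nat -> R) (e : R) : 0 < e -> u @ \oo --> (0 : R) ->
  exists N, forall n, (N <= n)%N -> `|u n| <= e.
Proof. by move=> e0 /cvgr0Pnorm_le/(_ _ e0)[N _ H]; exists N. Qed.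

(** As d tends to 0 the factor d / (r^2 + d), at most 1, tends to 0 wherever r does not vanish,
    hence at almost every point where g does not vanish. *)
Lemma cutoff_small (g r : R -> R) (a b e : R) : continuous g -> continuous r -> 0 < e ->
  {ae (@lebesgue_measure R), forall t, g t != 0 -> r t != 0} ->
  exists2 d, 0 < d & itg a b (fun t => `|g t| * (d / (r t ^+ 2 + d))) <= e.
Proof.
move=> cg cr e0 gr.
have [C C0 gC] := continuous_bounded_itv a b cg.
pose d n : R := n.+1%:R^-1.
have d0 n : 0 < d n by rewrite invr_gt0.
have D0 n t : 0 < r t ^+ 2 + d n by rewrite ltr_wpDl ?sqr_ge0.
have Dn n t : r t ^+ 2 + d n != 0 by rewrite gt_eqF.
pose f n t := `|g t| * (d n / (r t ^+ 2 + d n)).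
have cf n : continuous (f n).
  by have Dn' := Dn n; rewrite /f; cont.
have f0 n t : 0 <= f n t by rewrite mulr_ge0// divr_ge0// ltW.
have fC n : {in `[a, b], forall t, `|f n t| <= C}.
  move=> t tab; rewrite ger0_norm//; apply: le_trans (gC t tab).
  by rewrite ler_piMr// ler_pdivrMr// mul1r lerDr sqr_ge0.
have fl : {ae (@lebesgue_measure R), forall t, t \in `[a, b] -> f ^~ t @ \oo --> (0 : R)}.
  case: gr => Z [mZ Z0 sZ]; exists Z; split => // t /= H; apply: sZ => /= H2; apply: H => _.
  have [gt0|gt0] := eqVneq (g t) 0.
    by rewrite /f gt0 normr0; under eq_fun do rewrite mul0r; exact: cvg_cst.
  have rt := H2 gt0.
  have dl : d n @[n --> \oo] --> (0 : R) by exact: cvg_harmonic.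
  have -> : (0 : R) = `|g t| * (0 / (r t ^+ 2 + 0)) by rewrite mul0r mulr0.
  apply: cvgM; first exact: cvg_cst.
  apply: cvgM => //; apply: cvgV; first by rewrite addr0 sqrf_eq0.
  by apply: cvgD => //; exact: cvg_cst.
have [N /(_ N (leqnn N)) H] := cvg0_le e0 (itg_dominated_cvg0 cf fC fl).
by exists (d N) => //; apply: le_trans H; exact: ler_norm.
Qed.

(** Divided by sqrt(l) the weight is at most 1, by the arithmetic-geometric inequality, and at most
    1 / (sqrt(l) |sin t|), so dominated convergence applies. A failure would give a sequence of
    values of l, since that theorem speaks of sequences. *)
Lemma phase_defect_small (e : R) : 0 < e -> exists2 L : R, 1 <= L &
  forall l, L <= l -> (Num.sqrt l)^-1 * phase_defect l <= e.
Proof.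
move=> e0; apply: contrapT => H.
have {}H n : exists l : R, n.+1%:R <= l /\ e < (Num.sqrt l)^-1 * phase_defect l.
  apply: contrapT => Hn; apply: H; exists n.+1%:R; first by rewrite ler1n.
  by move=> l nl; rewrite leNgt; apply/negP => h; apply: Hn; exists l.
have [u Hu] := choice H.
have u0 n : 0 < u n by apply: lt_le_trans (Hu n).1.
have s0 n : 0 < Num.sqrt (u n) by rewrite sqrtr_gt0.
pose f n t := (Num.sqrt (u n))^-1 * phase_weight (u n) t.
have cf n : continuous (f n).
  by have cw := continuous_phase_weight (u0 n); rewrite /f; cont.
have D0 n t : 0 < sin t ^+ 2 + (u n)^-1 by exact: phase_denom_gt0.
have f0 n t : 0 <= f n t by rewrite mulr_ge0 ?invr_ge0 ?divr_ge0// ltW.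
have sE n : (Num.sqrt (u n))^-1 ^+ 2 = (u n)^-1.
  by rewrite exprVn sqr_sqrtr// ltW.
have f1 n : {in `[- pi, pi], forall t, `|f n t| <= 1}.
  move=> t _; rewrite ger0_norm// /f /phase_weight mulrA ler_pdivrMr// mul1r -sE.
  have h1 : 0 < (Num.sqrt (u n))^-1 by rewrite invr_gt0.
  rewrite -[sin t ^+ 2](real_normK (num_real _)).
  by have := sqr_ge0 ((Num.sqrt (u n))^-1 - `|sin t|); nra.
have fl : {ae (@lebesgue_measure R), forall t, t \in `[- pi, pi] -> f ^~ t @ \oo --> (0 : R)}.
  apply: aeW => t _; rewrite /f /phase_weight.
  have [st|st] := eqVneq (sin t) 0.
    by rewrite st normr0; under eq_fun do rewrite mul0r mulr0; exact: cvg_cst.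
  have cl : (Num.sqrt (u n))^-1 @[n --> \oo] --> (0 : R).
    apply/cvgr0Pnorm_le => eps eps0.
    have [N HN] := cvg0_le (exprn_gt0 2 eps0) (@cvg_harmonic R).
    exists N => // n /= /HN; rewrite ger0_norm ?invr_ge0// => h.
    have x0 : 0 <= (Num.sqrt (u n))^-1 by rewrite invr_ge0 ltW.
    rewrite ger0_norm// -ler_sqr ?nnegrE//; last exact: ltW.
    rewrite sE; apply: le_trans h; rewrite lef_pV2 ?posrE//.
    exact: (Hu n).1.
  apply: (@squeeze_cvgr _ _ _ _ (fun=> 0) (fun n => (Num.sqrt (u n))^-1 * `|sin t|^-1)).
  - apply: nearW => n; rewrite f0 /=; apply: ler_wpM2l; first by rewrite invr_ge0 ltW.
    have ns : 0 < `|sin t| by rewrite normr_gt0.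
    rewrite ler_pdivrMr// mulrC ler_pdivlMr// -expr2 real_normK ?num_real// lerDl.
    by rewrite invr_ge0 ltW.
  - exact: cvg_cst.
  - by rewrite -(mul0r `|sin t|^-1); apply: cvgM => //; exact: cvg_cst.
have [N /(_ N (leqnn N)) HN] := cvg0_le e0 (itg_dominated_cvg0 cf f1 fl).
have := (Hu N).2; rewrite ltNge => /negP; apply.
apply: le_trans HN; rewrite /phase_defect -itgZ; first exact: ler_norm.
exact: continuous_phase_weight.
Qed.

End Dominated.

(** * Normalized Bessel amplitudes *)

Section Amplitudes.
Context {R : realType}.
Implicit Types (l : R).

Lemma derive_le0_le (f df : R -> R) a b : a <= b ->
  (forall x : R, a <= x <= b -> is_derive x (1 : R) f (df x)) ->
  (forall x, a <= x <= b -> df x <= 0) -> f b <= f a.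
Proof.
move=> ab fE f0.
have [||c] := @MVT_segment R f df a b ab.
- by move=> x; rewrite in_itv/= => xab; apply: fE; lra.
- apply: continuous_in_subspaceT => x; rewrite inE/= in_itv/= => xab.
  apply/differentiable_continuous/derivable1_diffP.
  by have := fE x xab => ?; exact: ex_derive.
rewrite in_itv/= => cab fc; rewrite -subr_le0 fc.
by rewrite mulr_le0_ge0// ?f0// subr_ge0.
Qed.

Let pc := @phase_cos R.
Let ps := @phase_sin R.

Lemma is_derive_phase_cos l : is_derive l (1 : R) pc (- ps l).
Proof.
have -> : pc = fun l => hw 1 (fun=> 1) (fun=> 0) (l, 0).
  by apply/funext => x; apply: eq_itg => t _ /=; rewrite (_ : 1 * (_ + _) = x * cos t); ring.
apply: isd_eq.
  exact: (@is_derive_hw R 1 (fun=> 1) (fun=> 0) (fun l => l) (fun=> 0) (fun=> 1) (fun=> 0) l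
    ltac:(cont) ltac:(cont) (fun s => isd_id s) (fun s => isd_cst 0 s) ltac:(cont) ltac:(cont)).
rewrite mul0r addr0 mul1r /ps /phase_sin -itgN; last by cont.
by apply: eq_itg => t _ /=; rewrite (_ : 1 * (_ + _) = l * cos t); ring.
Qed.

(** The recurrence J_1' = J_0 - J_1 / l. The derivative is the integral of cos^2 t cos(l cos t); in
    the sin^2 part one integration by parts produces J_1 / l. *)
Lemma is_derive_phase_sin l : 0 < l -> is_derive l (1 : R) ps (pc l - ps l / l).
Proof.
move=> l0; have ln0 : l != 0 by rewrite gt_eqF.
have -> : ps = fun l => hw 1 (fun=> 0) (@cos R) (l, 0).
  by apply/funext => x; apply: eq_itg => t _ /=; rewrite (_ : 1 * (_ + _) = x * cos t); ring.
apply: isd_eq.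
  exact: (@is_derive_hw R 1 (fun=> 0) (@cos R) (fun l => l) (fun=> 0) (fun=> 1) (fun=> 0) l
    ltac:(cont) (@continuous_cos R) (fun s => isd_id s) (fun s => isd_cst 0 s) ltac:(cont) ltac:(cont)).
rewrite mul0r addr0 mul1r.
pose L (t : R) := - l^-1 * sin (l * cos t).
pose dL (t : R) := sin t * cos (l * cos t).
have dLE (t : R) : is_derive t (1 : R) L (dL t) by rewrite /L; isd; rewrite /dL; field.
have cdL : continuous dL by rewrite /dL; cont.
have pi0 := @pi_gt0 R.
have := itg_byparts (a := - pi) (b := pi) ltac:(lra) (fun t => is_derive_sin t) dLE (@continuous_cos R) cdL.
rewrite sinN sinpi oppr0 !mul0r subrr sub0r => e.
transitivity (pc l - itg (- pi) pi (fun t => sin t * dL t)).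
  rewrite /pc /phase_cos -itgB; [|cont|by rewrite /dL; cont].
  apply: eq_itg => t _ /=; rewrite /dL (_ : 1 * (_ + _) = l * cos t); last by ring.
  have := sin2cos2 t; set s := sin t; set c := cos t => sE.
  by transitivity (cos (l * c) - s ^+ 2 * cos (l * c)); [rewrite sE; ring|ring].
congr (_ - _); rewrite e /ps /phase_sin [RHS]mulrC -itgZ; last by cont.
by rewrite -itgN; [apply: eq_itg => t _; rewrite /L /= (_ : 1 * (_ + _) = l * cos t); ring|rewrite /L; cont].
Qed.

Definition amp_cos l : R := Num.sqrt l * phase_cos l.
Definition amp_sin l : R := Num.sqrt l * phase_sin l.

Let p := amp_cos.
Let m := amp_sin.

Lemma continuous_amp_cos : continuous amp_cos.
Proof.
have cs : continuous (@Num.sqrt R) by move=> x; exact: sqrt_continuous.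
have cp : continuous pc by apply: is_derive_continuous is_derive_phase_cos.
by rewrite /amp_cos; cont.
Qed.

Lemma continuous_amp_sin : continuous amp_sin.
Proof.
have cs : continuous (@Num.sqrt R) by move=> x; exact: sqrt_continuous.
have cp : continuous ps by apply: continuous_itg; cont.
by rewrite /amp_sin; cont.
Qed.

Lemma is_derive_amp_cos l : 0 < l -> is_derive l (1 : R) p (- m l + p l / (2 * l)).
Proof.
move=> l0; have h := isdM (is_derive1_sqrt l0) (is_derive_phase_cos l).
apply: isd_eq h _; rewrite /m /p /amp_sin /amp_cos /ps /pc.
have s0 : Num.sqrt l != 0 by rewrite gt_eqF// sqrtr_gt0.
have sl : Num.sqrt l ^+ 2 = l by rewrite sqr_sqrtr// ltW.
move: sl s0; set P := phase_cos l; set S := phase_sin l; set s := Num.sqrt l => <- s0.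
by field.
Qed.

Lemma is_derive_amp_sin l : 0 < l -> is_derive l (1 : R) m (p l - m l / (2 * l)).
Proof.
move=> l0; have h := isdM (is_derive1_sqrt l0) (is_derive_phase_sin l0).
apply: isd_eq h _; rewrite /m /p /amp_sin /amp_cos /ps /pc.
have s0 : Num.sqrt l != 0 by rewrite gt_eqF// sqrtr_gt0.
have sl : Num.sqrt l ^+ 2 = l by rewrite sqr_sqrtr// ltW.
move: sl s0; set P := phase_cos l; set S := phase_sin l; set s := Num.sqrt l => <- s0.
by field.
Qed.

(** Provides a positive energy at l = 1, from which the lower bound on the amplitudes is
    propagated. *)
Lemma phase_cos1_gt0 : 0 < pc 1.
Proof.
have pi0 := @pi_gt0 R; have pi2 := @pi_ge2 R.
have c1 := @cos1_gt0 R.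
apply: (@lt_le_trans _ _ (cos 1 * (pi - - pi))); first by rewrite mulr_gt0//; lra.
rewrite -itg_cst; last lra.
apply: le_itg; [by cont|by cont|] => t _; rewrite mul1r -[leRHS]cos_norm.
have ct := cos_max t.
have [->//|ct1] := eqVneq (`|cos t|) 1.
have ct2 : `|cos t| < 1 by rewrite lt_neqAle ct1.
by rewrite ltW// ltr_cos ?in_itv//= ?ler01 ?normr_ge0//=; lra.
Qed.

(* The energy p^2 + (p')^2 of p'' + (1 + 1/(4 l^2)) p = 0 is almost conserved. *)
Let w l := p l / (2 * l) - m l.
Let E l := p l ^+ 2 + w l ^+ 2.

Let is_derive_w l : 0 < l -> is_derive l (1 : R) w (- p l - p l / (4 * l ^+ 2)).
Proof.
move=> l0; have ln0 : l != 0 by rewrite gt_eqF.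
have d2l : is_derive l (1 : R) (fun l => 2 * l) 2 by isd; ring.
have h := isdD (isdM (is_derive_amp_cos l0) (isdV (g := fun l => 2 * l) _ d2l)) (isdN (is_derive_amp_sin l0)).
apply: isd_eq; first by apply: h; rewrite mulf_neq0.
by rewrite /=; field.
Qed.

Let is_derive_E l : 0 < l -> is_derive l (1 : R) E (- (w l * p l) / (2 * l ^+ 2)).
Proof.
move=> l0; have ln0 : l != 0 by rewrite gt_eqF.
have dp := is_derive_amp_cos l0. have dw := is_derive_w l0.
have h := isdD (isdX 1 dp) (isdX 1 dw).
by apply: isd_eq h _; rewrite /w !expr1; field.
Qed.

Let E_ge0 l : 0 <= E l. Proof. by rewrite addr_ge0// sqr_ge0. Qed.

Let wp_le l : 0 < l -> `|w l * p l / (2 * l ^+ 2)| <= E l / (4 * l ^+ 2).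
Proof.
move=> l0; have l2 : 0 < l ^+ 2 by rewrite exprn_gt0.
have -> : E l / (4 * l ^+ 2) = (E l / 2) / (2 * l ^+ 2) by field; rewrite gt_eqF.
rewrite normrM normfV [`|2 * _|]gtr0_norm ?mulr_gt0//.
apply: ler_wpM2r; first by rewrite invr_ge0 mulr_ge0// ltW.
rewrite /E ler_norml; have := sqr_ge0 (w l + p l). have := sqr_ge0 (w l - p l).
by move=> ? ?; apply/andP; split; nra.
Qed.

(** A Gronwall argument with an explicit multiplier: |E'| <= E / (4 l^2), so E (1 + 1/l) is
    nonincreasing on l >= 1. *)
Let E_le l : 1 <= l -> E l <= 2 * E 1.
Proof.
move=> l1; have l0 : 0 < l by lra.
have h : E l * (1 + l^-1) <= E 1 * (1 + 1^-1).
  apply: (@derive_le0_le (fun l => E l * (1 + l^-1))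
    (fun l => - (w l * p l) / (2 * l ^+ 2) * (1 + l^-1) - E l / l ^+ 2)) => // x /andP[x1 _].
    have x0 : 0 < x by lra.
    have xn0 : x != 0 by rewrite gt_eqF.
    have h := isdM (is_derive_E x0) (isdD (isd_cst 1 x) (isdV xn0 (isd_id x))).
    by apply: isd_eq h _; field.
  have x0 : 0 < x by lra.
  have x20 : 0 < x ^+ 2 by rewrite exprn_gt0.
  have := wp_le x0; have -> : w x * p x / (2 * x ^+ 2) = - (- (w x * p x) / (2 * x ^+ 2)) by ring.
  rewrite normrN; set d := - (w x * p x) / _; move=> dE.
  have xi : x^-1 <= 1 by rewrite invf_le1.
  have xi0 : 0 < x^-1 by rewrite invr_gt0.
  have e1 : E x / (4 * x ^+ 2) = 4^-1 * (E x / x ^+ 2) by field; rewrite gt_eqF.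
  have e2 : 0 <= E x / x ^+ 2 by rewrite divr_ge0// ltW.
  rewrite e1 ler_norml in dE; nra.
have li : 0 < l^-1 by rewrite invr_gt0.
by move: h; rewrite invr1; have := E_ge0 l; nra.
Qed.

(** The same with the multiplier l / (l + 1): its logarithmic derivative 1 / (l (l + 1)) is at least
    1 / (4 l^2) for l >= 1. *)
Let E_ge l : 1 <= l -> E 1 / 2 <= E l.
Proof.
move=> l1; have l0 : 0 < l by lra.
have h : - (E l * (l / (l + 1))) <= - (E 1 * (1 / (1 + 1))).
  apply: (@derive_le0_le (fun l => - (E l * (l / (l + 1))))
    (fun l => (w l * p l) / (2 * l ^+ 2) * (l / (l + 1)) - E l / (l + 1) ^+ 2)) => // x /andP[x1 _].
    have x0 : 0 < x by lra.
    have xn0 : x != 0 by rewrite gt_eqF.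
    have x1n0 : x + 1 != 0 by rewrite gt_eqF//; lra.
    have dx1 : is_derive x (1 : R) (fun l => l + 1) 1 by isd; ring.
    have h := isdN (isdM (is_derive_E x0) (isdM (isd_id x) (isdV (g := fun l => l + 1) x1n0 dx1))).
    by apply: isd_eq h _; field; apply/andP.
  have x0 : 0 < x by lra.
  have x20 : 0 < x ^+ 2 by rewrite exprn_gt0.
  have xp1 : 0 < x + 1 by lra.
  have := wp_le x0; set d := _ / (2 * x ^+ 2); move=> dE.
  have d1 : d <= E x / (4 * x ^+ 2) by apply: le_trans dE; exact: ler_norm.
  rewrite subr_le0; apply: (@le_trans _ _ (E x / (4 * x ^+ 2) * (x / (x + 1)))).
    by apply: ler_wpM2r => //; rewrite divr_ge0// ltW.
  have -> : E x / (4 * x ^+ 2) * (x / (x + 1)) = E x / (x + 1) ^+ 2 * ((x + 1) / (4 * x)).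
    by field; rewrite !gt_eqF.
  apply: ler_piMr; first by rewrite divr_ge0// exprn_ge0// ltW.
  by rewrite ler_pdivrMr ?mul1r; lra.
have h2 : E l * (l / (l + 1)) <= E l.
  by apply: ler_piMr => //; rewrite ler_pdivrMr ?mul1r ?lerDl ?ler01//; lra.
rewrite lerN2 in h; apply: le_trans h2; apply: le_trans h.
have -> : 1 + 1 = 2 :> R by ring.
by rewrite mul1r.
Qed.

(** The energy involves p and w = p / (2 l) - m. For l >= 1 the correction p / (2 l) is at most |p|
    / 2, so the energy is comparable with p^2 + m^2. *)
Lemma amp_bounds : exists c C : R, [/\ 0 < c, 0 < C,
  forall l, 1 <= l -> c <= amp_cos l ^+ 2 + amp_sin l ^+ 2 &
  forall l, 1 <= l -> `|amp_cos l| <= C /\ `|amp_sin l| <= C].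
Proof.
have E1 : 0 < E 1.
  rewrite /E /p /amp_cos sqrtr1 mul1r; apply: ltr_pwDl; last exact: sqr_ge0.
  by rewrite exprn_gt0// phase_cos1_gt0.
have mw l : 1 <= l -> m l ^+ 2 <= 2 * E l /\ E l <= 2 * (p l ^+ 2 + m l ^+ 2).
  move=> l1; have l0 : 0 < l by lra.
  pose y := (2 * l)^-1.
  have y0 : 0 < y by rewrite invr_gt0; lra.
  have y1 : y <= 2^-1 by rewrite /y lef_pV2 ?posrE; lra.
  have wE : w l = p l * y - m l by [].
  rewrite /E wE; set P := p l; set M := m l.
  have h : (P * y) ^+ 2 <= P ^+ 2 / 4.
    have y2 : y ^+ 2 <= 4^-1 by nra.
    by rewrite exprMn; apply: ler_wpM2l => //; exact: sqr_ge0.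
  have h1 := sqr_ge0 (P * y + (P * y - M)). have h2 := sqr_ge0 (P * y - (P * y - M)).
  have h3 := sqr_ge0 (P * y + M). have h4 := sqr_ge0 (P * y - M).
  have h5 := sqr_ge0 P. have h6 := sqr_ge0 M.
  by split; nra.
exists (E 1 / 4), (1 + 4 * E 1); split; [lra|lra| |] => l l1.
  have [_ h] := mw l l1; have := E_ge l1; rewrite -/(p l) -/(m l); lra.
have [h _] := mw l l1; have h2 := E_le l1.
have sqb (x y : R) : 0 <= y -> x ^+ 2 <= y -> `|x| <= 1 + y.
  move=> y0 xy; have := sqr_ge0 (`|x| - 1); rewrite -[x ^+ 2]real_normK ?num_real// in xy.
  by have := normr_ge0 x; nra.
have := sqr_ge0 (w l); have := sqr_ge0 (p l) => p0 w0.
split; apply: sqb; rewrite -/(p l) -/(m l); [lra| |lra|lra].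
by move: h2; rewrite {1}/E; lra.
Qed.

End Amplitudes.

(** * Oscillation along the boundary *)

Section RiemannLebesgue.
Context {R : realType}.

(** [z] has mean zero in a quantitative sense: up to the bounded error [s l / l] it is the
    derivative of a bounded function. The bounds are required only for l >= 1, the range of
    [amp_bounds]. *)
Definition oscillating (z : R -> R) := exists (D s : R -> R) (C : R),
  [/\ continuous D, continuous z & continuous s] /\
  [/\ 0 < C,
    forall l : R, 0 < l -> is_derive l (1 : R) D (z l + s l / l) &
    forall l, 1 <= l -> [/\ `|D l| <= C, `|z l| <= C & `|s l| <= C]].

Lemma is_derive_unique (f : R -> R) (x a b : R) :
  is_derive x (1 : R) f a -> is_derive x (1 : R) f b -> a = b.
Proof. by move=> ha hb; rewrite -(@derive_val _ _ _ _ _ _ _ ha) (@derive_val _ _ _ _ _ _ _ hb). Qed.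

Lemma derivative_periodic (f df : R -> R) (T : R) : (forall t : R, is_derive t (1 : R) f (df t)) ->
  (forall t, f (t + T) = f t) -> forall t, df (t + T) = df t.
Proof.
move=> dfE fT t; have h := is_derive_addr (dfE (t + T)).
by apply: (is_derive_unique h); rewrite (_ : (fun y => _) = f)//; apply/funext.
Qed.

Lemma positive_lower_bound (f : R -> R) (a b : R) : continuous f -> (forall t, 0 < f t) ->
  exists2 c, 0 < c & {in `[a, b], forall t, c <= f t}.
Proof.
move=> cf f0; have fn0 t : f t != 0 by rewrite gt_eqF.
have cV : continuous (fun t => (f t)^-1) by cont.
have [C C0 fC] := continuous_bounded_itv a b cV.
exists C^-1 => [|t tab]; first by rewrite invr_gt0.
have := fC t tab; rewrite gtr0_norm ?invr_gt0// => h.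
by rewrite -[f t]invrK lef_pV2 ?posrE ?invr_gt0.
Qed.

Variables (rho drho ddrho : R -> R).
Hypothesis rho0 : forall t, 0 < rho t.
Hypothesis rhop : forall t, rho (t + 2 * pi) = rho t.
Hypothesis drhoE : forall t : R, is_derive t (1 : R) rho (drho t).
Hypothesis ddrhoE : forall t : R, is_derive t (1 : R) drho (ddrho t).
Hypothesis cddrho : continuous ddrho.

(* Where [rho'] vanishes the integrand is damped by the cutoff rho'^2 / (rho'^2 + d). *)
Lemma riemann_lebesgue (z g dg : R -> R) (e : R) : oscillating z ->
  (forall t : R, is_derive t (1 : R) g (dg t)) -> continuous dg ->
  (forall t, g (t + 2 * pi) = g t) ->
  {ae (@lebesgue_measure R), forall t, g t != 0 -> drho t != 0} -> 0 < e ->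
  exists K : R, forall k, K <= k -> `|itg (- pi) pi (fun t => g t * z (k * rho t))| <= e.
Proof.
move=> [D [s [C [[cD cz cs] [C0 dD DC]]]]] dgE cdg gp gae e0.
have pi0 := @pi_gt0 R.
have npi : - pi <= pi :> R by lra.
have cg := is_derive_continuous dgE. have cdrho := is_derive_continuous ddrhoE.
have crho := is_derive_continuous drhoE.
have drhop := derivative_periodic drhoE rhop.
have [r r0 rr] := positive_lower_bound (- pi) pi crho rho0.
have [d d0 dle] := cutoff_small (- pi) pi cg cdrho (divr_gt0 e0 (mulr_gt0 (ltr0Sn R 1) C0)) gae.
pose B t := drho t ^+ 2 + d.
have B0 t : 0 < B t by rewrite ltr_wpDl ?sqr_ge0.
have Bn0 t : B t != 0 by rewrite gt_eqF.
have cB : continuous B by rewrite /B; cont.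
have dB (t : R) : is_derive t (1 : R) B (2 * drho t * ddrho t) by rewrite /B; isd; ring.
(* The factor [drho] completes z(k rho) to the derivative of D(k rho), up to the term in [s]. *)
pose u t := g t * drho t / B t.
pose du t := (dg t * drho t + g t * ddrho t) / B t +
   g t * drho t * (- (B t)^-2 * (2 * drho t * ddrho t)).
have duE (t : R) : is_derive t (1 : R) u (du t).
  exact: (@isdM _ _ (fun t => (B t)^-1) _ _ _ (isdM (dgE t) (ddrhoE t)) (isdV (Bn0 t) (dB t))).
have cBV : continuous (fun t => (B t)^-1) by cont.
have B2 t : B t ^+ 2 != 0 by rewrite expf_neq0.
have cdu : continuous du by rewrite /du; cont.
have cu := is_derive_continuous duE.
have rn0 t : rho t != 0 by rewrite gt_eqF.
pose U := itg (- pi) pi (fun t => `|du t|).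
pose W := itg (- pi) pi (fun t => `|u t * drho t / rho t|).
have U0 : 0 <= U by apply: itg_ge0.
have W0 : 0 <= W by apply: itg_ge0.
pose X := C * U + C * W.
have X0 : 0 <= X by rewrite addr_ge0// mulr_ge0// ltW.
(* The term r^-1 ensures k rho >= 1 on the interval, and X (2 / e) makes the part with the factor
   1/k at most e / 2. *)
exists (1 + r^-1 + X * (2 / e)) => k kK.
have ri : 0 < r^-1 by rewrite invr_gt0.
have Xe : 0 <= X * (2 / e) by rewrite mulr_ge0// divr_ge0// ltW.
have k0 : 0 < k by lra.
have kn0 : k != 0 by rewrite gt_eqF.
have kr t : t \in `[- pi, pi] -> 1 <= k * rho t.
  move=> tp; apply: (@le_trans _ _ (r^-1 * r)); first by rewrite mulVf// gt_eqF.
  by apply: ler_pM; [exact: ltW|exact: ltW|lra|exact: rr].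
have krn0 t : k * rho t != 0 by rewrite mulf_neq0.
pose G t := D (k * rho t).
pose dG t := (z (k * rho t) + s (k * rho t) / (k * rho t)) * (k * drho t).
have dGE (t : R) : is_derive t (1 : R) G (dG t).
  have h : is_derive t (1 : R) (fun t => k * rho t) (k * drho t) by isd; ring.
  have h2 := dD (k * rho t) (mulr_gt0 k0 (rho0 t)).
  exact: (@isd_comp _ D (fun t => k * rho t) t _ _ h2 h).
have cdG : continuous dG by rewrite /dG; cont.
have cG : continuous G by rewrite /G; cont.
have bp : itg (- pi) pi (fun t => u t * dG t) = - itg (- pi) pi (fun t => du t * G t).
  rewrite (itg_byparts npi duE dGE cdu cdG).
  have shift (f : R -> R) : (forall t, f (t + 2 * pi) = f t) -> f pi = f (- pi).
    by move=> fp; rewrite -[RHS]fp; congr f; ring.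
  have -> : u pi = u (- pi) by apply: shift => t; rewrite /u /B gp drhop.
  have -> : G pi = G (- pi) by apply: shift => t; rewrite /G rhop.
  by rewrite subrr sub0r.
have cz' : continuous (fun t => z (k * rho t)) by cont.
have cs' : continuous (fun t => s (k * rho t)) by cont.
have split : itg (- pi) pi (fun t => g t * z (k * rho t)) =
    itg (- pi) pi (fun t => g t * (d / B t) * z (k * rho t)) +
    k^-1 * (itg (- pi) pi (fun t => u t * dG t) -
            itg (- pi) pi (fun t => u t * drho t / rho t * s (k * rho t))).
  rewrite -itgB; [|cont..]. rewrite -itgZ; last by cont.
  rewrite -itgD; [|cont..]; apply: eq_itg => t _.
  have dE : d = B t - drho t ^+ 2 by rewrite /B; ring.
  rewrite dE /u /dG; have := Bn0 t. have := rn0 t.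
  by move: (B t) => y r1 y1; field; rewrite kn0 y1 r1.
rewrite split bp; apply: le_trans (ler_normD _ _) _.
have b1 : `|itg (- pi) pi (fun t => g t * (d / B t) * z (k * rho t))| <= e / 2.
  apply: (@le_trans _ _ (C * itg (- pi) pi (fun t => `|g t| * (d / B t)))).
    rewrite -itgZ; last by cont.
    apply: norm_itg_le; [by cont|by cont|] => t tp.
    have [_ zC _] := DC _ (kr t tp).
    rewrite !normrM normfV [`|d|]gtr0_norm// [`|B t|]gtr0_norm// mulrC.
    by apply: ler_wpM2r => //; rewrite mulr_ge0// divr_ge0// ltW.
  rewrite mulrC -ler_pdivlMr//; apply: le_trans dle _.
  by rewrite le_eqVlt; apply/orP; left; apply/eqP; field; rewrite gt_eqF.
have b2 : `|k^-1 * (- itg (- pi) pi (fun t => du t * G t) -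
            itg (- pi) pi (fun t => u t * drho t / rho t * s (k * rho t)))| <= e / 2.
  rewrite normrM normfV [`|k|]gtr0_norm// -opprD normrN.
  apply: (@le_trans _ _ (k^-1 * X)).
    apply: ler_wpM2l; first by rewrite invr_ge0 ltW.
    apply: le_trans (ler_normD _ _) _; apply: lerD.
      rewrite -itgZ; last by cont.
      apply: norm_itg_le; [by cont|by cont|] => t tp.
      have [DC' _ _] := DC _ (kr t tp).
      by rewrite normrM mulrC; apply: ler_wpM2r.
    rewrite -itgZ; last by cont.
    apply: norm_itg_le; [by cont|by cont|] => t tp.
    have [_ _ sC] := DC _ (kr t tp).
    by rewrite normrM mulrC; apply: ler_wpM2r.
  rewrite mulrC ler_pdivrMr// mulrC -ler_pdivrMr ?divr_gt0//.
  rewrite invf_div; lra.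
lra.
Qed.

End RiemannLebesgue.

Section AmplitudeProducts.
Context {R : realType}.
Variable h : R.
Hypothesis h1 : 1 < h.

Let h0 : 0 < h. Proof. exact: lt_trans h1. Qed.

Let p := @amp_cos R.
Let m := @amp_sin R.
Let p' l := p (h * l).
Let m' l := m (h * l).
Let Q := (h ^+ 2 - 1)^-1.

Let cp : continuous p. Proof. exact: continuous_amp_cos. Qed.
Let cm : continuous m. Proof. exact: continuous_amp_sin. Qed.
Let cp' : continuous p'. Proof. by rewrite /p'; cont. Qed.
Let cm' : continuous m'. Proof. by rewrite /m'; cont. Qed.

Let Qn0 : h ^+ 2 - 1 != 0.
Proof. by have h2 := h1; have h3 := h0; rewrite gt_eqF// subr_gt0 expr2; nra. Qed.

Let dp (l : R) (l0 : 0 < l) : is_derive l (1 : R) p (- m l + p l / (2 * l)) := is_derive_amp_cos l0.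
Let dm (l : R) (l0 : 0 < l) : is_derive l (1 : R) m (p l - m l / (2 * l)) := is_derive_amp_sin l0.

Let dp' (l : R) : 0 < l -> is_derive l (1 : R) p' (- h * m' l + p' l / (2 * l)).
Proof.
move=> l0; have hl : 0 < h * l by rewrite mulr_gt0.
have e : is_derive l (1 : R) (fun l => h * l) h by isd; ring.
apply: isd_eq (@isd_comp _ p (fun l => h * l) l _ _ (dp hl) e) _.
have hn : h != 0 by rewrite gt_eqF.
have ln : l != 0 by rewrite gt_eqF.
by rewrite /p' /m'; field; rewrite hn ln.
Qed.

Let dm' (l : R) : 0 < l -> is_derive l (1 : R) m' (h * p' l - m' l / (2 * l)).
Proof.
move=> l0; have hl : 0 < h * l by rewrite mulr_gt0.
have e : is_derive l (1 : R) (fun l => h * l) h by isd; ring.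
apply: isd_eq (@isd_comp _ m (fun l => h * l) l _ _ (dm hl) e) _.
have hn : h != 0 by rewrite gt_eqF.
have ln : l != 0 by rewrite gt_eqF.
by rewrite /p' /m'; field; rewrite hn ln.
Qed.

Let bilinear_bounded (c1 c2 c3 c4 : R) : exists2 C, 0 < C & forall l, 1 <= l ->
  `|c1 * (p l * p' l) + c2 * (m l * m' l) + c3 * (m l * p' l) + c4 * (p l * m' l)| <= C.
Proof.
have [_ [C [_ C0 _ bC]]] := @amp_bounds R.
exists ((`|c1| + `|c2| + `|c3| + `|c4| + 1) * (C * C)).
  by rewrite mulr_gt0 ?mulr_gt0// ltr_wpDl// !addr_ge0.
move=> l l1; have hl : 1 <= h * l by have hh := h1; nra.
have [pC mC] := bC l l1. have [pC' mC'] := bC _ hl.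
have b (c x y : R) : `|x| <= C -> `|y| <= C -> `|c * (x * y)| <= `|c| * (C * C).
  by move=> xC yC; rewrite !normrM; apply: ler_wpM2l => //; apply: ler_pM.
have e1 := b c1 _ _ pC pC'. have e2 := b c2 _ _ mC mC'.
have e3 := b c3 _ _ mC pC'. have e4 := b c4 _ _ pC mC'.
apply: le_trans (ler_normD _ _) _; apply: le_trans (lerD (ler_normD _ _) (lexx _)) _.
apply: le_trans (lerD (lerD (ler_normD _ _) (lexx _)) (lexx _)) _.
rewrite !mulrDl; rewrite -/(p l) -/(m l) -/(p' l) -/(m' l) in e1 e2 e3 e4 *.
have := mulr_gt0 C0 C0; lra.
Qed.

(** Differentiation maps the span of the four products into itself up to terms in 1/l. On the
    leading part it splits into two 2 by 2 blocks of determinant h^2 - 1 up to sign, so h > 1 makes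
    every product a derivative up to such terms. *)
Let oscillating_bilinear (z : R -> R) (d1 d2 d3 d4 z1 z2 z3 z4 : R) :
  (forall l, z l = z1 * (p l * p' l) + z2 * (m l * m' l) + z3 * (m l * p' l) + z4 * (p l * m' l)) ->
  z1 = d3 + h * d4 -> z2 = - h * d3 - d4 -> z3 = h * d2 - d1 -> z4 = d2 - h * d1 ->
  oscillating z.
Proof.
move=> zE e1 e2 e3 e4.
pose D l := d1 * (p l * p' l) + d2 * (m l * m' l) + d3 * (m l * p' l) + d4 * (p l * m' l).
pose s l := d1 * (p l * p' l) + (- d2) * (m l * m' l) + 0 * (m l * p' l) + 0 * (p l * m' l).
have {}zE : z = fun l => z1 * (p l * p' l) + z2 * (m l * m' l) + z3 * (m l * p' l) + z4 * (p l * m' l).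
  exact/funext.
have [C1 C10 D1] := bilinear_bounded d1 d2 d3 d4.
have [C2 C20 D2] := bilinear_bounded z1 z2 z3 z4.
have [C3 C30 D3] := bilinear_bounded d1 (- d2) 0 0.
exists D, s, (C1 + C2 + C3); split; first by rewrite zE /D /s; split; cont.
split; first by lra.
  move=> l l0; have ln : l != 0 by rewrite gt_eqF.
  have P := dp l0. have M := dm l0. have P' := dp' l0. have M' := dm' l0.
  rewrite /D; isd; rewrite zE /s e1 e2 e3 e4; field.
  exact: ln.
move=> l l1; have := D1 l l1. have := D2 l l1. have := D3 l l1.
by rewrite zE /D /s; split; lra.
Qed.

Lemma oscillating_cos_cos : oscillating (fun l => amp_cos l * amp_cos (h * l)).
Proof.
(* The coefficients come from solving the 2 by 2 block for the desired product; likewise in the next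
   three lemmas. *)
apply: (@oscillating_bilinear _ 0 0 (- Q) (h * Q) 1 0 0 0); rewrite /Q /p' /p.
- by move=> l /=; ring.
- by field.
- by field.
- by ring.
- by ring.
Qed.

Lemma oscillating_sin_sin : oscillating (fun l => amp_sin l * amp_sin (h * l)).
Proof.
apply: (@oscillating_bilinear _ 0 0 (- h * Q) Q 0 1 0 0); rewrite /Q /m' /m.
- by move=> l /=; ring.
- by field.
- by field.
- by ring.
- by ring.
Qed.

Lemma oscillating_sin_cos : oscillating (fun l => amp_sin l * amp_cos (h * l)).
Proof.
apply: (@oscillating_bilinear _ Q (h * Q) 0 0 0 0 1 0); rewrite /Q /m /p' /p.
- by move=> l /=; ring.
- by ring.
- by ring.
- by field.
- by field.
Qed.

Lemma oscillating_cos_sin : oscillating (fun l => amp_cos l * amp_sin (h * l)).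
Proof.
apply: (@oscillating_bilinear _ (- h * Q) (- Q) 0 0 0 0 0 1); rewrite /Q /p /m' /m.
- by move=> l /=; ring.
- by ring.
- by ring.
- by field.
- by field.
Qed.

End AmplitudeProducts.

(** * Analytic dependence on the wave number *)

Section TaylorBounded.
Context {R : realType}.

Definition taylor_at (C M k0 : R) (F : R -> R) (a : nat -> R) := forall n k,
  `|F k - \sum_(j < n) a j * (k - k0) ^+ j| <= C * ((M * `|k - k0|) ^+ n / n`!%:R).

(* These are entire functions of exponential type, uniformly on the real axis; this is the only
   analyticity that is needed. *)
Definition taylor_bounded (F : R -> R) := exists C M : R, [/\ 0 <= C, 0 <= M &
  forall k0, exists a, taylor_at C M k0 F a].

Lemma taylor_boundedD F G : taylor_bounded F -> taylor_bounded G ->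
  taylor_bounded (fun k => F k + G k).
Proof.
move=> [C [M [C0 M0 HF]]] [D [N [D0 N0 HG]]].
exists (C + D), (M + N); split; [by rewrite addr_ge0|by rewrite addr_ge0|] => k0.
have [a aF] := HF k0. have [b bG] := HG k0.
exists (fun j => a j + b j) => n k.
rewrite (_ : \sum_(_ < _) _ = \sum_(j < n) a j * (k - k0) ^+ j + \sum_(j < n) b j * (k - k0) ^+ j); last first.
  by rewrite -big_split/=; apply: eq_bigr => j _; rewrite mulrDl.
rewrite (_ : F k + G k - _ = (F k - \sum_(j < n) a j * (k - k0) ^+ j) +
  (G k - \sum_(j < n) b j * (k - k0) ^+ j)); last by ring.
apply: le_trans (ler_normD _ _) _; rewrite mulrDl; apply: lerD.
  apply: le_trans (aF n k) _; apply: ler_wpM2l => //.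
  apply: ler_wpM2r; first by rewrite invr_ge0.
  by apply: lerXn2r; rewrite ?nnegrE ?mulr_ge0 ?addr_ge0//; apply: ler_wpM2r => //; rewrite lerDl.
apply: le_trans (bG n k) _; apply: ler_wpM2l => //.
apply: ler_wpM2r; first by rewrite invr_ge0.
by apply: lerXn2r; rewrite ?nnegrE ?mulr_ge0 ?addr_ge0//; apply: ler_wpM2r => //; rewrite lerDr.
Qed.

Lemma expr_fact_cvg0 (x : R) : x ^+ n / n`!%:R @[n --> \oo] --> (0 : R).
Proof. exact: (cvg_series_cvg_0 (is_cvg_series_exp_coeff x)). Qed.

(** The coefficients at k0 vanish one after the other: if the earlier ones are 0, a zero of F at
    distance d from k0 bounds the next one by a constant times d. Then every Taylor sum is 0 and the
    remainder bound tends to 0 at each real k, so no continuation argument is needed. *)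
Lemma taylor_bounded_eq0 F (E : set R) k0 : taylor_bounded F -> limit_point E k0 ->
  (forall k, E k -> F k = 0) -> forall k, F k = 0.
Proof.
move=> [C [M [C0 M0 HF]]] Ek0 FE.
have [a aF] := HF k0.
have a0 : forall j, a j = 0.
  elim/ltn_ind => j ih; apply/eqP; rewrite -normr_le0; apply/ler_addgt0Pr => e e0.
  pose B := C * (M ^+ j.+1 / j.+1`!%:R) + 1.
  have B0 : 0 < B by rewrite ltr_wpDl// mulr_ge0// divr_ge0// exprn_ge0.
  have eB : 0 < e / B by rewrite divr_gt0.
  have nU : nbhs k0 (ball k0 (e / B)) by exact: nbhsx_ballx.
  have [y [yk0 Ey /= yU]] := Ek0 _ nU.
  have y0 : y - k0 != 0 by rewrite subr_eq0.
  have := aF j.+1 y; rewrite FE// big_ord_recr/= big1; last first.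
    by move=> i _; rewrite ih// mul0r.
  rewrite !add0r normrN normrM normrX exprMn.
  set d := `|y - k0|; have d0 : 0 < d by rewrite normr_gt0.
  move=> h.
  have {}h : `|a j| * d ^+ j <= (C * (M ^+ j.+1 / j.+1`!%:R) * d) * d ^+ j.
    by apply: le_trans h _; rewrite le_eqVlt [d ^+ j.+1]exprSr; apply/orP; left; apply/eqP; ring.
  rewrite ler_pM2r ?exprn_gt0// in h.
  rewrite ?add0r; apply: le_trans h _.
  have dB : d * B <= e.
    by move: yU; rewrite /ball/= distrC -/d ltr_pdivlMr// => /ltW.
  apply: le_trans dB; rewrite mulrC; apply: ler_wpM2l; first exact: ltW.
  by rewrite /B lerDl.
move=> k; apply/eqP; rewrite -normr_le0; apply/ler_addgt0Pr => e e0; rewrite add0r.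
have cv : C * ((M * `|k - k0|) ^+ n / n`!%:R) @[n --> \oo] --> (0 : R).
  by rewrite -(mulr0 C); apply: cvgM; [exact: cvg_cst|exact: expr_fact_cvg0].
have [N /(_ N (leqnn N)) HN] := cvg0_le e0 cv.
apply: le_trans (le_trans (ler_norm _) HN).
have := aF N k; rewrite big1 ?subr0// => i _; by rewrite a0 mul0r.
Qed.

(** The Taylor sum of cos(c + u) in u, the j-th derivative being a phase shift by j pi / 2. The
    phase c also covers the sine. *)
Definition cos_taylor n (c u : R) := \sum_(j < n) u ^+ j / j`!%:R * cos (c + (pi / 2) *+ j).

Lemma continuous_cos_taylor n c : continuous (cos_taylor n c).
Proof.
elim: n => [|n ih].
  rewrite (_ : cos_taylor 0 c = fun=> 0); first by cont.
  by apply/funext => u; rewrite /cos_taylor big_ord0.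
rewrite (_ : cos_taylor n.+1 c = fun u => cos_taylor n c u + u ^+ n / n`!%:R * cos (c + (pi / 2) *+ n)).
  by cont.
by apply/funext => u; rewrite /cos_taylor big_ord_recr.
Qed.

Lemma is_derive_cos_taylor n c u :
  is_derive u (1 : R) (cos_taylor n.+1 c) (cos_taylor n (c + pi / 2) u).
Proof.
elim: n => [|n ih].
  rewrite (_ : cos_taylor 1 c = fun=> cos c).
    by rewrite /cos_taylor big_ord0; exact: isd_cst.
  by apply/funext => x; rewrite /cos_taylor big_ord_recr big_ord0/= add0r expr0 fact0 invr1 !mul1r mulr0n addr0.
rewrite (_ : cos_taylor n.+2 c = fun u => cos_taylor n.+1 c u +
    u ^+ n.+1 * (n.+1`!%:R^-1 * cos (c + (pi / 2) *+ n.+1))); last first.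
  by apply/funext => x; rewrite /cos_taylor big_ord_recr/= mulrA.
apply: isd_eq (isdD ih (isdM (isdX n (isd_id u)) (isd_cst _ u))) _.
rewrite [RHS]/cos_taylor big_ord_recr/= -/(cos_taylor n _ u); congr (_ + _).
have -> : c + (pi / 2) *+ n.+1 = c + pi / 2 + (pi / 2) *+ n by rewrite [in LHS]mulrS addrA.
rewrite mulr0 addr0 mulr1 factS natrM invfM.
have : n.+1%:R != 0 :> R by rewrite pnatr_eq0.
have : n`!%:R != 0 :> R by rewrite pnatr_eq0 -lt0n fact_gt0.
by move=> ? ?; field; apply/andP.
Qed.

Lemma cos_taylorN n c u : cos_taylor n c (- u) = cos_taylor n (- c) u.
Proof.
apply: eq_bigr => j _; rewrite exprNn.
have -> : cos (- c + (pi / 2) *+ j) = (-1) ^+ j * cos (c + (pi / 2) *+ j).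
  rewrite -[LHS]cosN opprD opprK.
  have -> : c - (pi / 2) *+ j = c + (pi / 2) *+ j - pi *+ j.
    by rewrite -addrA; congr (_ + _); rewrite -mulrnBl -mulNrn; congr (_ *+ _); lra.
  elim: (nat_of_ord j) (c + _) => [|i ih] x; first by rewrite mulr0n subr0 mul1r.
  by rewrite mulrS opprD addrA addrAC -[cos _]opprK -cosDpi subrK ih exprS mulN1r mulNr.
by ring.
Qed.

(** Induction on n: the derivative of each remainder is the previous remainder with phase c + pi /
    2. Negative u reduce to positive ones by changing the sign of c. *)
Lemma cos_taylor_bound n (c u : R) :
  `|cos (c + u) - cos_taylor n c u| <= `|u| ^+ n / n`!%:R.
Proof.
wlog u0 : c u / 0 <= u.
  move=> H; have [/H//|/ltW un] := leP 0 u.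
  have := H (- c) (- u); rewrite oppr_ge0 normrN => /(_ un).
  by rewrite cos_taylorN opprK -opprD cosN.
rewrite [`|u|]ger0_norm//.
elim: n c u u0 => [|n ih] c u u0.
  by rewrite /cos_taylor big_ord0 subr0 expr0 fact0 invr1 mulr1 cos_max.
pose f v := cos (c + v) - cos_taylor n.+1 c v.
pose df v := cos (c + pi / 2 + v) - cos_taylor n (c + pi / 2) v.
have dfE (v : R) : is_derive v (1 : R) f (df v).
  have h : is_derive v (1 : R) (fun v => cos (c + v)) (- sin (c + v)) by isd; ring.
  by apply: isd_eq (isdD h (isdN (is_derive_cos_taylor n c v))) _; rewrite /df addrAC cosDpihalf.
have cdf : continuous df.
  by have ct := @continuous_cos_taylor n (c + pi / 2); rewrite /df; cont.
have f0 : f 0 = 0.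
  rewrite /f addr0 /cos_taylor big_ord_recl/= expr0 fact0 invr1 !mul1r mulr0n addr0 big1 ?addr0 ?subrr//.
  by move=> i _; rewrite /bump/= exprS !mul0r.
have -> : cos (c + u) - cos_taylor n.+1 c u = itg 0 u df.
  by rewrite (itg_derive u0 dfE cdf) f0 subr0.
have n0 : n.+1%:R != 0 :> R by rewrite pnatr_eq0.
have nf0 : n`!%:R != 0 :> R by rewrite pnatr_eq0 -lt0n fact_gt0.
have -> : u ^+ n.+1 / n.+1`!%:R = itg 0 u (fun v => v ^+ n / n`!%:R).
  have h (v : R) : is_derive v (1 : R) (fun v => v ^+ n.+1 * n.+1`!%:R^-1) (v ^+ n / n`!%:R).
    apply: isd_eq (isdM (isdX n (isd_id v)) (isd_cst _ v)) _.
    by rewrite mulr0 addr0 mulr1 factS natrM invfM; field; apply/andP.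
  by rewrite (itg_derive u0 h); [rewrite expr0n/= mul0r subr0|cont].
apply: norm_itg_le => //; first by cont.
by move=> v; rewrite in_itv/= => /andP[v0 _]; exact: ih.
Qed.

End TaylorBounded.

Section PeriodicBounded.
Context {R : realType}.

Lemma angle_representative (t : R) : exists z : int, t + 2 * pi *~ z \in `[- pi, pi].
Proof.
have pi0 := @pi_gt0 R.
pose z := Num.floor ((t + pi) / (2 * pi)).
have /andP[h1 h2] := floor_itv ((t + pi) / (2 * pi)); rewrite -/z in h1 h2.
rewrite ler_pdivlMr in h1; last lra. rewrite ltr_pdivrMr in h2; last lra.
exists (- z); rewrite mulrNz in_itv/= -mulrzr.
by move: h2; rewrite intrD => h2; apply/andP; split; lra.
Qed.

Lemma periodic_bounded (f : R -> R) : continuous f -> (forall t, f (t + 2 * pi) = f t) ->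
  exists2 C, 0 < C & forall t, `|f t| <= C.
Proof.
move=> cf fp; have [C C0 fC] := continuous_bounded_itv (- pi) pi cf.
exists C => // t; have [z zt] := angle_representative t.
by rewrite -(periodicz z fp); exact: fC.
Qed.

End PeriodicBounded.

Section EntireDependence.
Context {R : realType}.
Variable rho : R -> R.
Hypothesis rho0 : forall t, 0 < rho t.
Hypothesis rhop : forall t, rho (t + 2 * pi) = rho t.
Hypothesis crho : continuous rho.
Let Om := star_domain rho.
Local Notation mu := (leb2 (R := R)).

Let mOm : measurable Om. Proof. exact: measurable_star_domain. Qed.

Let iOm := @continuous_integrable_star_domain R rho rho0 rhop crho.

Lemma star_domain_bounded : exists2 C, 0 < C & forall x, Om x -> `|x.1| <= C /\ `|x.2| <= C.
Proof.
have [C C0 rC] := periodic_bounded crho rhop.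
exists C => // _ [r [t [/andP[r0 rt] ->]]] /=.
have rC' : r <= C by rewrite ltW// (lt_le_trans rt)// (le_trans _ (rC t))// ler_norm.
by rewrite !normrM (ger0_norm r0); split; apply: le_trans rC'; rewrite ler_piMr ?cos_max ?sin_max.
Qed.

Definition jcontinuous (f : R * R -> R -> R -> R) :=
  continuous (fun z : (R * R) * R * R => f z.1.1 z.1.2 z.2).

Let inner (f : R * R -> R -> R -> R) x :=
  itg (- pi) pi (fun t => itg (- pi) pi (fun s => f x t s)).

Definition domain_integral (f : R * R -> R -> R -> R) := \int[mu]_(x in Om) inner f x.

Let jslice2 f x t : jcontinuous f -> continuous (f x t).
Proof.
move=> cf; apply: (@cont_comp2 _ _ _ (fun z : (R * R) * R * R => f z.1.1 z.1.2 z.2)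
  (fun s => (x, t, s))) => //.
by cont.
Qed.

Let jslice1 f : jcontinuous f ->
  continuous (fun z : (R * R) * R => itg (- pi) pi (fun s => f z.1 z.2 s)).
Proof. by move=> cf; apply: (@continuous_itg _ _ _ _ (fun z s => f z.1 z.2 s)). Qed.

Let jslice f x : jcontinuous f -> continuous (fun t => itg (- pi) pi (fun s => f x t s)).
Proof.
move=> cf; apply: (@cont_comp2 _ _ _ (fun z : (R * R) * R => itg (- pi) pi (fun s => f z.1 z.2 s))
  (fun t => (x, t))); first exact: jslice1.
by cont.
Qed.

Let cinner f : jcontinuous f -> continuous (inner f).
Proof.
move=> cf; apply: (@continuous_itg _ _ _ _ (fun x t => itg (- pi) pi (fun s => f x t s))).
exact: jslice1.
Qed.

Lemma domain_integralD f g : jcontinuous f -> jcontinuous g ->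
  domain_integral (fun x t s => f x t s + g x t s) = domain_integral f + domain_integral g.
Proof.
move=> cf cg; rewrite /domain_integral -RintegralD//; last 2 first.
- by apply: iOm; exact: cinner.
- by apply: iOm; exact: cinner.
apply: eq_Rintegral => x _; rewrite /inner -itgD; [|exact: jslice..].
by apply: eq_itg => t _; rewrite -itgD//; exact: jslice2.
Qed.

Lemma domain_integralZ c f : jcontinuous f ->
  domain_integral (fun x t s => c * f x t s) = c * domain_integral f.
Proof.
move=> cf; rewrite /domain_integral -RintegralZl//; last by apply: iOm; exact: cinner.
apply: eq_Rintegral => x _; rewrite /inner -itgZ; last exact: jslice.
by apply: eq_itg => t _; rewrite -itgZ//; exact: jslice2.
Qed.

Lemma eq_domain_integral f g : (forall x t s, f x t s = g x t s) ->
  domain_integral f = domain_integral g.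
Proof.
by move=> fg; apply: eq_Rintegral => x _; apply: eq_itg => t _; apply: eq_itg => s _.
Qed.

Lemma domain_integral_bound : exists2 K, 0 <= K & forall f B, 0 <= B -> jcontinuous f ->
  (forall x t s, Om x -> `|f x t s| <= B) -> `|domain_integral f| <= B * K.
Proof.
have pi0 := @pi_ge0 R.
pose A := \int[mu]_(x in Om) (fun=> 1 : R) x.
have c1 (c : R) : continuous (fun _ : R * R => c) by cont.
have A0 : 0 <= A by apply: Rintegral_ge0.
exists ((pi - - pi) * (pi - - pi) * A); first by rewrite !mulr_ge0//; lra.
move=> f B B0 cf fB.
have h := @le_normr_Rintegral _ _ _ (leb2 (R := R)) Om (inner f) mOm (iOm (cinner cf)).
apply: le_trans h _.
have -> : B * ((pi - - pi) * (pi - - pi) * A) =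
    \int[mu]_(x in Om) (B * (pi - - pi) * (pi - - pi) * (fun=> 1 : R) x).
  by rewrite RintegralZl//; [rewrite -/A; ring|exact: iOm].
apply: le_Rintegral => //.
- by apply: iOm; have cI := cinner cf; cont.
- by apply: iOm; cont.
move=> x Ox; rewrite mulr1.
apply: norm_itg_le_cst; [lra|exact: jslice|] => t _.
apply: norm_itg_le_cst; [lra|exact: jslice2|] => s _.
exact: fB.
Qed.

(** The Taylor expansion in k is taken under the integral. The bound W on the phase over the domain
    gives the exponential type, uniformly in the centre k0 because all derivatives of the cosine are
    bounded by 1. *)
Lemma taylor_bounded_domain_integral (g : R -> R -> R) (w : R * R -> R -> R -> R) (c : R) :
  jcontinuous (fun _ => g) -> jcontinuous w ->
  (exists2 G, 0 <= G & forall t s, `|g t s| <= G) ->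
  (exists2 W, 0 <= W & forall x t s, Om x -> `|w x t s| <= W) ->
  taylor_bounded (fun k => domain_integral (fun x t s => g t s * cos (k * w x t s + c))).
Proof.
move=> cg cw [G G0 gG] [W W0 wW].
have [K K0 HK] := domain_integral_bound.
exists (G * K), W; split; [by rewrite mulr_ge0|by []|] => k0.
pose term j x t s := g t s * (w x t s ^+ j / j`!%:R * cos (k0 * w x t s + c + (pi / 2) *+ j)).
have cterm j : jcontinuous (term j).
  by rewrite /jcontinuous in cg cw *; rewrite /term; cont.
exists (fun j => domain_integral (term j)) => n k.
pose S n x t s := g t s * cos_taylor n (k0 * w x t s + c) ((k - k0) * w x t s).
have SE m x t s : S m.+1 x t s = S m x t s + (k - k0) ^+ m * term m x t s.
  by rewrite /S /cos_taylor big_ord_recr/= mulrDr /term exprMn; ring.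
have cS m : jcontinuous (S m).
  elim: m => [|m ih]; rewrite /jcontinuous.
    rewrite (_ : (fun _ => _) = fun=> 0); first by cont.
    by apply/funext => z; rewrite /S /cos_taylor big_ord0 mulr0.
  rewrite (_ : (fun _ => _) = fun z => S m z.1.1 z.1.2 z.2 + (k - k0) ^+ m * term m z.1.1 z.1.2 z.2).
    by have := cterm m; rewrite /jcontinuous in ih * => ?; apply: contD => //; apply: contM => //; cont.
  by apply/funext => z; rewrite SE.
have -> : \sum_(j < n) domain_integral (term j) * (k - k0) ^+ j = domain_integral (S n).
  elim: n => [|n ih].
    rewrite big_ord0 (@eq_domain_integral _ (fun x t s => 0 * term 0 x t s)).
      by rewrite domain_integralZ// mul0r.
    by move=> x t s; rewrite /S /cos_taylor big_ord0 mulr0 mul0r.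
  rewrite big_ord_recr/= ih (eq_domain_integral (SE n)) domain_integralD//.
    by rewrite domain_integralZ// mulrC.
  by have := cterm n; rewrite /jcontinuous => ?; apply: contM => //; cont.
pose T x t s := g t s * cos (k * w x t s + c).
have cT : jcontinuous T by rewrite /jcontinuous in cg cw *; rewrite /T; cont.
have cNS : jcontinuous (fun x t s => -1 * S n x t s).
  by have := cS n; rewrite /jcontinuous => ?; apply: contM => //; cont.
rewrite -[X in `|X|]/(domain_integral T - domain_integral (S n)).
rewrite -mulN1r -domain_integralZ// -domain_integralD//.
have -> : G * K * ((W * `|k - k0|) ^+ n / n`!%:R) = G * ((W * `|k - k0|) ^+ n / n`!%:R) * K by ring.
apply: HK.
- by rewrite mulr_ge0// divr_ge0// exprn_ge0// mulr_ge0.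
- by rewrite /jcontinuous in cT cNS *; exact: contD.
move=> x t s Ox; rewrite mulN1r /T /S -mulrBr normrM.
apply: ler_pM => //.
have -> : k * w x t s + c = k0 * w x t s + c + (k - k0) * w x t s by ring.
apply: le_trans (cos_taylor_bound _ _ _) _; apply: ler_wpM2r; first by rewrite invr_ge0.
apply: lerXn2r; rewrite ?nnegrE ?mulr_ge0// normrM mulrC.
by apply: ler_wpM2r => //; exact: wW.
Qed.

End EntireDependence.

Section PairingDependence.
Context {R : realType}.
Variable rho : R -> R.
Hypothesis rho0 : forall t, 0 < rho t.
Hypothesis rhop : forall t, rho (t + 2 * pi) = rho t.
Hypothesis crho : continuous rho.

(** Product-to-sum formulas write the product of the two integrands, at angles t and s, as four
    cosines with phases ray(t) - h ray(s) and ray(t) + h ray(s); the shift by - pi / 2 turns the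
    sines into cosines. *)
Lemma taylor_bounded_pairing h (a b A B : R -> R) : 0 <= h ->
  continuous a -> continuous b -> continuous A -> continuous B ->
  (forall t, a (t + 2 * pi) = a t) -> (forall t, b (t + 2 * pi) = b t) ->
  (forall t, A (t + 2 * pi) = A t) -> (forall t, B (t + 2 * pi) = B t) ->
  taylor_bounded (fun k =>
    \int[leb2 (R := R)]_(x in star_domain rho) (hw k a b x * hw (h * k) A B x)).
Proof.
move=> h0 ca cb cA cB ap bp Ap Bp.
have [Ma Ma0 aM] := periodic_bounded ca ap. have [Mb Mb0 bM] := periodic_bounded cb bp.
have [MA MA0 AM] := periodic_bounded cA Ap. have [MB MB0 BM] := periodic_bounded cB Bp.
have [C C0 OC] := star_domain_bounded rhop crho.
pose ray (x : R * R) t := cos t * x.1 + sin t * x.2.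
have rayC x t : star_domain rho x -> `|ray x t| <= C + C.
  move=> /OC[x1 x2]; rewrite (le_trans (ler_normD _ _))// lerD// normrM.
    by rewrite (le_trans _ x1)// ler_piMl ?cos_max.
  by rewrite (le_trans _ x2)// ler_piMl ?sin_max.
pose w (e : R) x t s := ray x t + e * h * ray x s.
have cw e : jcontinuous (w e) by rewrite /jcontinuous /w /ray; cont.
have wW e : `|e| = 1 ->
    exists2 W, 0 <= W & forall x t s, star_domain rho x -> `|w e x t s| <= W.
  move=> e1; exists (C + C + h * (C + C)); first by rewrite addr_ge0 ?mulr_ge0//; lra.
  move=> x t s Ox; rewrite (le_trans (ler_normD _ _))// lerD ?rayC//.
  by rewrite !normrM e1 mul1r (ger0_norm h0) ler_wpM2l// rayC.
pose M := Ma + Mb + MA + MB.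
have M0 : 0 <= M by rewrite /M; lra.
pose nice (f : R -> R) := continuous f /\ forall t, `|f t| <= M.
have na : nice a by split=> // t; rewrite (le_trans (aM t))// /M; lra.
have nb : nice b by split=> // t; rewrite (le_trans (bM t))// /M; lra.
have nA : nice A by split=> // t; rewrite (le_trans (AM t))// /M; lra.
have nB : nice B by split=> // t; rewrite (le_trans (BM t))// /M; lra.
pose g (p P r Q : R -> R) (e t s : R) := 2^-1 * (p t * P s + e * (r t * Q s)).
pose f p P r Q e d c k (x : R * R) t s := g p P r Q e t s * cos (k * w d x t s + c).
have cf p P r Q e d c k : nice p -> nice P -> nice r -> nice Q -> jcontinuous (f p P r Q e d c k).
  move=> [cp _] [cP _] [cr _] [cQ _]; have cwd := cw d.
  by rewrite /jcontinuous in cwd *; rewrite /f /g; cont.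
have tf p P r Q e d c : nice p -> nice P -> nice r -> nice Q -> `|e| = 1 -> `|d| = 1 ->
    taylor_bounded (fun k => domain_integral rho (f p P r Q e d c k)).
  move=> [cp pM] [cP PM] [cr rM] [cQ QM] e1 d1.
  apply: taylor_bounded_domain_integral => //; last exact: wW.
    by rewrite /jcontinuous /g; cont.
  exists (M * M); first by rewrite mulr_ge0.
  move=> t s; rewrite /g normrM ger0_norm ?invr_ge0//.
  have h1 : `|p t * P s + e * (r t * Q s)| <= `|p t * P s| + `|r t * Q s|.
    by rewrite (le_trans (ler_normD _ _))// [`|e * _|]normrM e1 mul1r.
  have h2 : `|p t * P s| <= M * M by rewrite normrM ler_pM.
  have h3 : `|r t * Q s| <= M * M by rewrite normrM ler_pM.
  lra.
have e1 : `|1 : R| = 1 by rewrite normr1.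
have em1 : `|-1 : R| = 1 by rewrite normrN normr1.
suff -> : (fun k => \int[leb2 (R := R)]_(x in star_domain rho) (hw k a b x * hw (h * k) A B x)) =
    fun k => domain_integral rho (f a A b B 1 (-1) 0 k)
           + domain_integral rho (f a A b B (-1) 1 0 k)
           + domain_integral rho (f b A a B 1 1 (- (pi / 2)) k)
           + domain_integral rho (f b A a B (-1) (-1) (- (pi / 2)) k).
  by do 3![apply: taylor_boundedD; last exact: tf]; exact: tf.
apply/funext => k.
have jD f1 f2 : jcontinuous f1 -> jcontinuous f2 ->
    jcontinuous (fun x t s => f1 x t s + f2 x t s : R).
  by rewrite /jcontinuous => ? ?; exact: contD.
have D := domain_integralD rho0 rhop crho.
have j1 := @cf a A b B 1 (-1) 0 k na nA nb nB.
have j2 := @cf a A b B (-1) 1 0 k na nA nb nB.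
have j3 := @cf b A a B 1 1 (- (pi / 2)) k nb nA na nB.
have j4 := @cf b A a B (-1) (-1) (- (pi / 2)) k nb nA na nB.
have j12 := jD _ _ j1 j2.
rewrite -(D _ _ j1 j2) -(D _ _ j12 j3) -(D _ _ (jD _ _ j12 j3) j4).
apply: eq_Rintegral => x _.
pose U t := a t * cos (k * ray x t) + b t * sin (k * ray x t).
pose V s := A s * cos (h * k * ray x s) + B s * sin (h * k * ray x s).
have cU : continuous U by rewrite /U /ray; cont.
have cV : continuous V by rewrite /V /ray; cont.
rewrite -[hw k a b x]/(itg (- pi) pi U) -[hw (h * k) A B x]/(itg (- pi) pi V).
rewrite mulrC -itgZ//; apply: eq_itg => t _; rewrite mulrC -itgZ//; apply: eq_itg => s _.
rewrite /U /V /f /g /w !cosBpihalf !addr0.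
have -> : k * (ray x t + -1 * h * ray x s) = k * ray x t - h * k * ray x s by ring.
have -> : k * (ray x t + 1 * h * ray x s) = k * ray x t + h * k * ray x s by ring.
by rewrite cosB cosD sinB sinD; field.
Qed.

End PairingDependence.

(** * Boundary asymptotics *)

Section BoundaryAsymptotics.
Context {R : realType}.

Definition C1_periodic (f : R -> R) := exists df : R -> R,
  [/\ forall t : R, is_derive t (1 : R) f (df t), continuous df & forall t, f (t + 2 * pi) = f t].

(* Values at the two critical points [t] and [t + pi] of the phase combine into the even part of
   the cosine density and the odd part of the sine density. *)
Definition even_half (a : R -> R) t := (a t + a (t + pi)) / 2.
Definition odd_half (b : R -> R) t := (b t - b (t + pi)) / 2.

Lemma C1_periodic_continuous f : C1_periodic f -> continuous f.
Proof. by move=> [df [dfE _ _]]; exact: is_derive_continuous dfE. Qed.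

Lemma C1_periodic_periodic f : C1_periodic f -> forall t, f (t + 2 * pi) = f t.
Proof. by case=> df []. Qed.

Variables rho drho : R -> R.
Hypothesis rho0 : forall t, 0 < rho t.
Hypothesis rhop : forall t, rho (t + 2 * pi) = rho t.
Hypothesis drho_rho : forall t : R, is_derive t (1 : R) rho (drho t).
Hypothesis cdrho : continuous drho.

Let crho := is_derive_continuous drho_rho.
Let boundary t : R * R := (rho t * cos t, rho t * sin t).

Definition trace k a b t := hw k a b (boundary t).
Definition flux k a b t :=
  normal1 rho drho t * hw1 k a b (boundary t) + normal2 rho drho t * hw2 k a b (boundary t).

Lemma continuous_trace k a b : continuous a -> continuous b -> continuous (trace k a b).
Proof.
move=> ca cb; apply: (@cont_comp2 _ _ _ (hw k a b) boundary); first exact: continuous_hw.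
by rewrite /boundary; cont.
Qed.

Lemma continuous_flux k a b : continuous a -> continuous b -> continuous (flux k a b).
Proof.
move=> ca cb.
have cB : continuous boundary by rewrite /boundary; cont.
have c1 : continuous (hw1 k a b) by apply: continuous_hw; cont.
have c2 : continuous (hw2 k a b) by apply: continuous_hw; cont.
by rewrite /flux /normal1 /normal2; cont.
Qed.

Lemma green_hw k l a b A B : continuous a -> continuous b -> continuous A -> continuous B ->
  (k ^+ 2 - l ^+ 2) * \int[leb2 (R := R)]_(x in star_domain rho) (hw k a b x * hw l A B x) =
  itg (- pi) pi (fun t => trace k a b t * flux l A B t - trace l A B t * flux k a b t).
Proof.
pose hwxx (k : R) (a b : R -> R) := hw1 k (fun t => k * cos t * b t) (fun t => - (k * cos t * a t)).
pose hwxy (k : R) (a b : R -> R) := hw2 k (fun t => k * cos t * b t) (fun t => - (k * cos t * a t)).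
pose hwyy (k : R) (a b : R -> R) := hw2 k (fun t => k * sin t * b t) (fun t => - (k * sin t * a t)).
have G (k' : R) (a' b' : R -> R) : continuous a' -> continuous b' ->
    gradient (hw k' a' b') (hw1 k' a' b') (hw2 k' a' b').
  by move=> ca cb c1 c2 d1 d2 s h1 h2 h3 h4; exact: is_derive_hw.
have hwyx (k' : R) (a' b' : R -> R) :
    hw1 k' (fun t => k' * sin t * b' t) (fun t => - (k' * sin t * a' t)) = hwxy k' a' b'.
  by apply/funext => x; apply: eq_itg => t _; ring.
move=> ca cb cA cB.
apply: (@green_star_domain R rho drho rho0 rhop drho_rho cdrho
   (hw k a b) (hw1 k a b) (hw2 k a b) (hwxx k a b) (hwxy k a b) (hwyy k a b)
   (hw l A B) (hw1 l A B) (hw2 l A B) (hwxx l A B) (hwxy l A B) (hwyy l A B)).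
all: try by apply: continuous_hw; cont.
- exact: G.
- by apply: G; cont.
- by rewrite -hwyx; apply: G; cont.
- exact: G.
- by apply: G; cont.
- by rewrite -hwyx; apply: G; cont.
- by move=> x; exact: hw_laplace.
- by move=> x; exact: hw_laplace.
Qed.

(** Rotating the angle of integration by t puts the critical points of the phase at s = 0 and s = pi
    for every boundary point, so one stationary phase lemma serves uniformly in t. *)
Lemma shifted_trace k a b : continuous a -> continuous b ->
  (forall t, a (t + 2 * pi) = a t) -> (forall t, b (t + 2 * pi) = b t) -> forall t,
  hw k a b (boundary t) = itg (- pi) pi (fun s =>
    a (s + t) * cos (k * rho t * cos s) + b (s + t) * sin (k * rho t * cos s)).
Proof.
move=> ca cb ap bp t.
pose F s := a s * cos (k * (cos s * (boundary t).1 + sin s * (boundary t).2)) +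
            b s * sin (k * (cos s * (boundary t).1 + sin s * (boundary t).2)).
have cF : continuous F by rewrite /F; cont.
have Fp s : F (s + 2 * pi) = F s.
  by rewrite /F ap bp periodic_cosD2pi periodic_sinD2pi.
rewrite -[LHS]/(itg (- pi) pi F) -(itg_shift_periodic t cF Fp).
apply: eq_itg => s _; rewrite /F /boundary /=.
have -> : cos (s + t) * (rho t * cos t) + sin (s + t) * (rho t * sin t) = rho t * cos s.
  have -> : cos s = cos (s + t - t) by congr cos; ring.
  by rewrite cosB; ring.
by rewrite !mulrA.
Qed.

Lemma shifted_flux k a b : continuous a -> continuous b ->
  (forall t, a (t + 2 * pi) = a t) -> (forall t, b (t + 2 * pi) = b t) -> forall t,
  flux k a b t = k * itg (- pi) pi (fun s => (rho t * cos s - drho t * sin s) *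
    (b (s + t) * cos (k * rho t * cos s) - a (s + t) * sin (k * rho t * cos s))).
Proof.
move=> ca cb ap bp t; rewrite /flux /hw1 /hw2 !shifted_trace; [|try by cont..]; last 4 first.
- by move=> s; rewrite periodic_sinD2pi bp.
- by move=> s; rewrite periodic_sinD2pi ap.
- by move=> s; rewrite periodic_cosD2pi bp.
- by move=> s; rewrite periodic_cosD2pi ap.
rewrite -!itgZ; [|cont..].
rewrite -itgD; [|cont..].
apply: eq_itg => s _.
have -> : rho t * cos s - drho t * sin s =
    normal1 rho drho t * cos (s + t) + normal2 rho drho t * sin (s + t).
  have -> : cos s = cos (s + t - t) by congr cos; ring.
  have -> : sin s = sin (s + t - t) by congr sin; ring.
  by rewrite cosB sinB /normal1 /normal2; ring.
by ring.
Qed.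

End BoundaryAsymptotics.

Section TraceAsymptotics.
Context {R : realType}.

Lemma scaled_stationary_phase (g dg : R -> R) M l : 0 < l ->
  (forall t : R, is_derive t (1 : R) g (dg t)) -> continuous dg ->
  (forall t, g (t + 2 * pi) = g t) -> (forall t, `|g t| <= M) -> (forall t, `|dg t| <= M) ->
  `|Num.sqrt l * itg (- pi) pi (fun t => g t * cos (l * cos t)) - (g 0 + g pi) / 2 * amp_cos l| <=
    10 * M * ((Num.sqrt l)^-1 * phase_defect l) /\
  `|Num.sqrt l * itg (- pi) pi (fun t => g t * sin (l * cos t)) - (g 0 - g pi) / 2 * amp_sin l| <=
    10 * M * ((Num.sqrt l)^-1 * phase_defect l).
Proof.
move=> l0 dgE cdg gp gM dgM.
have [hc hs] := stationary_phase l0 dgE cdg gp gM dgM.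
have s0 : 0 < Num.sqrt l by rewrite sqrtr_gt0.
have sl : Num.sqrt l ^+ 2 = l by rewrite sqr_sqrtr// ltW.
have -> : (Num.sqrt l)^-1 = Num.sqrt l * l^-1 by rewrite -[in l^-1]sl; field; rewrite gt_eqF.
have -> : 10 * M * (Num.sqrt l * l^-1 * phase_defect l) =
  Num.sqrt l * (10 * M * (l^-1 * phase_defect l)) by ring.
rewrite /amp_cos /amp_sin; split.
  by rewrite mulrCA -mulrBr normrM (gtr0_norm s0) ler_pM2l.
by rewrite mulrCA -mulrBr normrM (gtr0_norm s0) ler_pM2l.
Qed.

Lemma C1_periodic_bounded (f df : R -> R) : (forall t : R, is_derive t (1 : R) f (df t)) ->
  continuous df -> (forall t, f (t + 2 * pi) = f t) ->
  exists2 M, 0 < M & forall t, `|f t| <= M /\ `|df t| <= M.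
Proof.
move=> dfE cdf fp; have dfp := derivative_periodic dfE fp.
have [M M0 fM] := periodic_bounded (is_derive_continuous dfE) fp.
have [L L0 fL] := periodic_bounded cdf dfp.
exists (M + L) => [|t]; first by rewrite addr_gt0.
by have := fM t; have := fL t; split; lra.
Qed.

Variables rho drho : R -> R.
Hypothesis rho0 : forall t, 0 < rho t.
Hypothesis rhop : forall t, rho (t + 2 * pi) = rho t.
Hypothesis drho_rho : forall t : R, is_derive t (1 : R) rho (drho t).
Hypothesis cdrho : continuous drho.

Let crho := is_derive_continuous drho_rho.

Lemma radius_lower_bound : exists2 r, 0 < r & forall t, r <= rho t.
Proof.
have [r r0 H] := positive_lower_bound (- pi) pi crho rho0.
exists r => // t; have [z zt] := angle_representative t.
by rewrite -(periodicz z rhop); exact: H.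
Qed.

(** The normal weight rho cos s - rho' sin s equals rho at s = 0 and - rho at s = pi. It therefore
    exchanges even and odd halves, which is why the leading term of the flux contains [odd_half b]
    with the cosine amplitude and [even_half a] with the sine one. *)
Lemma trace_defect a b : C1_periodic a -> C1_periodic b -> exists2 M, 0 < M &
  forall k t, 0 < k -> let l := k * rho t in
  `|Num.sqrt l * trace rho k a b t - (even_half a t * amp_cos l + odd_half b t * amp_sin l)| <=
    M * ((Num.sqrt l)^-1 * phase_defect l) /\
  `|Num.sqrt l * flux rho drho k a b t / l - (odd_half b t * amp_cos l - even_half a t * amp_sin l)| <=
    M * ((Num.sqrt l)^-1 * phase_defect l).
Proof.
move=> Ca Cb.
have [ca cb] := (C1_periodic_continuous Ca, C1_periodic_continuous Cb).
case: Ca Cb => da [daE cda ap] [db [dbE cdb bp]].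
have [Ma Ma0 aM] := C1_periodic_bounded daE cda ap.
have [Mb Mb0 bM] := C1_periodic_bounded dbE cdb bp.
have [Mr Mr0 rM] := C1_periodic_bounded drho_rho cdrho rhop.
have [r r0 rr] := radius_lower_bound.
pose M := Ma + Mb; pose L := 4 * (Mr * M).
have M0 : 0 < M by rewrite addr_gt0.
have MrM0 : 0 < Mr * M by rewrite mulr_gt0.
have {}aM t : `|a t| <= M /\ `|da t| <= M by have := aM t; rewrite /M; split; lra.
have {}bM t : `|b t| <= M /\ `|db t| <= M by have := bM t; rewrite /M; split; lra.
(* Each expression is a sum of two stationary phase integrals with constant 10. [L] bounds the
   densities times the normal weight and their derivatives; division by rho >= r comes from k / l =
   1 / rho. *)
exists (20 * M + 20 * L / r) => [|k t k0 l].
  by rewrite addr_gt0 ?divr_gt0 ?mulr_gt0.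
have l0 : 0 < l by rewrite mulr_gt0.
have eta0 : 0 <= (Num.sqrt l)^-1 * phase_defect l.
  by rewrite mulr_ge0 ?invr_ge0 ?sqrtr_ge0 ?phase_defect_ge0.
set eta := (Num.sqrt l)^-1 * phase_defect l in eta0 *.
have shift (f df : R -> R) : (forall t : R, is_derive t (1 : R) f (df t)) ->
    forall s : R, is_derive s (1 : R) (fun s => f (s + t)) (df (s + t)).
  by move=> dfE s; exact: is_derive_addr.
have shiftp (f : R -> R) : (forall t, f (t + 2 * pi) = f t) ->
    forall s, f (s + 2 * pi + t) = f (s + t).
  by move=> fp s; rewrite addrAC fp.
have ax : pi + t = t + pi by rewrite addrC.
have cdas : continuous (fun s => da (s + t)) by cont.
have cdbs : continuous (fun s => db (s + t)) by cont.
have [ha _] := scaled_stationary_phase l0 (shift _ _ daE) cdas (shiftp _ ap)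
  (fun s => (aM (s + t)).1) (fun s => (aM (s + t)).2).
have [_ hb] := scaled_stationary_phase l0 (shift _ _ dbE) cdbs (shiftp _ bp)
  (fun s => (bM (s + t)).1) (fun s => (bM (s + t)).2).
rewrite -/eta in ha hb.
pose n s := rho t * cos s - drho t * sin s.
pose dn s := - (rho t * sin s) - drho t * cos s.
have nM s : `|n s| <= 2 * Mr /\ `|dn s| <= 2 * Mr.
  have [h1 h2] := rM t; have c1 := cos_max s; have s1 := sin_max s.
  have H (u v x y : R) : `|u| <= Mr -> `|v| <= Mr -> `|x| <= 1 -> `|y| <= 1 -> `|u * x - v * y| <= 2 * Mr.
    move=> hu hv hx hy; rewrite (le_trans (ler_normB _ _))// !normrM.
    have : `|u| * `|x| <= Mr by rewrite (le_trans _ hu)// ler_piMr.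
    have : `|v| * `|y| <= Mr by rewrite (le_trans _ hv)// ler_piMr.
    lra.
  split; first exact: H.
  by rewrite /dn -mulNr; apply: H; rewrite ?normrN.
have dnE (s : R) : is_derive s (1 : R) n (dn s) by rewrite /n; isd; rewrite /dn; ring.
have cn := is_derive_continuous dnE.
have cdn : continuous dn by rewrite /dn; cont.
have np s : n (s + 2 * pi) = n s by rewrite /n periodic_cosD2pi periodic_sinD2pi.
have key (f df : R -> R) : (forall t : R, is_derive t (1 : R) f (df t)) -> continuous df ->
    (forall t, f (t + 2 * pi) = f t) -> (forall t, `|f t| <= M /\ `|df t| <= M) ->
  `|Num.sqrt l * itg (- pi) pi (fun s => n s * f (s + t) * cos (l * cos s))
     - rho t * odd_half f t * amp_cos l| <= 10 * L * eta /\
  `|Num.sqrt l * itg (- pi) pi (fun s => n s * f (s + t) * sin (l * cos s))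
     - rho t * even_half f t * amp_sin l| <= 10 * L * eta.
  move=> dfE cdf fp fM; have cf := is_derive_continuous dfE.
  have gE (s : R) : is_derive s (1 : R) (fun s => n s * f (s + t)) (dn s * f (s + t) + n s * df (s + t)).
    exact: isdM (dnE s) (shift _ _ dfE s).
  have [|s|s|s|h1 h2] := @scaled_stationary_phase _ _ L l l0 gE.
  - by cont.
  - by rewrite np shiftp.
  - have [h1 h2] := nM s; have [h3 h4] := fM (s + t); rewrite normrM /L.
    have : `|n s| * `|f (s + t)| <= 2 * Mr * M by rewrite ler_pM.
    lra.
  - have [h1 h2] := nM s; have [h3 h4] := fM (s + t).
    have k1 : `|dn s * f (s + t)| <= 2 * Mr * M by rewrite normrM ler_pM.
    have k2 : `|n s * df (s + t)| <= 2 * Mr * M by rewrite normrM ler_pM.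
    by rewrite (le_trans (ler_normD _ _))// /L; lra.
  rewrite -/eta /n cos0 sin0 cospi sinpi add0r ax in h1 h2.
  split; [apply: le_trans h1|apply: le_trans h2]; rewrite le_eqVlt; apply/orP; left; apply/eqP.
    by congr (`|_ - _|); rewrite /odd_half; ring.
  by congr (`|_ - _|); rewrite /even_half; ring.
have [_ ka] := key _ _ daE cda ap aM. have [kb _] := key _ _ dbE cdb bp bM.
rewrite !add0r ax in ha hb.
have L0 : 0 < L by rewrite mulr_gt0.
have Lr0 : 0 <= 20 * L / r * eta by rewrite mulr_ge0// divr_ge0 ?mulr_ge0//; exact: ltW.
have Me0 : 0 <= M * eta by rewrite mulr_ge0// ltW.
rewrite mulrDl; split.
  rewrite /trace (shifted_trace rho k ca cb ap bp) -/l itgD; [|cont..].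
  rewrite mulrDr [- (_ + odd_half b t * _)]opprD addrACA (le_trans (ler_normD _ _))//.
  by move: ha hb; rewrite -/(even_half a t) -/(odd_half b t); lra.
rewrite (shifted_flux rho drho k ca cb ap bp) -/l.
pose Ic := itg (- pi) pi (fun s => n s * b (s + t) * cos (l * cos s)).
pose Is := itg (- pi) pi (fun s => n s * a (s + t) * sin (l * cos s)).
have -> : itg (- pi) pi (fun s => (rho t * cos s - drho t * sin s) *
    (b (s + t) * cos (l * cos s) - a (s + t) * sin (l * cos s))) = Ic - Is.
  rewrite -itgB; [|cont..].
  by apply: eq_itg => s _; rewrite /n; ring.
have rt := rho0 t.
have -> : Num.sqrt l * (k * (Ic - Is)) / l - (odd_half b t * amp_cos l - even_half a t * amp_sin l) =
    ((Num.sqrt l * Ic - rho t * odd_half b t * amp_cos l) -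
     (Num.sqrt l * Is - rho t * even_half a t * amp_sin l)) / rho t.
  have -> : Num.sqrt l * (k * (Ic - Is)) / l = Num.sqrt l * (Ic - Is) / rho t.
    by rewrite /l; field; rewrite !gt_eqF.
  by field; rewrite gt_eqF.
rewrite normrM [X in _ * X]gtr0_norm ?invr_gt0//.
have B : `|(Num.sqrt l * Ic - rho t * odd_half b t * amp_cos l) -
     (Num.sqrt l * Is - rho t * even_half a t * amp_sin l)| <= 20 * L * eta.
  by rewrite (le_trans (ler_normB _ _))//; move: kb ka; rewrite -/Ic -/Is; lra.
have ir0 : 0 <= (rho t)^-1 by rewrite invr_ge0 ltW.
rewrite (le_trans (ler_wpM2r ir0 B))//.
have : (rho t)^-1 <= r^-1 by rewrite lef_pV2 ?posrE.
have L2 : 0 <= 20 * L * eta by rewrite mulr_ge0// mulr_ge0//; exact: ltW.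
move=> /(ler_wpM2l L2) /le_trans; apply.
have -> : 20 * L * eta * r^-1 = 20 * L / r * eta by ring.
by rewrite -[leLHS]add0r lerD2r -mulrA mulr_ge0.
Qed.

Lemma trace_asymptotics a b e : C1_periodic a -> C1_periodic b -> 0 < e -> exists K, forall k t,
  K <= k -> let l := k * rho t in [/\ 0 < k, 1 <= l,
  `|Num.sqrt l * trace rho k a b t - (even_half a t * amp_cos l + odd_half b t * amp_sin l)| <= e &
  `|Num.sqrt l * flux rho drho k a b t / l - (odd_half b t * amp_cos l - even_half a t * amp_sin l)|
    <= e].
Proof.
move=> Ca Cb e0; have [M M0 H] := trace_defect Ca Cb.
have [r r0 rr] := radius_lower_bound.
have [L L1 HL] := phase_defect_small (divr_gt0 e0 M0).
exists (L / r) => k t kK l.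
have k0 : 0 < k by apply: lt_le_trans kK; rewrite divr_gt0//; lra.
have Ll : L <= l.
  rewrite ler_pdivrMr// in kK; rewrite (le_trans kK)//.
  by rewrite ler_wpM2l// ltW.
have [h1 h2] := H k t k0; rewrite -/l in h1 h2.
have hl : M * ((Num.sqrt l)^-1 * phase_defect l) <= e.
  by rewrite mulrC -ler_pdivlMr//; exact: HL.
split=> //; [exact: le_trans Ll|exact: le_trans h1 hl|exact: le_trans h2 hl].
Qed.

End TraceAsymptotics.

Section BoundaryLimit.
Context {R : realType}.
Variables rho drho : R -> R.
Hypothesis rho0 : forall t, 0 < rho t.
Hypothesis rhop : forall t, rho (t + 2 * pi) = rho t.
Hypothesis drho_rho : forall t : R, is_derive t (1 : R) rho (drho t).
Hypothesis cdrho : continuous drho.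

Let crho := is_derive_continuous drho_rho.

(* limit of [sqrt h] times the integrand of the boundary term in [green_hw], for [l = h k] *)
Definition boundary_form h k (a b A B : R -> R) t := let l := k * rho t in
  h * (even_half a t * amp_cos l + odd_half b t * amp_sin l) *
    (odd_half B t * amp_cos (h * l) - even_half A t * amp_sin (h * l)) -
  (even_half A t * amp_cos (h * l) + odd_half B t * amp_sin (h * l)) *
    (odd_half b t * amp_cos l - even_half a t * amp_sin l).

Lemma continuous_boundary_form h k a b A B : continuous a -> continuous b -> continuous A ->
  continuous B -> continuous (boundary_form h k a b A B).
Proof.
move=> ca cb cA cB; have cp := @continuous_amp_cos R; have cm := @continuous_amp_sin R.
by rewrite /boundary_form /even_half /odd_half; cont.
Qed.

Let product_defect (x x0 y y0 P d : R) : `|x - x0| <= d -> `|y - y0| <= d -> `|x0| <= P ->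
  `|y0| <= P -> d <= 1 -> `|x * y - x0 * y0| <= (2 * P + 1) * d.
Proof.
move=> hx hy x0P y0P d1.
have d0 : 0 <= d by apply: le_trans hx.
have P0 : 0 <= P by apply: le_trans x0P.
have -> : x * y - x0 * y0 = (x - x0) * (y - y0) + ((x - x0) * y0 + x0 * (y - y0)) by ring.
rewrite (le_trans (ler_normD _ _))//.
have h1 : `|(x - x0) * (y - y0)| <= d * d by rewrite normrM ler_pM.
have h2 : `|(x - x0) * y0| <= d * P by rewrite normrM ler_pM.
have h3 : `|x0 * (y - y0)| <= P * d by rewrite normrM ler_pM.
have h4 : d * d <= d by rewrite ler_piMl.
have h5 := ler_normD ((x - x0) * y0) (x0 * (y - y0)).
lra.
Qed.

Lemma boundary_limit h a b A B e : 1 < h -> C1_periodic a -> C1_periodic b -> C1_periodic A ->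
  C1_periodic B -> 0 < e -> exists K, forall k, K <= k ->
  \int[leb2 (R := R)]_(x in star_domain rho) (hw k a b x * hw (h * k) A B x) = 0 ->
  `|itg (- pi) pi (boundary_form h k a b A B)| <= e.
Proof.
move=> h1 Ca Cb CA CB e0; have pi0 := @pi_gt0 R.
have h0 : 0 < h := lt_trans ltr01 h1.
have [ca cb] := (C1_periodic_continuous Ca, C1_periodic_continuous Cb).
have [cA cB] := (C1_periodic_continuous CA, C1_periodic_continuous CB).
have [Ma Ma0 aM] := periodic_bounded ca (C1_periodic_periodic Ca).
have [Mb Mb0 bM] := periodic_bounded cb (C1_periodic_periodic Cb).
have [MA MA0 AM] := periodic_bounded cA (C1_periodic_periodic CA).
have [MB MB0 BM] := periodic_bounded cB (C1_periodic_periodic CB).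
have [_ [C [_ C0 _ pC]]] := @amp_bounds R.
pose M := Ma + Mb + MA + MB.
have M0 : 0 < M by rewrite /M; lra.
have evenM f Mf : (forall t, `|f t| <= Mf) -> Mf <= M -> forall t, `|even_half f t| <= M.
  move=> fM MfM t; have := fM t; have := fM (t + pi); rewrite /even_half !ler_norml.
  by move=> /andP[? ?] /andP[? ?]; apply/andP; split; lra.
have oddM f Mf : (forall t, `|f t| <= Mf) -> Mf <= M -> forall t, `|odd_half f t| <= M.
  move=> fM MfM t; have := fM t; have := fM (t + pi); rewrite /odd_half !ler_norml.
  by move=> /andP[? ?] /andP[? ?]; apply/andP; split; lra.
have Ea := evenM _ _ aM ltac:(rewrite /M; lra). have Ob := oddM _ _ bM ltac:(rewrite /M; lra).
have EA := evenM _ _ AM ltac:(rewrite /M; lra). have OB := oddM _ _ BM ltac:(rewrite /M; lra).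
pose P := 2 * (M * C).
have P0 : 0 < P by rewrite /P !mulr_gt0.
have bD (u v x y : R) : `|u| <= M -> `|v| <= M -> `|x| <= C -> `|y| <= C -> `|u * x + v * y| <= P.
  move=> hu hv hx hy; rewrite (le_trans (ler_normD _ _))//.
  have H1 : `|u * x| <= M * C by rewrite normrM ler_pM.
  have H2 : `|v * y| <= M * C by rewrite normrM ler_pM.
  rewrite /P; lra.
have bB (u v x y : R) : `|u| <= M -> `|v| <= M -> `|x| <= C -> `|y| <= C -> `|u * x - v * y| <= P.
  by move=> hu hv hx hy; rewrite -mulNr; apply: bD => //; rewrite normrN.
(* The two product errors are at most (2 P + 1) d, with weights h and 1, over an interval of length
   2 pi. *)
pose Q := (h + 1) * (2 * P + 1) * (pi - - pi).
have Q0 : 0 < Q by rewrite /Q !mulr_gt0//; lra.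
pose d := Num.min 1 (e / Q).
have d0 : 0 < d by rewrite lt_min ltr01 divr_gt0.
have d1 : d <= 1 by rewrite ge_min lexx.
have dQ : (h + 1) * (2 * P + 1) * d * (pi - - pi) <= e.
  rewrite mulrAC -/Q mulrC -ler_pdivlMr//.
  by rewrite /d ge_min lexx orbT.
have [K1 H1] := trace_asymptotics rho0 rhop drho_rho cdrho Ca Cb d0.
have [K2 H2] := trace_asymptotics rho0 rhop drho_rho cdrho CA CB d0.
exists (Num.max 0 (Num.max K1 K2)) => k.
rewrite !ge_max => /andP[k0 /andP[k1 k2]] orth.
have hk2 : K2 <= h * k by rewrite (le_trans k2)// ler_peMl// ltW.
have G : itg (- pi) pi (fun t => trace rho k a b t * flux rho drho (h * k) A B t -
    trace rho (h * k) A B t * flux rho drho k a b t) = 0.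
  by rewrite -(green_hw rho0 rhop drho_rho cdrho k (h * k) ca cb cA cB) orth mulr0.
have ct1 := continuous_trace drho_rho (k := k) ca cb. have ct2 := continuous_trace drho_rho (k := h * k) cA cB.
have cf1 := continuous_flux drho_rho cdrho (k := k) ca cb.
have cf2 := continuous_flux drho_rho cdrho (k := h * k) cA cB.
have cbf := continuous_boundary_form (h := h) (k := k) ca cb cA cB.
set F := (fun t => _ - _) in G.
have cF : continuous F by rewrite /F; cont.
have -> : itg (- pi) pi (boundary_form h k a b A B) =
    itg (- pi) pi (fun t => boundary_form h k a b A B t - Num.sqrt h * F t).
  rewrite [RHS]itgB; [|cont..].
  by rewrite itgZ// G mulr0 subr0.
rewrite (le_trans _ dQ)//; apply: norm_itg_le_cst; [lra|cont|] => t _.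
have [k0' l1 x1 x2] := H1 k t k1. have [_ hl1 y1 y2] := H2 (h * k) t hk2.
set l := k * rho t in l1 x1 x2 *.
have l0 : 0 < l := lt_le_trans ltr01 l1.
have lE : h * k * rho t = h * l by rewrite /l mulrA.
rewrite lE in hl1 y1 y2.
have [[pl ml] [phl mhl]] := (pC _ l1, pC _ hl1).
have D1 := product_defect x1 y2 (bD _ _ _ _ (Ea t) (Ob t) pl ml) (bB _ _ _ _ (OB t) (EA t) phl mhl) d1.
have D2 := product_defect y1 x2 (bD _ _ _ _ (EA t) (OB t) phl mhl) (bB _ _ _ _ (Ob t) (Ea t) pl ml) d1.
rewrite /boundary_form -/l -mulrA.
set m1 := (_ + _) * (_ - _) in D1 *. set m2 := (_ + _) * (_ - _) in D2 *.
set q1 := (X in X - m1) in D1. set q2 := (X in X - m2) in D2.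
(* The traces are normalized by sqrt(l) and sqrt(h l), the fluxes by sqrt(l) / l and sqrt(h l) / (h
   l); collecting the factors gives sqrt(h) on the left and h in front of [q1]. *)
have -> : Num.sqrt h * F t = h * q1 - q2.
  rewrite /q1 /q2 /F (sqrtrM l); last exact: ltW.
  have sl : Num.sqrt l ^+ 2 = l by rewrite sqr_sqrtr// ltW.
  have sh : Num.sqrt h ^+ 2 = h by rewrite sqr_sqrtr// ltW.
  have sl0 : Num.sqrt l != 0 by rewrite gt_eqF// sqrtr_gt0.
  have sh0 : Num.sqrt h != 0 by rewrite gt_eqF// sqrtr_gt0.
  move: sl sh sl0 sh0; set sl := Num.sqrt l; set sh := Num.sqrt h => <- <- sl0 sh0.
  by field; rewrite sl0 sh0.
have -> : h * m1 - m2 - (h * q1 - q2) = (q2 - m2) - h * (q1 - m1) by ring.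
rewrite (le_trans (ler_normB _ _))// normrM (gtr0_norm h0).
have -> : (h + 1) * (2 * P + 1) * d = (2 * P + 1) * d + h * ((2 * P + 1) * d) by ring.
by rewrite lerD// ler_wpM2l// ltW.
Qed.

End BoundaryLimit.

(** * Localization at a circular arc *)

Section VanishingAtInfinity.
Context {R : realType}.
Implicit Types (F G : R -> R).

Definition vanishing F := forall e : R, 0 < e -> exists K : R, forall k, K <= k -> `|F k| <= e.

Lemma vanishingD F G : vanishing F -> vanishing G -> vanishing (fun k => F k + G k).
Proof.
move=> vF vG e e0; have [K HK] := vF _ (divr_gt0 e0 (ltr0n R 2)).
have [L HL] := vG _ (divr_gt0 e0 (ltr0n R 2)).
exists (Num.max K L) => k; rewrite ge_max => /andP[/HK h1 /HL h2].
by rewrite (le_trans (ler_normD _ _))//; lra.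
Qed.

Lemma vanishingZ c F : vanishing F -> vanishing (fun k => c * F k).
Proof.
move=> vF e e0; have c0 : 0 < `|c| + 1 by rewrite ltr_wpDl.
have [K HK] := vF _ (divr_gt0 e0 c0); exists K => k /HK h.
rewrite normrM (@le_trans _ _ ((`|c| + 1) * `|F k|))//; last by rewrite mulrC -ler_pdivlMr.
by rewrite ler_wpM2r// lerDl.
Qed.

End VanishingAtInfinity.

Section C1Periodic.
Context {R : realType}.
Implicit Types (f g : R -> R).

Lemma C1_periodicM f g : C1_periodic f -> C1_periodic g -> C1_periodic (fun t => f t * g t).
Proof.
move=> [df [dfE cdf fp]] [dg [dgE cdg gp]].
have [cf cg] := (is_derive_continuous dfE, is_derive_continuous dgE).
exists (fun t => df t * g t + f t * dg t); split; [|cont|by move=> t; rewrite fp gp].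
by move=> t; exact: isdM.
Qed.

Lemma C1_periodicD f g : C1_periodic f -> C1_periodic g -> C1_periodic (fun t => f t + g t).
Proof.
move=> [df [dfE cdf fp]] [dg [dgE cdg gp]].
exists (fun t => df t + dg t); split; [|cont|by move=> t; rewrite fp gp].
by move=> t; exact: isdD.
Qed.

Lemma C1_periodic_cst (c : R) : C1_periodic (fun=> c).
Proof. by exists (fun=> 0); split => //; [move=> t; exact: isd_cst|cont]. Qed.

Lemma C1_periodic_shift f c : C1_periodic f -> C1_periodic (fun t => f (t + c)).
Proof.
move=> [df [dfE cdf fp]]; exists (fun t => df (t + c)); split; [|cont|].
  by move=> t; exact: is_derive_addr.
by move=> t; rewrite addrAC fp.
Qed.

Lemma C1_periodic_even_half f : C1_periodic f -> C1_periodic (even_half f).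
Proof.
move=> Cf; apply: C1_periodicM; last exact: C1_periodic_cst.
by apply: C1_periodicD => //; exact: C1_periodic_shift.
Qed.

Lemma C1_periodic_odd_half f : C1_periodic f -> C1_periodic (odd_half f).
Proof.
move=> Cf; rewrite (_ : odd_half f = fun t => (f t + -1 * f (t + pi)) / 2); last first.
  by apply/funext => t; rewrite mulN1r.
apply: C1_periodicM; last exact: C1_periodic_cst.
apply: C1_periodicD => //; apply: C1_periodicM; first exact: C1_periodic_cst.
exact: C1_periodic_shift.
Qed.

End C1Periodic.

Section LocalVanishing.
Context {R : realType}.
Variables rho drho ddrho : R -> R.
Hypothesis rho0 : forall t, 0 < rho t.
Hypothesis rhop : forall t, rho (t + 2 * pi) = rho t.
Hypothesis drhoE : forall t : R, is_derive t (1 : R) rho (drho t).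
Hypothesis ddrhoE : forall t : R, is_derive t (1 : R) drho (ddrho t).
Hypothesis cddrho : continuous ddrho.
Variables (h : R) (a b : R -> R) (S : set R).
Hypothesis h1 : 1 < h.
Hypotheses (Ca : C1_periodic a) (Cb : C1_periodic b).
Hypothesis S_unbounded : forall K, exists2 k, K <= k & S k.
Hypothesis S_orth : forall k, S k -> forall A B, C1_periodic A -> C1_periodic B ->
  \int[leb2 (R := R)]_(x in star_domain rho) (hw k a b x * hw (h * k) A B x) = 0.
Variables (Y : R -> R) (c : R).
Hypothesis CY : C1_periodic Y.
Hypothesis c_gt0 : 0 < c.
Hypothesis Y_circle : forall t, Y t != 0 -> rho t = c.
Hypothesis Y_antipodal :
  {ae (@lebesgue_measure R), forall t, Y (t + pi) != 0 -> drho t != 0}.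

Let E := even_half a.
Let O := odd_half b.
Let Cz : C1_periodic (fun=> 0 : R) := C1_periodic_cst 0.
Let cdrho := is_derive_continuous ddrhoE.
Let crho := is_derive_continuous drhoE.
Let CE : C1_periodic E := C1_periodic_even_half Ca.
Let CO : C1_periodic O := C1_periodic_odd_half Cb.
Let cE := C1_periodic_continuous CE.
Let cO := C1_periodic_continuous CO.
Let cY := C1_periodic_continuous CY.
Let cp := @continuous_amp_cos R.
Let cm := @continuous_amp_sin R.

(** The part of [boundary_form] that does not depend on the test density. A cosine density
    corresponds to (x, y) = (- amp_sin, amp_cos), a sine density to (amp_cos, amp_sin). *)
Let form k (x y : R -> R) t := let l := k * rho t in
  h * (E t * amp_cos l + O t * amp_sin l) * x (h * l) -
  y (h * l) * (O t * amp_cos l - E t * amp_sin l).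

Let continuous_form k x y : continuous x -> continuous y -> continuous (form k x y).
Proof. by move=> cx cy; rewrite /form; cont. Qed.

Let antipodal_vanishing z g : oscillating z -> C1_periodic g ->
  vanishing (fun k => itg (- pi) pi (fun t => Y (t + pi) * g t * z (k * rho t))).
Proof.
move=> oz Cg e e0.
have [dg [dgE cdg gp]] := C1_periodicM (C1_periodic_shift pi CY) Cg.
apply: (riemann_lebesgue rho0 rhop drhoE ddrhoE cddrho oz dgE cdg gp _ e0).
have sf := @filterS _ _ (ae_filter_ringOfSetsType leb).
apply: sf Y_antipodal => t H; rewrite mulf_eq0 negb_or => /andP[+ _]; exact: H.
Qed.

Let antipodal_form_vanishing x y :
  oscillating (fun l => amp_cos l * x (h * l)) -> oscillating (fun l => amp_sin l * x (h * l)) ->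
  oscillating (fun l => amp_cos l * y (h * l)) -> oscillating (fun l => amp_sin l * y (h * l)) ->
  continuous x -> continuous y ->
  vanishing (fun k => itg (- pi) pi (fun t => Y (t + pi) * form k x y t)).
Proof.
move=> ocx osx ocy osy cx cy.
have v := vanishingD (vanishingD (vanishingZ h (antipodal_vanishing ocx CE))
                        (vanishingZ h (antipodal_vanishing osx CO)))
   (vanishingD (vanishingZ (-1) (antipodal_vanishing ocy CO)) (antipodal_vanishing osy CE)).
apply: (eq_rect _ vanishing v); apply/funext => k; rewrite -!itgZ; [|cont..].
rewrite -!itgD; [|cont..].
by apply: eq_itg => t _; rewrite /form; ring.
Qed.

(* [Y] lives where the radius is constant, so the oscillating factors leave the integral. *)
Let circle_form k x y : itg (- pi) pi (fun t => Y t * form k x y t) =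
  let l := k * c in
  let e := itg (- pi) pi (fun t => Y t * E t) in
  let o := itg (- pi) pi (fun t => Y t * O t) in
  h * (e * amp_cos l + o * amp_sin l) * x (h * l) - y (h * l) * (o * amp_cos l - e * amp_sin l).
Proof.
cbv zeta; set l := k * c.
pose u := h * amp_cos l * x (h * l) + y (h * l) * amp_sin l.
pose v := h * amp_sin l * x (h * l) - y (h * l) * amp_cos l.
transitivity (itg (- pi) pi (fun t => u * (Y t * E t) + v * (Y t * O t))).
  apply: eq_itg => t _; have [->|/Y_circle rc] := eqVneq (Y t) 0; first by ring.
  by rewrite /form rc -/l /u /v; ring.
rewrite itgD; [|cont..].
rewrite !itgZ; [|cont..].
by rewrite /u /v; ring.
Qed.

(** The two equations apply a rotation, scaled by the root of P^2 + M^2, to (h y1, y2), and (y1, y2)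
    is a rotation of (e, o), scaled by the root of p^2 + m^2. Hence the sum of squares is computed
    exactly. As d <= 1, each square is at most 9 d, which gives 18 d. *)
Let amplitude_system (c0 d e o p m P M : R) : 0 < c0 -> 0 < d <= 1 ->
  c0 <= p ^+ 2 + m ^+ 2 -> c0 <= P ^+ 2 + M ^+ 2 ->
  `|h * (e * p + o * m) * - M - P * (o * p - e * m)| <= 3 * d ->
  `|h * (e * p + o * m) * P - M * (o * p - e * m)| <= 3 * d ->
  c0 ^+ 2 * (e ^+ 2 + o ^+ 2) <= 18 * d.
Proof.
have hh := h1; move=> c00 /andP[d0 d1] a1 a2.
pose y1 := e * p + o * m; pose y2 := o * p - e * m.
rewrite -/y1 -/y2 => H3 H4.
have sq3 (u : R) : `|u| <= 3 * d -> u ^+ 2 <= 9 * d.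
  move=> hu; rewrite -real_normK ?num_real//.
  have : `|u| ^+ 2 <= (3 * d) ^+ 2 by rewrite lerXn2r// nnegrE; lra.
  by nra.
have := sq3 _ H3; have := sq3 _ H4 => q2 q1.
have y12 : y1 ^+ 2 + y2 ^+ 2 = (e ^+ 2 + o ^+ 2) * (p ^+ 2 + m ^+ 2) by rewrite /y1 /y2; ring.
have tot : (h ^+ 2 * y1 ^+ 2 + y2 ^+ 2) * (P ^+ 2 + M ^+ 2) <= 18 * d.
  have -> : (h ^+ 2 * y1 ^+ 2 + y2 ^+ 2) * (P ^+ 2 + M ^+ 2) =
    (h * y1 * - M - P * y2) ^+ 2 + (h * y1 * P - M * y2) ^+ 2 by ring.
  lra.
have z1 := sqr_ge0 y1. have z2 := sqr_ge0 y2. have z3 := sqr_ge0 e. have z4 := sqr_ge0 o.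
have b1 : c0 * (e ^+ 2 + o ^+ 2) <= y1 ^+ 2 + y2 ^+ 2.
  by rewrite y12 mulrC ler_wpM2l// addr_ge0.
have b2 : y1 ^+ 2 + y2 ^+ 2 <= h ^+ 2 * y1 ^+ 2 + y2 ^+ 2.
  by rewrite lerD2r ler_peMl// expr_ge1//; lra.
apply: le_trans tot; rewrite expr2 -mulrA mulrC.
apply: ler_pM => //; [|exact: ltW|exact: le_trans b2].
by rewrite mulr_ge0 ?addr_ge0// ltW.
Qed.

Let half_le (d u v : R) : `|2^-1 * (u + v)| <= d -> `|v| <= d -> `|u| <= 3 * d.
Proof. by rewrite !ler_norml => /andP[? ?] /andP[? ?]; apply/andP; split; lra. Qed.

(** The two integrals do not depend on k, so it is enough to bound them by an arbitrary d at one
    suitable large k in [S]. The contributions at t + pi are small by Riemann-Lebesgue, and those on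
    the circular arc satisfy the linear system. *)
Lemma local_vanishing :
  itg (- pi) pi (fun t => Y t * even_half a t) = 0 /\
  itg (- pi) pi (fun t => Y t * odd_half b t) = 0.
Proof.
rewrite -/E -/O; set e := itg _ _ _; set o := itg _ _ _.
pose z0 := (fun=> 0) : R -> R.
pose nm (l : R) := - amp_sin l.
have cnm : continuous nm by rewrite /nm; cont.
have f1 k t : boundary_form rho h k a b Y z0 t =
    2^-1 * (Y t * form k nm (@amp_cos R) t + Y (t + pi) * form k nm (@amp_cos R) t).
  by rewrite /boundary_form /form /nm -/E -/O /even_half /odd_half /z0; field.
have f2 k t : boundary_form rho h k a b z0 Y t =
    2^-1 * (Y t * form k (@amp_cos R) (@amp_sin R) t - Y (t + pi) * form k (@amp_cos R) (@amp_sin R) t).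
  by rewrite /boundary_form /form -/E -/O /even_half /odd_half /z0; field.
have opN (z : R -> R) : oscillating z -> oscillating (fun l => - z l).
  move=> [D [s [C [[cD cz cs] [C0 dD DC]]]]].
  exists (fun l => - D l), (fun l => - s l), C; split; first by split; cont.
  split => // [l l0|l l1]; first by apply: isd_eq (isdN (dD l l0)) _; ring.
  by have [? ? ?] := DC l l1; rewrite !normrN.
have occ := oscillating_cos_cos h1. have ocs := oscillating_cos_sin h1.
have osc := oscillating_sin_cos h1. have oss := oscillating_sin_sin h1.
have ocn : oscillating (fun l => amp_cos l * nm (h * l)).
  by apply: (eq_rect _ oscillating (opN _ ocs)); apply/funext => l; rewrite /nm mulrN.
have osn : oscillating (fun l => amp_sin l * nm (h * l)).
  by apply: (eq_rect _ oscillating (opN _ oss)); apply/funext => l; rewrite /nm mulrN.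
have v1 := antipodal_form_vanishing ocn osn occ osc cnm cp.
have v2 := antipodal_form_vanishing occ osc ocs oss cp cm.
have [c0 [_ [c00 _ ampc0 _]]] := @amp_bounds R.
suff H d : 0 < d -> c0 ^+ 2 * (e ^+ 2 + o ^+ 2) <= d.
  have : c0 ^+ 2 * (e ^+ 2 + o ^+ 2) <= 0.
    by apply/ler_addgt0Pl => d d0; rewrite addr0; exact: H.
  rewrite pmulr_rle0 ?exprn_gt0// => eo.
  have := sqr_ge0 e; have := sqr_ge0 o => o2 e2.
  by split; apply/eqP; rewrite -sqrf_eq0 eq_le ?e2 ?o2 andbT; lra.
move=> d0; pose d1 := Num.min 1 (d / 18).
have d10 : 0 < d1 by rewrite lt_min ltr01 divr_gt0.
have d11 : d1 <= 1 by rewrite ge_min lexx.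
have d1d : d1 <= d / 18 by rewrite ge_min lexx orbT.
have [K1 H1] := v1 _ d10. have [K2 H2] := v2 _ d10.
have [K3 H3] := boundary_limit rho0 rhop drhoE cdrho h1 Ca Cb CY Cz d10.
have [K4 H4] := boundary_limit rho0 rhop drhoE cdrho h1 Ca Cb Cz CY d10.
(* The bound c^-1 gives k c >= 1, where the amplitude bounds hold. *)
have [k + Sk] := S_unbounded (Num.max (Num.max K1 K2) (Num.max (Num.max K3 K4) c^-1)).
rewrite !ge_max => /andP[/andP[/H1 {}H1 /H2 {}H2] /andP[/andP[k3 k4] kc]].
have {}H3 := H3 k k3 (S_orth Sk CY Cz). have {}H4 := H4 k k4 (S_orth Sk Cz CY).
have l1 : 1 <= k * c by rewrite -ler_pdivrMr// mul1r.
have hl1 : 1 <= h * (k * c) by rewrite (le_trans l1)// ler_peMl ?(le_trans ler01 l1)// ltW.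
have cf1 := @continuous_form k _ _ cnm cp. have cf2 := @continuous_form k _ _ cp cm.
have {}H3 : `|itg (- pi) pi (fun t => Y t * form k nm (@amp_cos R) t)| <= 3 * d1.
  apply: half_le H1; rewrite -itgD; [|cont..].
  by rewrite -itgZ; [rewrite -(eq_itg (fun t _ => f1 k t))|cont].
have {}H4 : `|itg (- pi) pi (fun t => Y t * form k (@amp_cos R) (@amp_sin R) t)| <= 3 * d1.
  apply: (@half_le d1 _ (- itg (- pi) pi (fun t => Y (t + pi) * form k (@amp_cos R) (@amp_sin R) t))); last by rewrite normrN.
  rewrite -itgB; [|cont..].
  by rewrite -itgZ; [rewrite -(eq_itg (fun t _ => f2 k t))|cont].
rewrite circle_form -/e -/o in H3. rewrite circle_form -/e -/o in H4.
have a1 := ampc0 _ l1. have a2 := ampc0 _ hl1.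
have d18 : 18 * d1 <= d by rewrite mulrC -ler_pdivlMr.
apply: le_trans (amplitude_system c00 _ a1 a2 H3 H4) d18.
by apply/andP.
Qed.

End LocalVanishing.

(** * Localizing functions on the circle *)

Section Bump.
Context {R : realType}.

(* [G y = max(0, y)^2] *)
Lemma half_square_antiderivative : exists G : R -> R,
  [/\ forall y : R, - 3 < y -> is_derive y (1 : R) G (y + `|y|),
      forall y, 0 <= G y, forall y, y <= 0 -> G y = 0 & forall y, 0 < y -> 0 < G y].
Proof.
(* [G] is built as the integral of y + |y| = 2 max(0, y) from -3, a point below all the values, at
   least -2, at which [bump] evaluates it. *)
have cf : continuous (fun y : R => y + `|y|) by cont.
have f0 (y : R) : 0 <= y + `|y| by have := ler_norm (- y); rewrite normrN; lra.
have le0 (y : R) : y <= 0 -> itg (-3) y (fun y => y + `|y|) = 0.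
  move=> y0; rewrite (@eq_itg _ _ _ _ (fun=> 0 * 0)); last first.
    by move=> t; rewrite in_itv/= => /andP[_ ty]; rewrite ler0_norm; lra.
  by rewrite itgZ ?mul0r//; cont.
exists (fun y => itg (-3) y (fun y => y + `|y|)); split => //.
- by move=> y y3; exact: (is_derive_itg_upper cf).
- by move=> y; exact: itg_ge0.
move=> y y0; rewrite (@itg_cat _ _ 0)//; [|lra].
rewrite le0// add0r (@eq_itg _ _ _ _ (fun x => 2 * x)); last first.
  by move=> t; rewrite in_itv/= => /andP[t0 _]; rewrite ger0_norm//; ring.
have dE (x : R) : is_derive x (1 : R) (fun x => x ^+ 2) (2 * x) by isd; ring.
rewrite (@itg_derive _ 0 y _ (fun x => 2 * x) _ dE); [|lra|cont].
by rewrite expr0n subr0 exprn_gt0.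
Qed.

(** The function max(0, cos(t - t0) - cos d)^2 is periodic by construction and C^1 because of the
    square. Reducing to d <= pi lets monotonicity of cos on [0, pi] locate the support. *)
Lemma bump (t0 d : R) : 0 < d -> exists X : R -> R,
  [/\ C1_periodic X, forall t, 0 <= X t, 0 < X t0 &
    forall t, X t != 0 -> exists z : int, `|t + 2 * pi *~ z - t0| < d].
Proof.
move=> d_gt0; have pi0 := @pi_gt0 R.
wlog dpi : d d_gt0 / d <= pi.
  move=> H; have [/H|pd] := leP d pi; first exact.
  have [//|X [CX X0 Xt HX]] := H pi pi0; exists X; split => // t /HX[z h].
  by exists z; exact: lt_trans pd.
have [G [dG G0 Gz Gp]] := half_square_antiderivative.
pose u t := cos (t - t0) - cos d.
have u3 t : - 3 < u t.
  rewrite /u; have := cos_geN1 (t - t0); have := cos_le1 d; lra.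
have udE (t : R) : is_derive t (1 : R) u (- sin (t - t0)) by rewrite /u; isd; ring.
have cu := is_derive_continuous udE.
exists (fun t => G (u t)); split => //.
- exists (fun t => (u t + `|u t|) * - sin (t - t0)); split; [|cont|].
    by move=> t; exact: (@isd_comp _ G u _ _ _ (dG _ (u3 t)) (udE t)).
  by move=> t; rewrite /u addrAC periodic_cosD2pi.
- apply: Gp; rewrite /u subrr subr_gt0 ltr_cos// in_itv/=; lra.
move=> t Gt; have ut : 0 < u t by rewrite ltNge; apply/negP => /Gz h; rewrite h eqxx in Gt.
have [z zt] := angle_representative (t - t0); exists z.
rewrite -addrA [_ *~ z - _]addrC addrA; move: zt; rewrite in_itv/= => /andP[z1 z2].
set s := _ + _ in z1 z2 *.
have st : cos d < cos `|s|.
  rewrite cos_norm /s (periodicz z (@periodic_cosD2pi R)).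
  by move: ut; rewrite /u subr_gt0.
move: st; rewrite ltr_cos//; rewrite in_itv/=; first by rewrite normr_ge0 ler_norml z1 z2.
by rewrite dpi ltW.
Qed.

Lemma itg_periodic_eq0 (f : R -> R) t0 : continuous f -> (forall t, f (t + 2 * pi) = f t) ->
  (forall t, 0 <= f t) -> itg (- pi) pi f = 0 -> f t0 = 0.
Proof.
move=> cf fp f0; have pi0 := @pi_gt0 R.
rewrite -(itg_shift_periodic t0 cf fp) => I0; apply/eqP; rewrite eq_le f0 andbT leNgt.
apply/negP => ft; pose g t := f (t + t0).
have cg : continuous g by rewrite /g; cont.
have h2 : 0 < f t0 / 2 by lra.
have /cvgrPdist_lt /(_ _ h2) := cg 0.
move=> /nbhs_ballP[d /= d0 Hd].
pose e := Num.min (d / 2) 1.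
have e0 : 0 < e by rewrite lt_min ltr01 divr_gt0.
have ed : e <= d / 2 by rewrite ge_min lexx.
have e1 : e <= 1 by rewrite ge_min lexx orbT.
have pi2 := @pi_ge2 R.
have : f t0 / 2 * (e - - e) <= itg (- e) e g.
  rewrite -itg_cst; last lra.
  apply: le_itg; [cont|exact: cg|] => t; rewrite in_itv/= => /andP[t1 t2].
  have : ball (0 : R) d t by rewrite /ball/= sub0r normrN ltr_norml; apply/andP; split; lra.
  by move=> /Hd; rewrite /g add0r ltr_norml => /andP[]; lra.
have : itg (- pi) pi g = 0 by exact: I0.
rewrite (@itg_cat _ _ (- e))//; [|lra|lra].
rewrite (@itg_cat _ (- e) e)//; [|lra|lra].
have j1 : 0 <= itg (- pi) (- e) g by apply: itg_ge0 => t _; exact: f0.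
have j2 : 0 <= itg e pi g by apply: itg_ge0 => t _; exact: f0.
have : 0 < f t0 / 2 * (e - - e) by rewrite mulr_gt0//; lra.
lra.
Qed.

End Bump.

Section DenseVanishing.
Context {R : realType}.
Variables rho drho ddrho : R -> R.
Hypothesis rho0 : forall t, 0 < rho t.
Hypothesis rhop : forall t, rho (t + 2 * pi) = rho t.
Hypothesis drhoE : forall t : R, is_derive t (1 : R) rho (drho t).
Hypothesis ddrhoE : forall t : R, is_derive t (1 : R) drho (ddrho t).
Hypothesis cddrho : continuous ddrho.
Variable N : set R.
Hypothesis oN : open N.
Hypothesis Np : forall t, N t <-> N (t + 2 * pi).
Hypothesis N_dense : closure (N `|` [set t | N (t - pi)]) = setT.
Hypothesis N_circle : forall t, N t -> drho t = 0.
Hypothesis N_antipodal : {ae (@lebesgue_measure R), forall t, N (t - pi) -> drho t != 0}.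
Variables (h : R) (a b : R -> R) (S : set R).
Hypothesis h1 : 1 < h.
Hypotheses (Ca : C1_periodic a) (Cb : C1_periodic b).
Hypothesis S_unbounded : forall K, exists2 k, K <= k & S k.
Hypothesis S_orth : forall k, S k -> forall A B, C1_periodic A -> C1_periodic B ->
  \int[leb2 (R := R)]_(x in star_domain rho) (hw k a b x * hw (h * k) A B x) = 0.

Let N_shift t (z : int) : N (t + 2 * pi *~ z) = N t.
Proof. by apply: (periodicz z) => s; apply/propext; have [] := Np s; split. Qed.

(** The test density is a bump times the half to be killed, so that the integral which vanishes is
    that of the bump times a square. *)
Lemma vanishing_on_circle t0 : N t0 -> even_half a t0 = 0 /\ odd_half b t0 = 0.
Proof.
move=> Nt0.
have /nbhs_ballP[d /= d0 Nd] : nbhs t0 N by exact: open_nbhs_nbhs.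
have {}Nd t : `|t - t0| < d -> N t by move=> td; apply: Nd; rewrite /ball/= distrC.
have rc t : `|t - t0| < d -> rho t = rho t0.
  have H s u : s <= u -> `|s - t0| < d -> `|u - t0| < d -> rho u = rho s.
    move=> su; rewrite !ltr_norml => /andP[s1 s2] /andP[u1 u2].
    apply: itg_eq_at_deriv0 su _ => x /andP[sx xu].
    apply: isd_eq (drhoE x) _; apply: N_circle; apply: Nd.
    by rewrite ltr_norml; apply/andP; split; lra.
  have t00 : `|t0 - t0| < d by rewrite subrr normr0.
  move=> td; have [/H|/ltW/H] := leP t t0; first by move=> ->.
  exact.
have [X [CX X0 Xt0 HX]] := bump t0 d0.
have key g : C1_periodic g ->
    itg (- pi) pi (fun t => X t * g t * even_half a t) = 0 /\
    itg (- pi) pi (fun t => X t * g t * odd_half b t) = 0.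
  move=> Cg; apply: (local_vanishing rho0 rhop drhoE ddrhoE cddrho h1 Ca Cb S_unbounded S_orth
    (C1_periodicM CX Cg) (rho0 t0)).
    move=> t; rewrite mulf_eq0 negb_or => /andP[/HX[z /rc]] + _.
    by rewrite (periodicz z rhop).
  have sf := @filterS _ _ (ae_filter_ringOfSetsType leb).
  apply: sf N_antipodal => t H; rewrite mulf_eq0 negb_or => /andP[/HX[z /Nd]] + _.
  rewrite N_shift => Nt; apply: H; apply/Np; rewrite (_ : t - pi + 2 * pi = t + pi)//; ring.
have sq g : C1_periodic g -> itg (- pi) pi (fun t => X t * g t * g t) = 0 -> g t0 = 0.
  move=> Cg I0; have [cX cg] := (C1_periodic_continuous CX, C1_periodic_continuous Cg).
  have : X t0 * g t0 * g t0 = 0.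
    apply: (@itg_periodic_eq0 _ (fun t => X t * g t * g t) t0) I0.
    - by cont.
    - by move=> t; rewrite (C1_periodic_periodic CX) (C1_periodic_periodic Cg).
    - by move=> t; rewrite -mulrA -expr2 mulr_ge0// sqr_ge0.
  by move/eqP; rewrite -mulrA mulf_eq0 gt_eqF//= -expr2 sqrf_eq0 => /eqP.
split.
  by apply: (sq (even_half a)) => //; [exact: C1_periodic_even_half|exact: (key _ (C1_periodic_even_half Ca)).1].
by apply: (sq (odd_half b)) => //; [exact: C1_periodic_odd_half|exact: (key _ (C1_periodic_odd_half Cb)).2].
Qed.

(** Translation by pi fixes the even half and changes the sign of the odd half, so both also vanish
    on N + pi, and then on the closure. *)
Lemma dense_vanishing t : even_half a t = 0 /\ odd_half b t = 0.
Proof.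
have H (g : R -> R) : continuous g -> (forall t, N t -> g t = 0) ->
    (forall t, N (t - pi) -> g t = 0) -> g t = 0.
  move=> cg gN gN'.
  have : closure (N `|` [set t | N (t - pi)]) `<=` g @^-1` [set 0].
    rewrite [X in _ `<=` X](closure_id _).1; first by apply: closure_subset => s [/gN|/gN'].
    apply: closed_comp; [by move=> s _; exact: cg|exact: closed_eq].
  by rewrite N_dense; exact.
have ap := C1_periodic_periodic Ca. have bp := C1_periodic_periodic Cb.
have ppi (s : R) : s + pi = s - pi + 2 * pi by ring.
split; apply: H.
- exact: C1_periodic_continuous (C1_periodic_even_half Ca).
- by move=> s /vanishing_on_circle[].
- move=> s /vanishing_on_circle[]; rewrite /even_half subrK => e0 _.
  by rewrite -[RHS]e0 ppi ap addrC.
- exact: C1_periodic_continuous (C1_periodic_odd_half Cb).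
- by move=> s /vanishing_on_circle[].
move=> s /vanishing_on_circle[_]; rewrite /odd_half subrK => e0.
by apply: oppr_inj; rewrite oppr0 -[RHS]e0 ppi bp; ring.
Qed.

End DenseVanishing.

(** * From infinitely many wave numbers to a contradiction *)

Section Conclusion.
Context {R : realType}.
Variable rho : R -> R.
Hypothesis rho0 : forall t, 0 < rho t.
Hypothesis rhop : forall t, rho (t + 2 * pi) = rho t.
Hypothesis crho : continuous rho.

Definition orthogonal_at h (a b : R -> R) k := forall A B, C1_periodic A -> C1_periodic B ->
  \int[leb2 (R := R)]_(x in star_domain rho) (hw k a b x * hw (h * k) A B x) = 0.

(* A bounded infinite set of wave numbers accumulates, and then analyticity in [k] gives every
   real wave number. *)
Lemma infinite_orthogonal_unbounded h a b (K : set R) : 0 <= h -> C1_periodic a -> C1_periodic b ->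
  infinite_set K -> (forall k, K k -> 0 < k /\ orthogonal_at h a b k) ->
  forall M, exists2 k, M <= k & orthogonal_at h a b k.
Proof.
move=> h0 Ca Cb Kinf Korth M.
have [[k Kk Mk]|H] := pselect (exists2 k, K k & M <= k); first by exists k => //; exact: (Korth k Kk).2.
have bK : bounded_set K.
  exists M; split; [exact: num_real|move=> x Mx k Kk /=].
  rewrite gtr0_norm ?(Korth k Kk).1// leNgt; apply/negP => xk.
  by apply: H; exists k => //; rewrite ltW// (lt_trans Mx).
have [k0 Kk0] := infinite_bounded_limit_point_nonempty Kinf bK.
(* Any wave number would do here, since the pairing now vanishes identically in k; M itself is the
   simplest one that is at least M. *)
exists M => // A B CA CB.
have [ca cb] := (C1_periodic_continuous Ca, C1_periodic_continuous Cb).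
have [cA cB] := (C1_periodic_continuous CA, C1_periodic_continuous CB).
have := taylor_bounded_pairing rho0 rhop crho h0 ca cb cA cB (C1_periodic_periodic Ca)
  (C1_periodic_periodic Cb) (C1_periodic_periodic CA) (C1_periodic_periodic CB).
move=> /taylor_bounded_eq0 /(_ Kk0); apply => k Kk.
exact: (Korth k Kk).2.
Qed.

End Conclusion.

Lemma C1_periodic_derive1 (R : realType) (f : R -> R) : (forall t, f (t + 2 * pi) = f t) ->
  (forall t, derivable f t 1) -> continuous (derive1 f) -> C1_periodic f.
Proof.
move=> fp fd cf; exists (derive1 f); split => // t.
by rewrite derive1E; exact: derivableP.
Qed.

Unset Implicit Arguments.

Theorem theorem4 (R : realType) (q : R) (rho : R -> R) (N : set R)
  (phir phii : R -> R) :
  1 < q ->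
  radius_function rho ->
  admissible q rho ->
  (* N : relatively open subset of R/(2 pi Z), represented by its
     2pi-periodic open lift to R *)
  open N ->
  (forall t, N t <-> N (t + 2 * pi)) ->
  (@lebesgue_measure R) (N `&` `[0, 2 * pi[%classic) = (pi%:E)%E ->
  closure (N `|` [set t | N (t - pi)]) = setT ->
  (forall t, N t -> derive1 rho t = 0) ->
  {ae @lebesgue_measure R, forall t, N (t - pi) -> derive1 rho t != 0} ->
  (* phi = phir + i phii : C^1 on S^1, not identically zero *)
  (forall t, phir (t + 2 * pi) = phir t) ->
  (forall t, phii (t + 2 * pi) = phii t) ->
  (forall t, derivable phir t 1) -> continuous (derive1 phir) ->
  (forall t, derivable phii t 1) -> continuous (derive1 phii) ->
  (exists t, phir t != 0 \/ phii t != 0) ->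
  finite_set [set k : R | 0 < k /\
    non_scattering (star_domain rho) k q
      (herglotz_re k phir phii) (herglotz_im k phir phii)].
Proof.
move=> q1 [rho0 [rhop [rhod [rhodd crhodd]]]] _ oN Np _ Nd Nc Na pr pi' dr cr di ci [t0 phi0].
apply: contrapT => Kinf.
set K := (X in finite_set X) in Kinf.
have drhoE (t : R) : is_derive t (1 : R) rho (derive1 rho t).
  by rewrite derive1E; exact: derivableP.
have ddrhoE (t : R) : is_derive t (1 : R) (derive1 rho) (derive1 (derive1 rho) t).
  by rewrite [derive1 (derive1 rho) t]derive1E; exact: derivableP.
have crho := is_derive_continuous drhoE.
have h1 : 1 < Num.sqrt q by rewrite -sqrtr1 ltr_sqrt//; lra.
have Cr := C1_periodic_derive1 pr dr cr. have Ci := C1_periodic_derive1 pi' di ci.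
have CNi : C1_periodic (fun t => - phii t).
  rewrite (_ : (fun _ => _) = fun t => -1 * phii t); last by apply/funext => t; rewrite mulN1r.
  by apply: C1_periodicM => //; exact: C1_periodic_cst.
(* The real part has cosine density [phir] and sine density [- phii], the imaginary part [phii] and
   [phir]. *)
have reE k : herglotz_re k phir phii = hw k phir (fun t => - phii t).
  by apply/funext => x; apply: eq_itg => t _; rewrite mulNr.
have imE k : herglotz_im k phir phii = hw k phii phir.
  by apply/funext => x; apply: eq_itg => t _; rewrite addrC.
have orth a b (C_a : C1_periodic a) (C_b : C1_periodic b) :
    (forall k, K k -> 0 < k /\ orthogonal_at rho (Num.sqrt q) a b k) ->
    (forall t, even_half a t = 0 /\ odd_half b t = 0).
  move=> Korth; apply: (dense_vanishing rho0 rhop drhoE ddrhoE crhodd oN Np Nd Nc Na h1 C_a C_b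
    (infinite_orthogonal_unbounded rho0 rhop crho (ltW (lt_trans ltr01 h1)) C_a C_b Kinf Korth)).
  by [].
have hr : forall t, even_half phir t = 0 /\ odd_half (fun t => - phii t) t = 0.
  apply: orth => // k [k0 [ur [ui [ur1 [ur2 [ui1 [ui2 [Hr [_ [_ [_ [Dr [_ [Nr _]]]]]]]]]]]]]]; split=> // A B CA CB.
  rewrite reE in Dr Nr.
  exact: (matching_orthogonal rho0 rhop crho k0 q1 (C1_periodic_continuous Cr) (C1_periodic_continuous CNi)
    Hr Dr Nr (C1_periodic_continuous CA) (C1_periodic_continuous CB)).
have hi : forall t, even_half phii t = 0 /\ odd_half phir t = 0.
  apply: orth => // k [k0 [ur [ui [ur1 [ur2 [ui1 [ui2 [_ [Hi [_ [_ [_ [Di [_ Ni]]]]]]]]]]]]]]; split=> // A B CA CB.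
  rewrite imE in Di Ni.
  exact: (matching_orthogonal rho0 rhop crho k0 q1 (C1_periodic_continuous Ci) (C1_periodic_continuous Cr)
    Hi Di Ni (C1_periodic_continuous CA) (C1_periodic_continuous CB)).
(* The real wave kills the even half of [phir] and the odd half of [phii], the imaginary wave the
   complementary halves; each function is the sum of its two halves. *)
have [r1 i1] := hr t0; have [i2 r2] := hi t0.
have rz : phir t0 = 0 by have <- : even_half phir t0 + odd_half phir t0 = phir t0; [rewrite /even_half /odd_half; field|rewrite r1 r2 addr0].
have iz : phii t0 = 0.
  have : even_half phii t0 - odd_half (fun t => - phii t) t0 = phii t0 by rewrite /even_half /odd_half; field.
  by rewrite i1 i2 subr0.
by case: phi0; rewrite ?rz ?iz eqxx.
Qed.
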